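(* There exist an analytic map $\phi\colon \mathbb{D}\to\mathbb{D}$ and an Orlicz function $\Psi$ such that the composition operator $C_\phi\colon H^\Psi\to H^\Psi$, $C_\phi(f)=f\circ\phi$, is compact, whereas the composition operator $C_\phi\colon \mathfrak{B}^\Psi\to\mathfrak{B}^\Psi$ is not compact.
   Context: $\mathbb{D}=\{z\in\mathbb{C}: |z|<1\}$, $\mathbb{T}=\partial\mathbb{D}$, $\mathcal{A}$ is the normalized area measure $dx\,dy/\pi$ on $\mathbb{D}$, and $m$ is the normalized Lebesgue measure on $\mathbb{T}$. An Orlicz function is a nonnegative increasing convex function $\Psi\colon[0,\infty)\to[0,\infty)$ with $\Psi(0)=0$, $\Psi(x)>0$ for $x>0$, and $\Psi(x)\to\infty$ as $x\to\infty$. For a positive measure $\mu$, $L^\Psi(\mu)$ is the space of measurable $f$ with $\int\Psi(|f|/C)\,d\mu<\infty$ for some $C>0$, normed by $\|f\|_\Psi=\inf\{C>0:\int\Psi(|f|/C)\,d\mu\le 1\}$. The Bergman–Orlicz space $\mathfrak{B}^\Psi$ is the subspace of $L^\Psi(\mathbb{D},\mathcal{A})$ of functions analytic in $\mathbb{D}$. The Hardy–Orlicz space $H^\Psi$ is the space of $f$ in the Hardy space $H^1$ whose boundary values $f^*$ belong to $L^\Psi(\mathbb{T},m)$, normed by $\|f^*\|_{L^\Psi(m)}$. For every analytic $\phi\colon\mathbb{D}\to\mathbb{D}$, $C_\phi$ is bounded on both spaces; compact means it maps bounded sets to relatively compact sets. *)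

(* Defs.v *)
From HB Require Import structures.
From mathcomp Require Import all_boot all_order all_algebra.
From mathcomp Require Import all_classical all_reals all_analysis.
From mathcomp Require Import complex.
Set Implicit Arguments. Unset Strict Implicit. Unset Printing Implicit Defensive.
Import Order.TTheory GRing.Theory Num.Theory.
Import numFieldNormedType.Exports.
Local Open Scope classical_set_scope.
Local Open Scope ring_scope.

Section OrliczDefs.
Variable R : realType.

Definition cabs (z : R[i]) : R := Normc.normc z.

Definition disc : set R[i] := [set z | cabs z < 1].

Definition cplx (p : R * R) : R[i] := Complex p.1 p.2.

Definition discRR : set (R * R) := [set p | cabs (cplx p) < 1].

Definition expi (t : R) : R[i] := Complex (cos t) (sin t).

(* analytic (holomorphic) in D: complex differentiable at every point of D *)
Definition analytic_in_disc (f : R[i] -> R[i]) : Prop :=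
  forall z : R[i], cabs z < 1 -> derivable (f : R[i]^o -> R[i]^o) z 1.

Definition analytic_selfmap (phi : R[i] -> R[i]) : Prop :=
  analytic_in_disc phi /\ forall z, cabs z < 1 -> cabs (phi z) < 1.

Definition Orlicz (Psi : R -> R) : Prop :=
  [/\ Psi 0 = 0,
      (forall x, 0 < x -> 0 < Psi x),
      (forall x y, 0 <= x -> x <= y -> Psi x <= Psi y),
      (forall x y t, 0 <= x -> 0 <= y -> 0 <= t -> t <= 1 ->
          Psi (t * x + (1 - t) * y) <= t * Psi x + (1 - t) * Psi y)
    & (forall M : R, exists x0 : R, forall x, x0 <= x -> M <= Psi x)].

Definition area_factor : R := (pi : R)^-1.
Definition circle_factor : R := (2 * (pi : R))^-1.
Definition two_pi : R := 2 * pi.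
Definition circle_arc : set R := `[0, two_pi[.

Definition area_int (h : R[i] -> \bar R) : \bar R :=
  (area_factor%:E * \int[(@lebesgue_measure R) \x (@lebesgue_measure R)]_(p in discRR)
      h (cplx p))%E.

Definition circle_int (h : R[i] -> \bar R) : \bar R :=
  (circle_factor%:E * \int[@lebesgue_measure R]_(t in circle_arc) h (expi t))%E.

Definition modular (I : (R[i] -> \bar R) -> \bar R) (Psi : R -> R)
  (g : R[i] -> R[i]) (C : R) : \bar R :=
  I (fun z => (Psi (cabs (g z) / C))%:E).

Definition lux_norm (I : (R[i] -> \bar R) -> \bar R) (Psi : R -> R)
  (g : R[i] -> R[i]) : R :=
  inf [set C : R | 0 < C /\ (modular I Psi g C <= 1)%E].

Definition in_LPsi_area (Psi : R -> R) (g : R[i] -> R[i]) : Prop :=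
  [/\ measurable_fun discRR (fun p => @complex.Re R (g (cplx p))),
      measurable_fun discRR (fun p => @complex.Im R (g (cplx p)))
    & exists C : R, 0 < C /\ (modular area_int Psi g C < +oo)%E].

Definition in_LPsi_circle (Psi : R -> R) (g : R[i] -> R[i]) : Prop :=
  [/\ measurable_fun circle_arc (fun t => @complex.Re R (g (expi t))),
      measurable_fun circle_arc (fun t => @complex.Im R (g (expi t)))
    & exists C : R, 0 < C /\ (modular circle_int Psi g C < +oo)%E].

Definition bergman_orlicz (Psi : R -> R) (f : R[i] -> R[i]) : Prop :=
  analytic_in_disc f /\ in_LPsi_area Psi f.
Definition bergman_norm (Psi : R -> R) (f : R[i] -> R[i]) : R :=
  lux_norm area_int Psi f.

Definition hardy1 (f : R[i] -> R[i]) : Prop :=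
  analytic_in_disc f /\
  exists M : R, forall r : R, 0 <= r -> r < 1 ->
    (circle_int (fun z => (cabs (f ((r%:C)%C * z)))%:E) <= M%:E)%E.

Definition boundary (f : R[i] -> R[i]) (z : R[i]) : R[i] :=
  if `[< cvg ((fun r : R => (f ((r%:C)%C * z) : R[i]^o)) @ at_left (1 : R)) >]
  then lim ((fun r : R => (f ((r%:C)%C * z) : R[i]^o)) @ at_left (1 : R))
  else 0.

Definition hardy_orlicz (Psi : R -> R) (f : R[i] -> R[i]) : Prop :=
  hardy1 f /\ in_LPsi_circle Psi (boundary f).
Definition hardy_norm (Psi : R -> R) (f : R[i] -> R[i]) : R :=
  lux_norm circle_int Psi (boundary f).

Definition comp_op (phi : R[i] -> R[i]) (f : R[i] -> R[i]) : R[i] -> R[i] :=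
  fun z => f (phi z).

(* compact operator T on the normed space (X, nrm): the image of every bounded
   sequence has a subsequence converging in norm to an element of X
   (sequential relative compactness of the image of bounded sets; X is a
   Banach, hence metric, space) *)
Definition compact_op (X : (R[i] -> R[i]) -> Prop) (nrm : (R[i] -> R[i]) -> R)
  (T : (R[i] -> R[i]) -> (R[i] -> R[i])) : Prop :=
  forall u : nat -> (R[i] -> R[i]),
    (forall n, X (u n)) ->
    (exists M : R, forall n, nrm (u n) <= M) ->
    exists (sigma : nat -> nat) (g : R[i] -> R[i]),
      [/\ (forall m n, (m < n)%N -> (sigma m < sigma n)%N),
          X g
        & (fun n => nrm (fun z => T (u (sigma n)) z - g z)) @ \oo --> (0 : R)].

End OrliczDefs.

(* Main.v *)
(* Psi and phi are built from one lacunary sequence T_k with T_(k+1) = T_k^12.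
   Psi is the supremum of x and of the lines T_k^3 (x - T_k); thus
   Psi(x) <= T_k^3 x for x <= T_(k+1), but Psi(2 T_(k+1)) >= T_(k+1)^4.  With
   u = 1 - z, b_k = T_k^-10 and e_k = T_k^-11, let phi = 1 - w where
   w = sum_k b_k u / (u + e_(k+1)); each quotient lies in the disc with diameter
   [0, 1], so |phi|^2 <= 1 - Re w, whence 1 - |phi| >= b_k / 8 for |u| >= e_(k+1),
   while |w| <= 3 b_k for |u| <= b_k e_k.

   Compactness on H^Psi: a function f of the unit ball satisfies
   |f(a)| = O(T_k^7) for |a| <= 1 - b_k / 8, and Psi of this is O(T_k^10).  The arc
   |u| < 2 e_k has length O(T_k^-11), so all the functions Psi(L |f o phi|) have a
   common integrable majorant on the circle, and a subsequence given by Montel's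
   theorem converges in norm by dominated convergence.

   Noncompactness on B^Psi: the functions T_(k+1) (b_k / (u + b_k))^8 are bounded
   in norm, since Psi(T_(k+1)) <= T_k^15 and they are at most 1 outside
   |u| < T_k^-8.  Composed with phi they tend to 0 pointwise, but are still of
   order T_(k+1) on a square of area of order T_k^-42, where Psi is at least T_k^48.

   The growth estimate in H^Psi rests on |f(a)| <= 2 int P_a |f^*| dm for f in H^1.
   Let W be analytic with |f| <= Re W (Herglotz integrals and Montel).  The bounded
   functions f / (1 + W/k)^2 are Poisson integrals of their radial limits by Fatou's
   theorem; the latter follows from a weak-type maximal inequality and from the
   L^2 convergence of dilations.  The Cauchy theory is derived from Goursat's
   theorem in polar coordinates. *)

Require Import Defs.
From HB Require Import structures.
From mathcomp Require Import all_boot all_order all_algebra.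
From mathcomp Require Import all_classical all_reals all_analysis.
From mathcomp Require Import measurable_realfun complex.
From mathcomp Require Import ring lra.
Set Implicit Arguments. Unset Strict Implicit. Unset Printing Implicit Defensive.
Import Order.TTheory GRing.Theory Num.Theory numFieldNormedType.Exports.
Local Open Scope classical_set_scope.
Local Open Scope ring_scope.

(** * Complex differentiability *)

(** At distance d from the circle, the height of a unit-ball function is limited by about
    Psi^-1(1/d) in H^Psi and Psi^-1(1/d^2) in B^Psi. Now Psi(T_(k+1)) is about T_k^15 = b_k^(-3/2),
    between b_k^-1 and b_k^-2: at distance b_k the height T_(k+1) is out of reach in H^Psi but
    attained in B^Psi. The map exploits this gap: it stays at distance comparable to b_k from 1
    throughout e_(k+1) <= |u| <= b_k e_k, so the circle comes closer only on a tiny arc, whereas a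
    square whose side is a fixed power of T_k is sent to where the peak lives. The smallness of that
    square is outweighed because Psi violates the doubling condition: just past T_(k+1), a constant
    factor gains a power of T_(k+1). With the other exponents fixed, 12 answers three demands: 12 >=
    8 keeps multiples of T_k^7 below T_(k+1) for large k, 3 + 12 <= 16 keeps the peaks bounded in
    norm, and 4 * 12 > 42 makes the composed peaks large. *)

Section ComplexBasics.
Variable R : realType.
Implicit Types (z w : R[i]) (x y : R).
Local Notation Re := (@complex.Re R).
Local Notation Im := (@complex.Im R).

Lemma normcE z : `|z| = ((cabs z)%:C)%C.
Proof. by []. Qed.

Lemma cabs_ge0 z : 0 <= cabs z.
Proof. by case: z => a b; exact: sqrtr_ge0. Qed.

Lemma cabs0 : cabs (0 : R[i]) = 0.
Proof. exact: Normc.normc0. Qed.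

Lemma cabs1 : cabs (1 : R[i]) = 1.
Proof. exact: Normc.normc1. Qed.

Lemma cabsM z w : cabs (z * w) = cabs z * cabs w.
Proof. exact: Normc.normcM. Qed.

Lemma cabsV z : cabs z^-1 = (cabs z)^-1.
Proof. exact: Normc.normcV. Qed.

Lemma cabsN z : cabs (- z) = cabs z.
Proof. by case: z => a b; rewrite /cabs /= !sqrrN. Qed.

Lemma cabsBC z w : cabs (z - w) = cabs (w - z).
Proof. by rewrite -cabsN opprB. Qed.

Lemma cabsD z w : cabs (z + w) <= cabs z + cabs w.
Proof. have -> : (cabs z + cabs w = Re (`|z| + `|w|)) by rewrite !normcE.
have : `|z + w| <= `|z| + `|w| by exact: ler_normD.
by rewrite {1}normcE lecE => /andP[]. Qed.

Lemma cabsB z w : cabs (z - w) <= cabs z + cabs w.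
Proof. by rewrite -(cabsN w) cabsD. Qed.

Lemma cabs_dist z w : `|cabs z - cabs w| <= cabs (z - w).
Proof.
have h (a b : R[i]) : cabs a - cabs b <= cabs (a - b).
  by rewrite lerBlDr -{1}(subrK b a) cabsD.
by rewrite ler_norml h andbT lerNl opprB cabsBC h.
Qed.

Lemma cabsX z n : cabs (z ^+ n) = cabs z ^+ n.
Proof. by elim: n => [|n IH]; rewrite ?expr0 ?cabs1// !exprS cabsM IH. Qed.

Lemma cabs_eq0 z : (cabs z == 0) = (z == 0).
Proof.
by apply/eqP/eqP => [/Normc.eq0_normc//|->]; rewrite cabs0.
Qed.

Lemma cabs_gt0 z : (0 < cabs z) = (z != 0).
Proof. by rewrite lt_neqAle cabs_ge0 andbT eq_sym cabs_eq0. Qed.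

Lemma cabs_real x : cabs (x%:C)%C = `|x|.
Proof. by rewrite /cabs /= expr0n/= addr0 sqrtr_sqr. Qed.

Lemma cabs_sqr z : cabs z ^+ 2 = Re z ^+ 2 + Im z ^+ 2.
Proof. by case: z => a b; rewrite /cabs /= sqr_sqrtr// addr_ge0 ?sqr_ge0. Qed.

Lemma Re_le_cabs z : `|Re z| <= cabs z.
Proof.
rewrite -(@ler_pXn2r _ 2)// ?nnegrE ?cabs_ge0//.
by rewrite cabs_sqr real_normK ?num_real// lerDl sqr_ge0.
Qed.

Lemma Im_le_cabs z : `|Im z| <= cabs z.
Proof.
rewrite -(@ler_pXn2r _ 2)// ?nnegrE ?cabs_ge0//.
by rewrite cabs_sqr real_normK ?num_real// lerDr sqr_ge0.
Qed.

Lemma ReD z w : Re (z + w) = Re z + Re w. Proof. by case: z; case: w. Qed.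
Lemma ImD z w : Im (z + w) = Im z + Im w. Proof. by case: z; case: w. Qed.
Lemma ReN z : Re (- z) = - Re z. Proof. by case: z. Qed.
Lemma ImN z : Im (- z) = - Im z. Proof. by case: z. Qed.
Lemma ReM z w : Re (z * w) = Re z * Re w - Im z * Im w.
Proof. by case: z; case: w. Qed.
Lemma ImM z w : Im (z * w) = Re z * Im w + Im z * Re w.
Proof. by case: z; case: w. Qed.
Definition cplxE := (ReD, ReN, ReM, ImD, ImN, ImM).

Lemma complex_eq z w : Re z = Re w -> Im z = Im w -> z = w.
Proof. by case: z => a b; case: w => c d /= -> ->. Qed.

Lemma cabs_conj z : cabs (conjc z) = cabs z.
Proof. by case: z => a b; rewrite /cabs /= sqrrN. Qed.

Lemma cabs_le_ReIm z : cabs z <= `|Re z| + `|Im z|.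
Proof.
rewrite -(@ler_pXn2r _ 2)// ?nnegrE ?cabs_ge0 ?addr_ge0//.
rewrite cabs_sqr sqrrD !real_normK ?num_real// lerD2r lerDl.
by rewrite mulrn_wge0// mulr_ge0.
Qed.

Lemma cabs_expi t : cabs (@expi R t) = 1.
Proof. by rewrite /cabs /expi /= cos2Dsin2 sqrtr1. Qed.

Lemma cabs_scale x t : 0 <= x -> cabs ((x%:C)%C * @expi R t) = x.
Proof. by move=> x0; rewrite cabsM cabs_expi mulr1 cabs_real ger0_norm. Qed.

Lemma expiD s t : @expi R (s + t) = expi s * expi t.
Proof. by apply: complex_eq; rewrite cplxE /= ?cosD ?sinD//; ring. Qed.

Lemma expi_conj t : conjc (@expi R t) = (expi t)^-1.
Proof.
apply: (@mulfI _ (expi t)); first by rewrite -cabs_eq0 cabs_expi oner_eq0.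
rewrite mulfV -?cabs_eq0 ?cabs_expi ?oner_eq0//.
apply: complex_eq; rewrite cplxE /=; last by ring.
by rewrite -(cos2Dsin2 t); ring.
Qed.

(** Stated over any field because it turns difference quotients into first-order expansions both for
    complex and for real derivatives. *)
Lemma difference_quotientE (F : fieldType) (l a h : F) : h != 0 ->
  l - h^-1 * a = - (h^-1 * (a - l * h)).
Proof. by move=> h0; field. Qed.

(** Balls of [R[i]^o] have radii in [R[i]]; positivity in that order forces the imaginary part to
    vanish, so real radii suffice. *)
Lemma nbhs_cabsP (z : R[i]^o) (P : set R[i]^o) :
  nbhs z P <-> exists2 d : R, 0 < d & forall w : R[i], cabs (w - z) < d -> P w.
Proof.
split.
  move=> /nbhs_ballP[e /= e0 H].
  exists (Re e).
    by move: e0; rewrite ltcE => /andP[].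
  move=> w wd; apply: H; rewrite -ball_normE /= distrC normcE.
  move: e0; rewrite !ltcE /= => /andP[/eqP -> _]; by rewrite eqxx.
move=> [d d0 H]; apply/nbhs_ballP; exists (d%:C)%C; first by rewrite /= ltcR.
by move=> w; rewrite -ball_normE /= distrC normcE ltcR; exact: H.
Qed.

(** Differentiability as an expansion without division: [w = z] is not excluded, which makes
    composition painless. *)
Definition cdiff (f : R[i] -> R[i]) z (c : R[i]) := forall e : R, 0 < e ->
  exists2 d : R, 0 < d & forall w, cabs (w - z) < d ->
    cabs (f w - f z - c * (w - z)) <= e * cabs (w - z).

Definition ccont (f : R[i] -> R[i]) z := forall e : R, 0 < e ->
  exists2 d : R, 0 < d & forall w, cabs (w - z) < d -> cabs (f w - f z) <= e.

Lemma derivable_cdiff (f : R[i] -> R[i]) z :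
  derivable (f : R[i]^o -> R[i]^o) z 1 <-> exists c, cdiff f z c.
Proof.
split.
  move=> df; exists ('D_1 (f : R[i]^o -> R[i]^o) (z : R[i]^o)) => e e0.
  have := df; move=> /cvg_ex /= [l Hl].
  have -> : 'D_1 (f : R[i]^o -> R[i]^o) (z : R[i]^o) = l by exact: cvg_lim Hl.
  move/cvgrPdist_le : Hl => /(_ (e%:C)%C); rewrite ltcR => /(_ e0).
  rewrite /= near_withinE => /nbhs_cabsP[d d0 H].
  exists d => // w wd.
  have [->|wz] := eqVneq w z; first by rewrite !subrr mulr0 subrr cabs0 mulr0.
  have wz0 : w - z != 0 by rewrite subr_eq0.
  have := H (w - z); rewrite subr0 => /(_ wd wz0).
  rewrite normcE lecR /=.
  have -> : l - (w - z)^-1 *: (f ((w - z) *: 1 + z) - f z) =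
            - ((w - z)^-1 * (f w - f z - l * (w - z))).
    by rewrite -difference_quotientE// /GRing.scale/= mulr1 subrK.
  by rewrite cabsN cabsM cabsV ler_pdivrMl ?cabs_gt0// [e * _]mulrC.
move=> [c H]; apply/cvg_ex; exists c; apply/cvgrPdist_le => e.
rewrite ltcE /= => /andP[/eqP Ime Ree].
have [d d0 {}H] := H _ Ree.
rewrite near_withinE; apply/nbhs_cabsP; exists d => // w.
rewrite subr0 => wd w0; rewrite normcE lecE /= Ime eqxx /=.
have := H (w + z); rewrite addrK => /(_ wd).
have -> : c - w^-1 *: (f (w *: 1 + z) - f z) =
            - (w^-1 * (f (w + z) - f z - c * w)).
  by rewrite -difference_quotientE// /GRing.scale/= mulr1.
by rewrite cabsN cabsM cabsV ler_pdivrMl ?cabs_gt0// [_ * cabs w]mulrC.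
Qed.

Lemma continuous_ccont (f : R[i] -> R[i]) z :
  {for z, continuous (f : R[i]^o -> R[i]^o)} <-> ccont f z.
Proof.
split.
  move=> /cvgrPdist_le H e e0.
  have := H (e%:C)%C; rewrite ltcR => /(_ e0) /nbhs_cabsP[d d0 {}H].
  by exists d => // w /H; rewrite normcE lecR cabsBC.
move=> H; apply/(@cvgrPdist_le R[i] R[i]^o R[i]^o (nbhs (z : R[i]^o)) _ (f : R[i]^o -> R[i]^o)) => e; rewrite ltcE => /= /andP[/eqP Ime Ree].
have [d d0 {}H] := H _ Ree; apply/nbhs_cabsP; exists d => // w /H.
by rewrite cabsBC normcE lecE /= Ime eqxx.
Qed.

Definition cdiffable f z := exists c, cdiff f z c.

Lemma cdiff_ccont f z c : cdiff f z c -> ccont f z.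
Proof.
move=> H; apply/continuous_ccont.
by apply: differentiable_continuous; apply/derivable1_diffP/derivable_cdiff; exists c.
Qed.

Lemma cdiffable_ccont f z : cdiffable f z -> ccont f z.
Proof. by case=> c; exact: cdiff_ccont. Qed.

Lemma cdiffable_cst k z : cdiffable (fun=> k) z.
Proof. by apply/derivable_cdiff; exact: derivable_cst. Qed.

Lemma cdiffable_id z : cdiffable id z.
Proof. by apply/derivable_cdiff; exact: derivable_id. Qed.

Let derivD (f g : R[i]^o -> R[i]^o) (z : R[i]^o) :
  derivable f z 1 -> derivable g z 1 -> derivable (fun u : R[i]^o => f u + g u) z 1.
Proof. exact: derivableD. Qed.

Let derivM (f g : R[i]^o -> R[i]^o) (z : R[i]^o) :
  derivable f z 1 -> derivable g z 1 -> derivable (fun u : R[i]^o => f u * g u) z 1.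
Proof. exact: derivableM. Qed.

Lemma cdiffableD f g z : cdiffable f z -> cdiffable g z ->
  cdiffable (fun w => f w + g w) z.
Proof. by move=> /derivable_cdiff ? /derivable_cdiff ?; apply/derivable_cdiff; exact: derivD. Qed.

Lemma cdiffableN f z : cdiffable f z -> cdiffable (fun w => - f w) z.
Proof. by move=> /derivable_cdiff ?; apply/derivable_cdiff; exact: (@derivableN R[i] R[i]^o R[i]^o (f : R[i]^o -> R[i]^o) z 1). Qed.

Lemma cdiffableB f g z : cdiffable f z -> cdiffable g z ->
  cdiffable (fun w => f w - g w) z.
Proof. by move=> ? ?; apply: cdiffableD => //; exact: cdiffableN. Qed.

Lemma cdiffableM f g z : cdiffable f z -> cdiffable g z ->
  cdiffable (fun w => f w * g w) z.
Proof. by move=> /derivable_cdiff ? /derivable_cdiff ?; apply/derivable_cdiff; exact: derivM. Qed.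

Lemma cdiffableV f z : cdiffable f z -> f z != 0 -> cdiffable (fun w => (f w)^-1) z.
Proof. by move=> /derivable_cdiff ? ?; apply/derivable_cdiff; exact: (@derivableV R[i] R[i]^o (f : R[i]^o -> R[i]^o) z 1). Qed.

Lemma cdiffableX f n z : cdiffable f z -> cdiffable (fun w => f w ^+ n) z.
Proof.
move=> df; elim: n => [|n IH].
  by rewrite [X in cdiffable X](_ : _ = fun=> 1)//; exact: cdiffable_cst.
rewrite [X in cdiffable X](_ : _ = fun w => f w * f w ^+ n); first exact: cdiffableM.
by apply/funext => w; rewrite exprS.
Qed.

Lemma cdiffable_comp f g z : cdiffable f z -> cdiffable g (f z) ->
  cdiffable (fun w => g (f w)) z.
Proof.
move=> [c Hf] [k Hg]; exists (k * c) => e e0.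
have c1 : 0 < cabs c + 1 by rewrite ltr_wpDl// cabs_ge0.
have k1 : 0 < cabs k + 1 by rewrite ltr_wpDl// cabs_ge0.
have e1 : 0 < e / (2 * (cabs c + 1)) by rewrite divr_gt0// mulr_gt0.
(* The entry [1] yields the Lipschitz-type bound [fw]; the other entry makes the error of [f],
   multiplied by [k], at most half of the target. *)
have e2 : 0 < Num.min 1 (e / (2 * (cabs k + 1))) by rewrite lt_min ltr01 divr_gt0// mulr_gt0.
have [d1 d10 {}Hg] := Hg _ e1; have [d2 d20 {}Hf] := Hf _ e2.
exists (Num.min d2 (d1 / (cabs c + 1))); first by rewrite lt_min d20 divr_gt0.
move=> w; rewrite lt_min ltr_pdivlMr// => /andP[/Hf hf wd1].
have fw : cabs (f w - f z) <= (cabs c + 1) * cabs (w - z).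
  rewrite -(subrK (c * (w - z)) (f w - f z)) (le_trans (cabsD _ _))// cabsM mulrDl mul1r addrC lerD2l.
  by rewrite (le_trans hf)// ler_piMl ?cabs_ge0// ge_min lexx.
have {}Hg := Hg (f w) _.
have -> : g (f w) - g (f z) - k * c * (w - z) =
    (g (f w) - g (f z) - k * (f w - f z)) + k * (f w - f z - c * (w - z)) by ring.
rewrite (le_trans (cabsD _ _))// (_ : e = e / 2 + e / 2); last by field.
rewrite mulrDl lerD//.
  rewrite (le_trans (Hg _))//; first by rewrite (le_lt_trans fw)// mulrC.
  rewrite (le_trans (ler_wpM2l (ltW e1) fw))// [leLHS](_ : _ = e / 2 * cabs (w - z))//.
  by field; rewrite gt_eqF.
rewrite cabsM (le_trans (ler_wpM2l (cabs_ge0 _) hf))// mulrA ler_wpM2r ?cabs_ge0//.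
have mle : Num.min 1 (e / (2 * (cabs k + 1))) <= e / (2 * (cabs k + 1)).
  by rewrite ge_min lexx orbT.
apply: le_trans (ler_wpM2l (cabs_ge0 k) mle) _.
rewrite mulrA ler_pdivrMr ?mulr_gt0//.
have -> : e / 2 * (2 * (cabs k + 1)) = cabs k * e + e by field.
by rewrite lerDl ltW.
Qed.

Lemma cdiffable_near f g z (d : R) : 0 < d -> (forall w, cabs (w - z) < d -> f w = g w) ->
  cdiffable f z -> cdiffable g z.
Proof.
move=> d0 fg [c H]; exists c => e /H[d1 d10 {}H].
exists (Num.min d d1); first by rewrite lt_min d0.
move=> w; rewrite lt_min => /andP[wd wd1]; rewrite -!fg//; first exact: H.
by rewrite subrr cabs0.
Qed.

End ComplexBasics.

(** * Goursat's theorem on rectangles *)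

Section Cousin.
Variable R : realType.
Implicit Types (a b c d x y : R).

(** Bisection: a rectangle violating [P] has a violating quarter, and the nested violating quarters
    shrink to a point where the local hypothesis is contradicted. It serves Goursat's theorem and,
    with one side degenerate, replaces compactness of a segment. *)
Lemma cousin2 (P : R -> R -> R -> R -> Prop) a b c d : a <= b -> c <= d ->
  (forall a' b' c' d', a <= a' -> a' <= b' -> b' <= b ->
     c <= c' -> c' <= d' -> d' <= d ->
     P a' ((a' + b') / 2) c' ((c' + d') / 2) ->
     P ((a' + b') / 2) b' c' ((c' + d') / 2) ->
     P a' ((a' + b') / 2) ((c' + d') / 2) d' ->
     P ((a' + b') / 2) b' ((c' + d') / 2) d' -> P a' b' c' d') ->
  (forall x y, a <= x -> x <= b -> c <= y -> y <= d ->
     exists2 e : R, 0 < e & forall a' b' c' d',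
     a <= a' -> a' <= x -> x <= b' -> b' <= b ->
     c <= c' -> c' <= y -> y <= d' -> d' <= d ->
     b' - a' < e -> d' - c' < e -> P a' b' c' d') ->
  P a b c d.
Proof.
move=> ab cd glue loc; apply: contrapT => nP.
pose bad (r : R * R * R * R) := let '(a', b', c', d') := r in
  [/\ [/\ a <= a', a' <= b' & b' <= b], [/\ c <= c', c' <= d' & d' <= d] & ~ P a' b' c' d'].
pose sub (r s : R * R * R * R) := let '(a', b', c', d') := r in
  let '(a1, b1, c1, d1) := s in
  [/\ a' <= a1, b1 <= b', c' <= c1, d1 <= d' &
   b1 - a1 = (b' - a') / 2 /\ d1 - c1 = (d' - c') / 2].
have step (r : {r | bad r}) : {s : {r | bad r} | sub (sval r) (sval s)}.
  case: r => -[[[a' b'] c'] d'] /= [[aa ab' bb] [cc cd' dd] nP'].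
  apply: cid; set m := (a' + b') / 2; set n := (c' + d') / 2.
  have am : a' <= m by rewrite /m; lra.
  have mb : m <= b' by rewrite /m; lra.
  have cn : c' <= n by rewrite /n; lra.
  have nd : n <= d' by rewrite /n; lra.
  have mk a1 b1 c1 d1 : sub (a', b', c', d') (a1, b1, c1, d1) ->
      a1 <= b1 -> c1 <= d1 -> ~ P a1 b1 c1 d1 ->
      exists x : {r | bad r}, sub (a', b', c', d') (sval x).
    move=> [s1 s2 s3 s4 [s5 s6]] h1 h2 nP1.
    have B : bad (a1, b1, c1, d1).
      split => //; split => //; [exact: le_trans s1|exact: le_trans bb|exact: le_trans s3|exact: le_trans dd].
    by exists (exist _ _ B); split.
  have [p1|np1] := pselect (P a' m c' n); last first.
    by apply: mk np1 => //; split => //; rewrite /m /n; split; lra.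
  have [p2|np2] := pselect (P m b' c' n); last first.
    by apply: mk np2 => //; split => //; rewrite /m /n; split; lra.
  have [p3|np3] := pselect (P a' m n d'); last first.
    by apply: mk np3 => //; split => //; rewrite /m /n; split; lra.
  have [p4|np4] := pselect (P m b' n d'); last first.
    by apply: mk np4 => //; split => //; rewrite /m /n; split; lra.
  by exfalso; apply: nP'; exact: glue.
have B0 : bad (a, b, c, d) by split => //; split.
pose s := fix s n : {r | bad r} :=
  if n is k.+1 then sval (step (s k)) else exist _ _ B0.
pose A n := (sval (s n)).1.1.1; pose B n := (sval (s n)).1.1.2.
pose C n := (sval (s n)).1.2; pose D n := (sval (s n)).2.
have sE n : sval (s n) = (A n, B n, C n, D n).
  by rewrite /A /B /C /D; case: (sval (s n)) => -[[]].
have bs n : bad (A n, B n, C n, D n) by rewrite -sE; exact: (svalP (s n)).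
have ss n : sub (A n, B n, C n, D n) (A n.+1, B n.+1, C n.+1, D n.+1).
  by rewrite -!sE; exact: (svalP (step (s n))).
have len n : B n - A n = (b - a) / 2 ^+ n /\ D n - C n = (d - c) / 2 ^+ n.
  elim: n => [|n [IH1 IH2]]; first by rewrite /A /B /C /D /= !expr0 !divr1.
  have [_ _ _ _ [-> ->]] := ss n.
  by rewrite IH1 IH2 exprSr invfM !mulrA.
have mono n k : [/\ A n <= A (n + k)%N, B (n + k)%N <= B n, C n <= C (n + k)%N
    & D (n + k)%N <= D n].
  elim: k => [|k [h1 h2 h3 h4]]; first by rewrite addn0.
  rewrite addnS; have [g1 g2 g3 g4 _] := ss (n + k)%N.
  by split; [exact: le_trans g1|exact: le_trans h2|exact: le_trans g3|exact: le_trans h4].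
have AB n k : A n <= B k.
  have [h1 _ _ _] := mono n k; have [_ h2 _ _] := mono k n.
  rewrite addnC in h2; have [[_ h3 _] _ _] := bs (n + k)%N.
  exact: le_trans h1 (le_trans h3 h2).
have CD n k : C n <= D k.
  have [_ _ h1 _] := mono n k; have [_ _ _ h2] := mono k n.
  rewrite addnC in h2; have [_ [_ h3 _] _] := bs (n + k)%N.
  exact: le_trans h1 (le_trans h3 h2).
pose x := sup (range A); pose y := sup (range C).
have Ax n : A n <= x.
  apply: ub_le_sup; last by exists n.
  by exists (B 0%N) => _ [k _ <-].
have xB n : x <= B n.
  by apply: sup_le_ub; [exists (A 0%N), 0%N|move=> _ [k _ <-]].
have Cy n : C n <= y.
  apply: ub_le_sup; last by exists n.
  by exists (D 0%N) => _ [k _ <-].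
have yD n : y <= D n.
  by apply: sup_le_ub; [exists (C 0%N), 0%N|move=> _ [k _ <-]].
have [e e0 He] := loc x y (Ax 0%N) (xB 0%N) (Cy 0%N) (yD 0%N).
have [n nlarge] : exists n, (b - a) / 2 ^+ n < e /\ (d - c) / 2 ^+ n < e.
  pose K := b - a + (d - c); have K0 : 0 <= K by rewrite /K; lra.
  pose n := (Num.truncn (K / e)).+1; exists n.
  have Kn : K < n%:R * e by rewrite -ltr_pdivrMr// truncnS_gt.
  have n2 : n%:R < 2 ^+ n :> R by rewrite -natrX ltr_nat ltn_expl.
  have p2 : 0 < 2 ^+ n :> R by rewrite exprn_gt0.
  rewrite !ltr_pdivrMr//.
  have : n%:R * e < e * 2 ^+ n by rewrite mulrC ltr_pM2l.
  by rewrite /K in Kn *; lra.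
have [l1 l2] := len n; have [[h1 h2 h3] [h4 h5 h6] nPn] := bs n.
by apply: nPn; apply: He => //; rewrite ?l1 ?l2; case: nlarge.
Qed.

End Cousin.

(** * Integrals of complex functions over real segments *)

Section SegmentIntegral.
Variable R : realType.
Local Notation mu := (@lebesgue_measure R).
Local Notation Re := (@complex.Re R).
Local Notation Im := (@complex.Im R).
Implicit Types (a b c d e x y : R) (F G : R -> R[i]).

Definition segcont a b F := forall x, a <= x <= b -> forall e : R, 0 < e ->
  exists2 d : R, 0 < d & forall y, a <= y <= b -> `|y - x| < d -> cabs (F y - F x) <= e.

Lemma segcont_within a b F : segcont a b F ->
  {within `[a, b], continuous (fun x => Re (F x))} /\
  {within `[a, b], continuous (fun x => Im (F x))}.
Proof.
move=> cF; split; apply/subspace_continuousP => x /=.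
all: rewrite in_itv /= => xab; apply/cvgrPdist_le => e e0.
all: have [d d0 H] := cF x xab e e0.
all: rewrite near_withinE; apply/nbhs_ballP; exists d => //= y.
all: rewrite /ball /= in_itv /= => xy /H; rewrite distrC => /(_ xy).
all: rewrite cabsBC => h; apply: le_trans h.
  by rewrite -ReN -ReD Re_le_cabs.
by rewrite -ImN -ImD Im_le_cabs.
Qed.

Lemma segcont_integrable a b F : segcont a b F ->
  mu.-integrable `[a, b] (EFin \o (Re \o F)) /\
  mu.-integrable `[a, b] (EFin \o (Im \o F)).
Proof.
move=> /segcont_within[h1 h2].
by split; apply: continuous_compact_integrable => //; exact: segment_compact.
Qed.

Definition sint a b F : R[i] :=
  Complex (\int[mu]_(x in `[a, b]) Re (F x)) (\int[mu]_(x in `[a, b]) Im (F x)).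

Lemma segcont_sub a b a' b' F : a <= a' -> b' <= b -> segcont a b F -> segcont a' b' F.
Proof.
move=> aa bb cF x /andP[ax xb] e e0.
have [|d d0 H] := cF x _ e e0; first by rewrite (le_trans aa)//= (le_trans xb).
exists d => // y /andP[ay yb]; apply: H; by rewrite (le_trans aa)//= (le_trans yb).
Qed.

Lemma segcontD a b F G : segcont a b F -> segcont a b G -> segcont a b (fun x => F x + G x).
Proof.
move=> cF cG x xab e e0.
have e20 : 0 < e / 2 by lra.
have [d1 d10 H1] := cF x xab _ e20; have [d2 d20 H2] := cG x xab _ e20.
exists (Num.min d1 d2); first by rewrite lt_min d10.
move=> y yab; rewrite lt_min => /andP[/H1-/(_ yab) h1 /H2-/(_ yab) h2].
rewrite opprD addrACA (le_trans (cabsD _ _))//; lra.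
Qed.

Lemma segcontN a b F : segcont a b F -> segcont a b (fun x => - F x).
Proof.
move=> cF x xab e e0; have [d1 d10 H1] := cF x xab _ e0; exists d1 => // y yab /H1-/(_ yab).
by rewrite -opprD cabsN.
Qed.

Lemma sintD a b F G : segcont a b F -> segcont a b G ->
  sint a b (fun x => F x + G x) = sint a b F + sint a b G.
Proof.
move=> /segcont_integrable[F1 F2] /segcont_integrable[G1 G2].
apply: complex_eq; rewrite cplxE /= -RintegralD//.
  by apply: eq_Rintegral => x _; rewrite cplxE.
by apply: eq_Rintegral => x _; rewrite cplxE.
Qed.

Lemma sintN a b F : segcont a b F -> sint a b (fun x => - F x) = - sint a b F.
Proof.
move=> /segcont_integrable[F1 F2].
apply: complex_eq; rewrite cplxE /= -mulN1r -RintegralZl//.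
  by apply: eq_Rintegral => x _; rewrite cplxE mulN1r.
by apply: eq_Rintegral => x _; rewrite cplxE mulN1r.
Qed.

Lemma sint_chasles a b c F : a <= b -> b <= c -> segcont a c F ->
  sint a c F = sint a b F + sint b c F.
Proof.
move=> ab bc cF; have [F1 F2] := segcont_integrable cF.
have [G1 G2] := segcont_integrable (segcont_sub ab (lexx c) cF).
have key (f : R -> R) : mu.-integrable `[a, c] (EFin \o f) ->
    mu.-integrable `[b, c] (EFin \o f) ->
    \int[mu]_(x in `[a, c]) f x = \int[mu]_(x in `[a, b]) f x + \int[mu]_(x in `[b, c]) f x.
  move=> if1 if2; rewrite -(Rintegral_itv_obnd_cbnd (r := b)).
    rewrite -(@Rintegral_itvB _ f (BLeft a) (BRight c) b)//; first by rewrite addrC subrK.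
    apply: integrableS if2 => //; exact: subset_itv_oc_cc.
by apply: complex_eq; rewrite cplxE /= -key.
Qed.

Lemma Rintegral_close a b (f : R -> R) k e : a <= b -> 0 <= e ->
  mu.-integrable `[a, b] (EFin \o f) ->
  (forall x, a <= x <= b -> `|f x - k| <= e) ->
  `|\int[mu]_(x in `[a, b]) f x - (b - a) * k| <= (b - a) * e.
Proof.
move=> ab e0 fi H.
have mE : fine (mu `[a, b]) = b - a.
  rewrite lebesgue_measure_itv /= lte_fin; case: ltP => //= ba.
  by rewrite (_ : a = b) ?subrr//; apply/eqP; rewrite eq_le ab.
have ci r : mu.-integrable `[a, b] (EFin \o cst r).
  apply: continuous_compact_integrable; first exact: segment_compact.
  by apply: continuous_subspaceT => x; exact: cvg_cst.
have u : \int[mu]_(x in `[a, b]) f x <= (b - a) * (k + e).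
  have := @Rintegral_cst _ _ R mu `[a, b] (measurable_itv _) (k + e).
  rewrite mE mulrC => <-; apply: le_Rintegral => //; first exact: (ci (k + e)).
  move=> x /=; rewrite in_itv /= => /H; rewrite ler_norml => /andP[]; lra.
have l : (b - a) * (k - e) <= \int[mu]_(x in `[a, b]) f x.
  have := @Rintegral_cst _ _ R mu `[a, b] (measurable_itv _) (k - e).
  rewrite mE mulrC => <-; apply: le_Rintegral => //; first exact: (ci (k - e)).
  move=> x /=; rewrite in_itv /= => /H; rewrite ler_norml => /andP[]; lra.
move: u l; move: (\int[mu]_(x in `[a, b]) f x) => I; clear => u l.
rewrite ler_norml; apply/andP; split; lra.
Qed.

(** The factor 2 comes from estimating the real and imaginary parts separately. *)
Lemma sint_close a b F k e : a <= b -> 0 <= e -> segcont a b F ->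
  (forall x, a <= x <= b -> cabs (F x - k) <= e) ->
  cabs (sint a b F - ((b - a)%:C)%C * k) <= 2 * ((b - a) * e).
Proof.
move=> ab e0 /segcont_integrable[F1 F2] H.
rewrite (le_trans (cabs_le_ReIm _))// mulr_natl mulr2n lerD//.
  rewrite !cplxE /= !mul0r !subr0; apply: Rintegral_close => // x /H.
  by apply: le_trans; rewrite -ReN -ReD Re_le_cabs.
rewrite !cplxE /= !mul0r !addr0; apply: Rintegral_close => // x /H.
by apply: le_trans; rewrite -ImN -ImD Im_le_cabs.
Qed.

End SegmentIntegral.

Section Goursat.
Variable R : realType.
Implicit Types (a b c d x y : R) (H : R[i] -> R[i]).
Local Open Scope complex_scope.

(** The integral of [H] dz along the counterclockwise boundary of the rectangle [a, b] x [c, d]. *)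
Definition rectint H a b c d : R[i] :=
  sint a b (fun s => H (s +i* c)) - sint a b (fun s => H (s +i* d)) +
  'i * (sint c d (fun t => H (b +i* t)) - sint c d (fun t => H (a +i* t))).

Definition cont_rect H a b c d := forall x y, a <= x <= b -> c <= y <= d -> ccont H (x +i* y).

Lemma cont_rect_h H a b c d y : cont_rect H a b c d -> c <= y <= d ->
  segcont a b (fun s => H (s +i* y)).
Proof.
move=> cH yc x xab e e0; have [r r0 h] := cH x y xab yc e e0.
exists r => // x' _ x'x; apply: h.
rewrite (_ : _ - _ = ((x' - x)%:C)); first by rewrite cabs_real.
by apply: complex_eq; rewrite cplxE //= subrr.
Qed.

Lemma cont_rect_v H a b c d x : cont_rect H a b c d -> a <= x <= b ->
  segcont c d (fun t => H (x +i* t)).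
Proof.
move=> cH xa y yc e e0; have [r r0 h] := cH x y xa yc e e0.
exists r => // y' _ y'y; apply: h.
rewrite (_ : _ - _ = 'i * ((y' - y)%:C)); first by rewrite cabsM cabs_real {1}/cabs /= expr0n expr1n add0r sqrtr1 mul1r.
by apply: complex_eq; rewrite !cplxE //=; ring.
Qed.

Lemma rectint_split H a b c d m n : cont_rect H a b c d ->
  a <= m -> m <= b -> c <= n -> n <= d ->
  rectint H a b c d = rectint H a m c n + rectint H m b c n +
    rectint H a m n d + rectint H m b n d.
Proof.
move=> cH am mb cn nd; have ab := le_trans am mb; have cd := le_trans cn nd.
have h y : c <= y <= d -> sint a b (fun s => H (s +i* y)) =
    sint a m (fun s => H (s +i* y)) + sint m b (fun s => H (s +i* y)).
  by move=> yc; rewrite (@sint_chasles _ a m b)//; exact: cont_rect_h yc.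
have v x : a <= x <= b -> sint c d (fun s => H (x +i* s)) =
    sint c n (fun s => H (x +i* s)) + sint n d (fun s => H (x +i* s)).
  by move=> xa; rewrite (@sint_chasles _ c n d)//; exact: cont_rect_v xa.
rewrite /rectint h ?lexx//= h ?lexx ?cd//= v ?lexx ?ab//= v ?lexx//=.
by ring.
Qed.

(** Opposite sides are paired. For the affine approximation of [H] at [p] the two paired differences
    are constants whose contributions cancel, so only the approximation error is integrated. *)
Lemma rectint_local H a b c d p k e : a <= b -> c <= d -> 0 <= e ->
  cont_rect H a b c d ->
  (forall x y, a <= x <= b -> c <= y <= d ->
     cabs (H (x +i* y) - H p - k * (x +i* y - p)) <= e * (b - a + (d - c))) ->
  cabs (rectint H a b c d) <= 4 * e * (b - a + (d - c)) ^+ 2.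
Proof.
move=> ab cd e0 cH h; set L := b - a + (d - c).
have L0 : 0 <= L by rewrite /L; lra.
have cc : c <= c <= d by rewrite lexx.
have dd : c <= d <= d by rewrite lexx cd.
have aa : a <= a <= b by rewrite lexx.
have bb : a <= b <= b by rewrite lexx ab.
rewrite /rectint -!sintN; try exact: (cont_rect_h cH); try exact: (cont_rect_v cH).
rewrite -!sintD; try exact: segcontN (cont_rect_h cH _); try exact: segcontN (cont_rect_v cH _);
  try exact: (cont_rect_h cH); try exact: (cont_rect_v cH).
have E1 := @sint_close _ a b (fun x => H (x +i* c) - H (x +i* d)) (k * ('i * (c - d)%:C)) (2 * (e * L)) ab.
have E2 := @sint_close _ c d (fun y => H (b +i* y) - H (a +i* y)) (k * (b - a)%:C) (2 * (e * L)) cd.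
have eL : 0 <= 2 * (e * L) by rewrite mulr_ge0// mulr_ge0.
have {}E1 := E1 eL (segcontD (cont_rect_h cH cc) (segcontN (cont_rect_h cH dd))).
have {}E2 := E2 eL (segcontD (cont_rect_v cH bb) (segcontN (cont_rect_v cH aa))).
have {}E1 := E1 _; have {}E2 := E2 _.
set S1 := sint a b _ in E1 *; set S2 := sint c d _ in E2 *.
have -> : S1 + 'i * S2 = (S1 - (b - a)%:C * (k * ('i * (c - d)%:C))) +
    'i * (S2 - (d - c)%:C * (k * (b - a)%:C)).
  have -> : ((c - d)%:C = - (d - c)%:C :> R[i]) by rewrite -rmorphN opprB.
  by ring.
rewrite (le_trans (cabsD _ _))// cabsM {2}/cabs /= expr0n expr1n add0r sqrtr1 mul1r.
have -> : 4 * e * L ^+ 2 = 2 * ((b - a) * (2 * (e * L))) + 2 * ((d - c) * (2 * (e * L))).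
  by rewrite /L; ring.
apply: lerD.
  apply: E1 => x xa.
  have -> : H (x +i* c) - H (x +i* d) - k * ('i * (c - d)%:C) =
    (H (x +i* c) - H p - k * (x +i* c - p)) - (H (x +i* d) - H p - k * (x +i* d - p)).
    have -> : 'i * (c - d)%:C = (x +i* c) - (x +i* d) :> R[i].
      by apply: complex_eq; rewrite !cplxE /=; ring.
    by ring.
  by rewrite (le_trans (cabsB _ _))// mulr_natl mulr2n lerD// h.
apply: E2 => y yc.
have -> : H (b +i* y) - H (a +i* y) - k * (b - a)%:C =
  (H (b +i* y) - H p - k * (b +i* y - p)) - (H (a +i* y) - H p - k * (a +i* y - p)).
  have -> : (b - a)%:C = (b +i* y) - (a +i* y) :> R[i].
    by apply: complex_eq; rewrite !cplxE /=; ring.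
  by ring.
by rewrite (le_trans (cabsB _ _))// mulr_natl mulr2n lerD// h.
Qed.

(** The bound 4 e L^2, with L the half-perimeter, is additive under bisection: each of the four
    quarters has half-perimeter L / 2. Hence [cousin2] propagates the local estimate with no loss,
    and e is arbitrary. *)
Theorem goursat H a b c d : a <= b -> c <= d ->
  (forall x y, a <= x <= b -> c <= y <= d -> cdiffable H (x +i* y)) ->
  rectint H a b c d = 0.
Proof.
move=> ab cd dH.
have cH : cont_rect H a b c d by move=> x y xa yc; exact/cdiffable_ccont/dH.
have cHs a' b' c' d' : a <= a' -> b' <= b -> c <= c' -> d' <= d -> cont_rect H a' b' c' d'.
  move=> aa bb cc dd x y /andP[? ?] /andP[? ?]; apply: cH; apply/andP; split; lra.
have key (e : R) : 0 < e -> cabs (rectint H a b c d) <= 4 * e * (b - a + (d - c)) ^+ 2.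
  move=> e0; apply: (@cousin2 R (fun a b c d =>
    cabs (rectint H a b c d) <= 4 * e * (b - a + (d - c)) ^+ 2)) => //.
    move=> a' b' c' d' aa ab' bb cc cd' dd.
    set m := (a' + b') / 2; set n := (c' + d') / 2 => p1 p2 p3 p4.
    rewrite (@rectint_split H a' b' c' d' m n); first last.
    - by clear -cd'; rewrite /n; lra.
    - by clear -cd'; rewrite /n; lra.
    - by clear -ab'; rewrite /m; lra.
    - by clear -ab'; rewrite /m; lra.
    - exact: cHs.
    have t (u v w z : R[i]) : cabs (u + v + w + z) <= cabs u + cabs v + cabs w + cabs z.
      by rewrite !(le_trans (cabsD _ _))// lerD2r (le_trans (cabsD _ _))// lerD2r cabsD.
    rewrite (le_trans (t _ _ _ _))//.
    have -> : 4 * e * (b' - a' + (d' - c')) ^+ 2 = 4 * e * (m - a' + (n - c')) ^+ 2 +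
       4 * e * (b' - m + (n - c')) ^+ 2 + 4 * e * (m - a' + (d' - n)) ^+ 2 +
       4 * e * (b' - m + (d' - n)) ^+ 2 by rewrite /m /n; field.
    by rewrite !lerD.
  move=> x y ax xb cy yd.
  have [k Hk] : cdiffable H (x +i* y) by apply: dH; apply/andP.
  have [r r0 h] := Hk _ e0; exists (r / 2); first by lra.
  move=> a' b' c' d' aa a'x xb' bb cc c'y yd' dd br dr.
  apply: (@rectint_local _ _ _ _ _ (x +i* y) k) => //; try lra; first exact: cHs.
  move=> x' y' /andP[? ?] /andP[? ?].
  have D : cabs (x' +i* y' - x +i* y) <= b' - a' + (d' - c').
    rewrite (le_trans (cabs_le_ReIm _))// !cplxE /= lerD// ler_norml; apply/andP; split; lra.
  rewrite (le_trans (h _ _))//; last by rewrite ler_pM2l.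
  by apply: le_lt_trans D _; lra.
apply/eqP; rewrite -cabs_eq0 eq_le cabs_ge0 andbT; apply/ler_addgt0Pl => e e0.
rewrite addr0; set L := (b - a + (d - c)) ^+ 2 in key.
have L0 : 0 <= L by rewrite sqr_ge0.
have := key (e / (4 * (L + 1))); rewrite divr_gt0 ?mulr_gt0//; last by lra.
move=> /(_ isT)/le_trans; apply.
have -> : 4 * (e / (4 * (L + 1))) * L = e * (L / (L + 1)) by field; apply/eqP; lra.
by rewrite ger_pMr// ler_pdivrMr; lra.
Qed.

End Goursat.

(** * Means over the circle *)

Section CircleMean.
Variable R : realType.
Local Notation mu := (@lebesgue_measure R).
Local Notation Re := (@complex.Re R).
Local Notation Im := (@complex.Im R).
Implicit Types (f g : R -> R) (F G : R -> R[i]) (t x y e : R).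

Definition carc : set R := `[0, 2 * pi[.

Lemma circle_arcE : @circle_arc R = carc. Proof. by []. Qed.

Lemma measurable_carc : measurable carc. Proof. exact: measurable_itv. Qed.
Hint Resolve measurable_carc : core.

Lemma two_pi_gt0 : 0 < 2 * pi :> R. Proof. by rewrite mulr_gt0// pi_gt0. Qed.

Lemma mu_carc : mu carc = (2 * pi)%:E.
Proof. by rewrite /carc lebesgue_measure_itv /= lte_fin two_pi_gt0 sube0. Qed.

Definition cint f := mu.-integrable carc (EFin \o f).

Definition ravg f : R := (2 * pi)^-1 * \int[mu]_(t in carc) f t.

Lemma ravg_circle_int f : cint f ->
  ((ravg f)%:E = (@circle_factor R)%:E * \int[mu]_(t in @circle_arc R) (f t)%:E)%E.
Proof.
move=> fi; rewrite /ravg /Rintegral EFinM fineK//.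
exact: integrable_fin_num.
Qed.

Lemma cint_cst k : cint (cst k).
Proof.
apply/integrableP; split; first exact/measurable_EFinP/measurable_cst.
by rewrite /= integral_cst//= mu_carc -EFinM ltry.
Qed.

Lemma cint_le f g : measurable_fun carc f -> cint g ->
  (forall t, carc t -> `|f t| <= g t) -> cint f.
Proof.
move=> mf gi fM; apply: (@le_integrable _ _ _ mu carc _ _ (EFin \o g)) => //.
- exact/measurable_EFinP.
- by move=> t /fM h /=; rewrite lee_fin (le_trans h)// ler_norm.
Qed.

Lemma cint_meas f : cint f -> measurable_fun carc f.
Proof. by move=> /integrableP[/measurable_EFinP]. Qed.

Lemma cintD f g : cint f -> cint g -> cint (fun t => f t + g t).
Proof. by move=> fi gi; exact: integrableD fi gi. Qed.

Lemma cintZ k f : cint f -> cint (fun t => k * f t).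
Proof. by move=> fi; exact: integrableZl fi. Qed.

Lemma cint_abs f : cint f -> cint (fun t => `|f t|).
Proof. by move=> fi; exact: integrable_abse fi. Qed.

Lemma ravgD f g : cint f -> cint g -> ravg (fun t => f t + g t) = ravg f + ravg g.
Proof. by move=> fi gi; rewrite /ravg RintegralD// mulrDr. Qed.

Lemma ravgZ k f : cint f -> ravg (fun t => k * f t) = k * ravg f.
Proof. by move=> fi; rewrite /ravg RintegralZl// mulrCA. Qed.

Lemma ravg_cst k : ravg (fun=> k) = k.
Proof.
have fE : fine (mu carc) = 2 * pi by rewrite mu_carc.
have := @Rintegral_cst _ _ R mu carc measurable_carc k; rewrite fE /ravg => ->.
by rewrite mulrCA mulVf ?mulr1// gt_eqF// two_pi_gt0.
Qed.

Lemma ravg_eq f g : (forall t, carc t -> f t = g t) -> ravg f = ravg g.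
Proof. by move=> h; congr (_ * _); apply: eq_Rintegral => t; rewrite inE => /h. Qed.

Lemma ravg_le f g : cint f -> cint g -> (forall t, carc t -> f t <= g t) -> ravg f <= ravg g.
Proof.
move=> fi gi h; rewrite ler_wpM2l ?invr_ge0 ?(ltW two_pi_gt0)//.
exact: le_Rintegral.
Qed.

Lemma ravg_ge0 f : (forall t, carc t -> 0 <= f t) -> 0 <= ravg f.
Proof.
move=> h; rewrite mulr_ge0 ?invr_ge0 ?(ltW two_pi_gt0)//; exact: Rintegral_ge0.
Qed.

Lemma ravg_abs f : cint f -> `|ravg f| <= ravg (fun t => `|f t|).
Proof.
move=> fi; rewrite normrM ger0_norm ?invr_ge0 ?(ltW two_pi_gt0)//.
by rewrite ler_wpM2l ?invr_ge0 ?(ltW two_pi_gt0)// le_normr_Rintegral.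
Qed.

Lemma ae_sub (P Q : R -> Prop) : (forall t, P t -> Q t) ->
  {ae mu, forall t, P t} -> {ae mu, forall t, Q t}.
Proof. by move=> PQ; apply: filterS => //; exact: (ae_filter_ringOfSetsType mu). Qed.

(** On [carc], [t = 0] is the only parameter with [expi t = 1], the one point of the circle at which
    the self-map touches the circle. *)
Lemma ae_neq0 : {ae mu, forall t, t != 0}.
Proof.
exists [set 0]; split; [exact: measurable_set1|exact: lebesgue_measure_set1|].
by move=> t /= /negP; rewrite negbK => /eqP.
Qed.

Lemma ravg_dct (f_ : nat -> R -> R) f g :
  (forall n, measurable_fun carc (f_ n)) -> measurable_fun carc f ->
  {ae mu, forall t, carc t -> f_ n t @[n --> \oo] --> f t} -> cint g ->
  (forall n t, carc t -> `|f_ n t| <= g t) ->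
  cint f /\ ravg (f_ n) @[n --> \oo] --> ravg f.
Proof.
move=> mf_ mf cf gi fg.
have [|||||fi _ H] := @dominated_convergence _ _ R mu carc measurable_carc (fun n => EFin \o f_ n)
  (EFin \o f) (EFin \o g).
- by move=> n; apply/measurable_EFinP; exact: mf_.
- exact/measurable_EFinP.
- apply: ae_sub cf => t h /h {}h; apply/fine_cvgP; split; [exact: nearW|exact: h].
- exact: gi.
- by apply: aeW => t n ct /=; rewrite lee_fin fg.
split => //; rewrite /ravg; apply: cvgMr.
apply: fine_cvg; rewrite fineK; [exact: H|exact: integrable_fin_num].
Unshelve. all: by end_near. Qed.

Definition cintc F := cint (Re \o F) /\ cint (Im \o F).
Definition cavg F : R[i] := Complex (ravg (Re \o F)) (ravg (Im \o F)).

Lemma cavg_eq F G : (forall t, carc t -> F t = G t) -> cavg F = cavg G.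
Proof. by move=> h; congr Complex; apply: ravg_eq => t /h /= ->. Qed.

Lemma cavgD F G : cintc F -> cintc G -> cavg (fun t => F t + G t) = cavg F + cavg G.
Proof.
move=> [F1 F2] [G1 G2]; apply: complex_eq; rewrite cplxE /= -ravgD//; apply: ravg_eq => t _ /=.
  by rewrite cplxE.
by rewrite cplxE.
Qed.

Lemma cintcD F G : cintc F -> cintc G -> cintc (fun t => F t + G t).
Proof.
move=> [F1 F2] [G1 G2]; split.
  by rewrite (_ : _ \o _ = fun t => (Re \o F) t + (Re \o G) t);
    [exact: cintD|apply/funext => t /=; rewrite cplxE].
by rewrite (_ : _ \o _ = fun t => (Im \o F) t + (Im \o G) t);
    [exact: cintD|apply/funext => t /=; rewrite cplxE].
Qed.

Lemma cintcZ k F : cintc F -> cintc (fun t => k * F t).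
Proof.
move=> [F1 F2]; split.
  rewrite (_ : _ \o _ = fun t => Re k * (Re \o F) t + - Im k * (Im \o F) t).
    by apply: cintD; exact: cintZ.
  by apply/funext => t /=; rewrite !cplxE mulNr.
rewrite (_ : _ \o _ = fun t => Re k * (Im \o F) t + Im k * (Re \o F) t).
  by apply: cintD; exact: cintZ.
by apply/funext => t /=; rewrite !cplxE.
Qed.

Lemma cavgZ k F : cintc F -> cavg (fun t => k * F t) = k * cavg F.
Proof.
move=> [F1 F2]; apply: complex_eq; rewrite cplxE /=.
  rewrite -(ravgZ _ F1) -mulNr -(ravgZ _ F2) -ravgD; [|exact: cintZ..].
  by apply: ravg_eq => t _ /=; rewrite cplxE mulNr.
rewrite -(ravgZ _ F1) -(ravgZ _ F2) -ravgD; [|exact: cintZ..].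
by apply: ravg_eq => t _ /=; rewrite cplxE.
Qed.

Lemma cavg_cst k : cavg (fun=> k) = k.
Proof. by apply: complex_eq => /=; rewrite ravg_cst. Qed.

Lemma cavg_conj F : cintc F -> cavg (fun t => conjc (F t)) = conjc (cavg F).
Proof.
move=> [_ F2]; apply: complex_eq => /=; first by apply: ravg_eq => t _ /=; case: (F t).
rewrite -mulN1r -ravgZ//; apply: ravg_eq => t _ /=.
by rewrite mulN1r; case: (F t).
Qed.

Definition rcont F := forall x e, 0 < e ->
  exists2 d : R, 0 < d & forall y, `|y - x| < d -> cabs (F y - F x) <= e.

Lemma rcont_continuous F : rcont F -> continuous (Re \o F) /\ continuous (Im \o F).
Proof.
move=> cF; split => x; apply/cvgrPdist_le => e e0.
all: have [d d0 H] := cF x e e0.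
all: apply/nbhs_ballP; exists d => //= y; rewrite /ball /= distrC => /H.
all: rewrite cabsBC => h; apply: le_trans h.
  by rewrite -ReN -ReD Re_le_cabs.
by rewrite -ImN -ImD Im_le_cabs.
Qed.

Lemma cint_continuous f : continuous f -> cint f.
Proof.
move=> cf; apply: (@integrableS _ _ _ mu `[0, 2 * pi]) => //.
  exact: subset_itv_co_cc.
apply: continuous_compact_integrable; first exact: segment_compact.
exact: continuous_subspaceT.
Qed.

Lemma cintc_rcont F : rcont F -> cintc F.
Proof. by move=> /rcont_continuous[h1 h2]; split; exact: cint_continuous. Qed.

Lemma rcont_abs F : rcont F -> continuous (fun t => cabs (F t)).
Proof.
move=> cF x; apply/cvgrPdist_le => e e0.
have [d d0 H] := cF x e e0.
apply/nbhs_ballP; exists d => //= y; rewrite /ball /= distrC => /H.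
by rewrite cabsBC; apply: le_trans; exact: cabs_dist.
Qed.

(** The factor 2, from separate treatment of real and imaginary parts, is the one that reappears in
    [boundary_majorant]. *)
Lemma cabs_cavg_le F g : cintc F -> cint g -> (forall t, carc t -> cabs (F t) <= g t) ->
  cabs (cavg F) <= 2 * ravg g.
Proof.
move=> [F1 F2] gi Fg; rewrite (le_trans (cabs_le_ReIm _))// mulr_natl mulr2n lerD//.
  rewrite (le_trans (ravg_abs F1))//; apply: ravg_le => //; first exact: cint_abs.
  by move=> t /Fg; apply: le_trans; exact: Re_le_cabs.
rewrite (le_trans (ravg_abs F2))//; apply: ravg_le => //; first exact: cint_abs.
by move=> t /Fg; apply: le_trans; exact: Im_le_cabs.
Qed.

(** Convergence through the real sequence of distances keeps every limit argument in [R]. *)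
Definition ccvg (u : nat -> R[i]) (l : R[i]) := cabs (u n - l) @[n --> \oo] --> 0.

Lemma ccvgP u l : ccvg u l <-> Re (u n) @[n --> \oo] --> Re l /\ Im (u n) @[n --> \oo] --> Im l.
Proof.
split.
  move=> /cvgrPdist_le h; split; apply/cvgrPdist_le => e e0.
    apply: filterS (h e e0) => n; rewrite sub0r normrN ger0_norm ?cabs_ge0// cabsBC.
    by apply: le_trans; rewrite -ReN -ReD Re_le_cabs.
  apply: filterS (h e e0) => n; rewrite sub0r normrN ger0_norm ?cabs_ge0// cabsBC.
  by apply: le_trans; rewrite -ImN -ImD Im_le_cabs.
move=> [h1 h2]; apply/cvgrPdist_le => e e0.
have e20 : 0 < e / 2 by lra.
move/cvgrPdist_le : h1 => /(_ _ e20) h1; move/cvgrPdist_le : h2 => /(_ _ e20).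
apply: filterS2 h1 => n h1 h2.
rewrite sub0r normrN ger0_norm ?cabs_ge0// (le_trans (cabs_le_ReIm _))// !cplxE.
by rewrite distrC (distrC (Im _)) in h2 *; rewrite distrC in h1; lra.
Qed.

Lemma cavg_dct (F_ : nat -> R -> R[i]) F g :
  (forall n, measurable_fun carc (Re \o F_ n)) -> (forall n, measurable_fun carc (Im \o F_ n)) ->
  measurable_fun carc (Re \o F) -> measurable_fun carc (Im \o F) ->
  {ae mu, forall t, carc t -> ccvg (F_ ^~ t) (F t)} -> cint g ->
  (forall n t, carc t -> cabs (F_ n t) <= g t) ->
  cintc F /\ ccvg (fun n => cavg (F_ n)) (cavg F).
Proof.
move=> m1 m2 m3 m4 cF gi Fg.
have [||c1 l1] := @ravg_dct (fun n => Re \o F_ n) (Re \o F) g m1 m3 _ gi.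
- by apply: ae_sub cF => t h /h/ccvgP[].
- by move=> n t /Fg h /=; rewrite (le_trans (Re_le_cabs _)).
have [||c2 l2] := @ravg_dct (fun n => Im \o F_ n) (Im \o F) g m2 m4 _ gi.
- by apply: ae_sub cF => t h /h/ccvgP[].
- by move=> n t /Fg h /=; rewrite (le_trans (Im_le_cabs _)).
by split; [split|apply/ccvgP; split].
Qed.

End CircleMean.

(** * Measurability of complex-valued functions *)

Section ComplexMeasurable.
Context {R : realType} {d : measure_display} {X : measurableType d}.
Variable D : set X.
Local Notation Re := (@complex.Re R).
Local Notation Im := (@complex.Im R).
Implicit Types (F G : X -> R[i]).
Local Open Scope complex_scope.

Definition cmeasurable F := measurable_fun D (Re \o F) /\ measurable_fun D (Im \o F).

Lemma cmeasurable_cst (k : R[i]) : cmeasurable (fun=> k).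
Proof. by split; exact: measurable_cst. Qed.

Lemma cmeasurableD F G : cmeasurable F -> cmeasurable G -> cmeasurable (fun x => F x + G x).
Proof.
move=> [f1 f2] [g1 g2]; split.
  rewrite (_ : _ \o _ = fun x => (Re \o F) x + (Re \o G) x); first exact: measurable_funD.
  by apply/funext => x /=; case: (F x) => ? ?; case: (G x).
rewrite (_ : _ \o _ = fun x => (Im \o F) x + (Im \o G) x); first exact: measurable_funD.
by apply/funext => x /=; case: (F x) => ? ?; case: (G x).
Qed.

Lemma cmeasurableM F G : cmeasurable F -> cmeasurable G -> cmeasurable (fun x => F x * G x).
Proof.
move=> [f1 f2] [g1 g2]; split.
  rewrite (_ : _ \o _ = fun x => (Re \o F) x * (Re \o G) x - (Im \o F) x * (Im \o G) x).
    by apply: measurable_funB; exact: measurable_funM.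
  by apply/funext => x /=; case: (F x) => ? ?; case: (G x).
rewrite (_ : _ \o _ = fun x => (Re \o F) x * (Im \o G) x + (Im \o F) x * (Re \o G) x).
  by apply: measurable_funD; exact: measurable_funM.
by apply/funext => x /=; case: (F x) => ? ?; case: (G x).
Qed.

Lemma cmeasurableX F n : cmeasurable F -> cmeasurable (fun x => F x ^+ n).
Proof.
move=> mF; elim: n => [|n IH]; first exact: cmeasurable_cst.
by under eq_fun do rewrite exprS; exact: cmeasurableM.
Qed.

Lemma cmeasurableB F G : cmeasurable F -> cmeasurable G -> cmeasurable (fun x => F x - G x).
Proof.
move=> mF mG; under eq_fun do rewrite -[- G _]mulN1r.
by apply: cmeasurableD => //; apply: cmeasurableM => //; exact: cmeasurable_cst.
Qed.

Lemma measurable_cabs F : cmeasurable F -> measurable_fun D (fun x => cabs (F x)).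
Proof.
move=> [h1 h2]; rewrite (_ : (fun x => _) = Num.sqrt \o (fun x => (Re (F x)) ^+ 2 + (Im (F x)) ^+ 2)).
  apply: measurableT_comp; first exact: (continuous_measurable_fun (@sqrt_continuous R)).
  by apply: measurable_funD; exact: measurable_funX.
by apply/funext => t /=; case: (F t).
Qed.

(* [x^-1] agrees with a monotone function on [e, +oo[ *)
Lemma cmeasurableV F (e : R) : 0 < e -> (forall x, D x -> e <= cabs (F x)) -> cmeasurable F ->
  cmeasurable (fun x => (F x)^-1).
Proof.
move=> e0 eF mF.
pose inv y : R := - (Num.max y (e ^+ 2))^-1.
have e20 : 0 < e ^+ 2 by rewrite exprn_gt0.
have max0 y : 0 < Num.max y (e ^+ 2) by rewrite lt_max e20 orbT.
have minv : measurable_fun setT inv.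
  apply: nondecreasing_measurable => // y z yz; rewrite lerN2 lef_pV2 ?posrE//.
  by rewrite ge_max !le_max yz lexx orbT.
have [f1 f2] := mF.
have mq : measurable_fun D (fun x => inv ((Re \o F) x ^+ 2 + (Im \o F) x ^+ 2)).
  by apply: measurableT_comp => //; apply: measurable_funD; exact: measurable_funX.
have key x : D x -> inv ((Re \o F) x ^+ 2 + (Im \o F) x ^+ 2) = - ((Re \o F) x ^+ 2 + (Im \o F) x ^+ 2)^-1.
  move=> Dx; rewrite /inv (max_idPl _)//= -cabs_sqr lerXn2r ?nnegrE ?cabs_ge0 ?eF// ltW//.
split.
  apply: (@eq_measurable_fun _ _ _ _ _ (fun x => -1 * ((Re \o F) x * inv ((Re \o F) x ^+ 2 + (Im \o F) x ^+ 2)))).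
    by move=> x /set_mem Dx; rewrite key//=; case: (F x) => u v /=; rewrite mulN1r mulrN opprK.
  by apply: measurable_funM; [exact: measurable_cst|exact: measurable_funM].
apply: (@eq_measurable_fun _ _ _ _ _ (fun x => (Im \o F) x * inv ((Re \o F) x ^+ 2 + (Im \o F) x ^+ 2))).
  by move=> x /set_mem Dx; rewrite key//=; case: (F x) => u v /=; rewrite mulrN.
exact: measurable_funM.
Qed.

Lemma cmeasurable_lim (F_ : nat -> X -> R[i]) F : (forall n, cmeasurable (F_ n)) ->
  (forall x, D x -> ccvg (F_ ^~ x) (F x)) -> cmeasurable F.
Proof.
move=> mF cF; split.
  apply: (@measurable_fun_cvg _ _ _ _ (fun n => Re \o F_ n)); first by move=> n; case: (mF n).
  by move=> t /cF/ccvgP[].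
apply: (@measurable_fun_cvg _ _ _ _ (fun n => Im \o F_ n)); first by move=> n; case: (mF n).
by move=> t /cF/ccvgP[].
Qed.

End ComplexMeasurable.

(** * Cauchy and Poisson formulas *)

Section PolarCauchy.
Variable R : realType.
Local Notation mu := (@lebesgue_measure R).
Local Notation Re := (@complex.Re R).
Local Notation Im := (@complex.Im R).
Implicit Types (s t x y e r : R) (z w : R[i]) (h : R[i] -> R[i]).
Local Open Scope complex_scope.

Lemma is_derive_near (f : R -> R) x l : is_derive x 1 f l -> forall e, 0 < e ->
  exists2 d : R, 0 < d & forall y, `|y - x| < d -> `|f y - f x - l * (y - x)| <= e * `|y - x|.
Proof.
move=> fl e e0.
have /cvg_ex[/= l' Hl'] : derivable f x 1 by exact: ex_derive.
have E : l = l'.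
  by rewrite -(@derive_val _ _ _ x 1 f l fl); apply/cvg_lim => //; exact: Rhausdorff.
rewrite -{l'}E in Hl'.
move/cvgrPdist_le : Hl' => /(_ e e0).
rewrite near_withinE => /nbhs_ballP[d /= d0 H].
exists d => // y yd; have [->|yx] := eqVneq y x; first by rewrite !subrr mulr0 subrr normr0 mulr0.
have yx0 : y - x != 0 by rewrite subr_eq0.
have := H (y - x); rewrite /ball /= sub0r normrN => /(_ yd yx0).
rewrite /GRing.scale /= mulr1 subrK difference_quotientE// normrN normrM normfV.
by rewrite ler_pdivrMl ?normr_gt0// [_ * e]mulrC.
Qed.

Definition cexp z : R[i] := (expR (Re z))%:C * expi (Im z).

Lemma cexpD z w : cexp (z + w) = cexp z * cexp w.
Proof. by rewrite /cexp !cplxE expRD expiD rmorphM /=; ring. Qed.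

Lemma cexp_cdiff0 : cdiff cexp 0 1.
Proof.
move=> e e0.
(* The four error terms [m1] to [m4] add up to 9 e1 W, which 10 covers. *)
have [e1 e10 [e11 e1e]] : exists2 e1 : R, 0 < e1 & e1 <= 1 /\ 10 * e1 <= e.
  exists (Num.min 1 (e / 10)); first by rewrite lt_min ltr01 divr_gt0.
  split; first by rewrite ge_min lexx.
  by rewrite mulrC -ler_pdivlMr// ge_min lexx orbT.
have [d1 d10 H1] := is_derive_near (is_derive_expR (0 : R)) e10.
have [d2 d20 H2] := is_derive_near (is_derive_cos (0 : R)) e10.
have [d3 d30 H3] := is_derive_near (is_derive_sin (0 : R)) e10.
exists (Num.min e1 (Num.min d1 (Num.min d2 d3))).
  by rewrite lt_min e10 lt_min d10 lt_min d20.
move=> w; rewrite subr0 !lt_min => /and4P[we1 wd1 wd2 wd3].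
set s := Re w; set t := Im w.
have sw : `|s| <= cabs w by exact: Re_le_cabs.
have tw : `|t| <= cabs w by exact: Im_le_cabs.
have := H1 s; rewrite !subr0 expR0 mul1r => /(_ (le_lt_trans sw wd1)) h1.
have := H2 t; rewrite !subr0 cos0 sin0 oppr0 mul0r subr0 => /(_ (le_lt_trans tw wd2)) h2.
have := H3 t; rewrite !subr0 cos0 sin0 mul1r subr0 => /(_ (le_lt_trans tw wd3)) h3.
have W0 := cabs_ge0 w; set W := cabs w in sw tw W0 we1 *.
have es : `|expR s - 1| <= 2 * e1.
  have -> : expR s - 1 = (expR s - 1 - s) + s by ring.
  rewrite (le_trans (ler_normD _ _))//.
  have : e1 * `|s| <= e1 * 1 by rewrite ler_wpM2l ?ltW//; lra.
  by lra.
have E2 : `|expR s| <= 3.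
  have -> : expR s = (expR s - 1) + 1 by ring.
  by rewrite (le_trans (ler_normD _ _))// normr1; lra.
rewrite /cexp /= expR0 mul1r; set X := _ - _.
have ReX : Re X = expR s * (cos t - 1) + (expR s - 1 - s).
  by rewrite /X /expi !cplxE /= cos0 mul0r; rewrite -/s -/t; ring.
have ImX : Im X = expR s * (sin t - t) + t * (expR s - 1).
  by rewrite /X /expi !cplxE /= sin0 mul0r; rewrite -/s -/t; ring.
rewrite (le_trans (cabs_le_ReIm _))// ReX ImX.
have m1 : `|expR s * (cos t - 1)| <= 3 * (e1 * W).
  rewrite normrM ler_pM// (le_trans h2)// ler_wpM2l// ltW//.
have m2 : `|expR s * (sin t - t)| <= 3 * (e1 * W).
  rewrite normrM ler_pM// (le_trans h3)// ler_wpM2l// ltW//.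
have m3 : `|t * (expR s - 1)| <= W * (2 * e1) by rewrite normrM ler_pM.
have m4 : `|expR s - 1 - s| <= e1 * W by rewrite (le_trans h1)// ler_wpM2l// ltW.
have m5 : 10 * e1 * W <= e * W by rewrite ler_wpM2r.
have m6 : 0 <= e1 * W by rewrite mulr_ge0// ltW.
rewrite (le_trans (lerD (ler_normD _ _) (ler_normD _ _)))//.
by lra.
Qed.

Lemma cexp_cdiff z : cdiffable cexp z.
Proof.
exists (cexp z) => e e0.
have c1 : 0 < cabs (cexp z) + 1 by rewrite ltr_wpDl// cabs_ge0.
have e10 : 0 < e / (cabs (cexp z) + 1) by rewrite divr_gt0.
have [d d0 H] := cexp_cdiff0 e10; exists d => // w wz.
have := H (w - z); rewrite !subr0 => /(_ wz).
have E : cexp 0 = 1 :> R[i] by rewrite /cexp /= expR0 mul1r; apply: complex_eq; rewrite /= ?cos0 ?sin0.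
rewrite E mul1r => h.
have -> : cexp w - cexp z - cexp z * (w - z) = cexp z * (cexp (w - z) - 1 - (w - z)).
  have -> : cexp w = cexp z * cexp (w - z) by rewrite -cexpD addrC subrK.
  by ring.
rewrite cabsM (le_trans (ler_wpM2l (cabs_ge0 _) h))// mulrA mulrCA -mulrA mulrA.
rewrite ler_wpM2r ?cabs_ge0// ler_piMr ?(ltW e0)//.
by rewrite ler_pdivrMr// mul1r lerDl.
Qed.

Lemma expi2pi t : expi (t + 2 * pi) = expi t :> R[i].
Proof.
apply: complex_eq; rewrite /= mulr_natl mulr2n addrA.
  by rewrite !cosDpi opprK.
by rewrite !sinDpi opprK.
Qed.

Lemma cos_sin_near t e : 0 < e -> exists2 d : R, 0 < d &
  forall s, `|s - t| < d -> cabs (expi s - expi t) <= e.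
Proof.
move=> e0; have e20 : 0 < e / 2 by lra.
have near (f : R -> R) : continuous f -> exists2 d : R, 0 < d &
    forall s, `|s - t| < d -> `|f s - f t| <= e / 2.
  move=> /(_ t)/cvgrPdist_le/(_ _ e20)/nbhs_ballP[d /= d0 H]; exists d => // s sd.
  by rewrite distrC; apply: H; rewrite /ball /= distrC.
have [d1 d10 H1] := near _ (@continuous_cos R).
have [d2 d20 H2] := near _ (@continuous_sin R).
exists (Num.min d1 d2); first by rewrite lt_min d10.
move=> s; rewrite lt_min => /andP[/H1 h1 /H2 h2].
apply: le_trans (cabs_le_ReIm _) _; rewrite !cplxE /=.
lra.
Qed.

Lemma rcont_circle h r : 0 <= r ->
  (forall z, cabs z = r -> ccont h z) -> rcont (fun t => h (r%:C * expi t)).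
Proof.
move=> r0 ch t e e0.
have [d d0 H] := ch (r%:C * expi t) (cabs_scale t r0) e e0.
have r1 : 0 < r + 1 by lra.
have d1 : 0 < d / (r + 1) / 2 by rewrite !divr_gt0.
have [d2 d20 H2] := cos_sin_near t d1; exists d2 => // y /H2 h2; apply: H.
rewrite -mulrBr cabsM cabs_real ger0_norm// (le_lt_trans (ler_wpM2l r0 h2))//.
rewrite -mulrA mulrA -mulrA mulrC -mulrA.
rewrite -[ltRHS]mulr1 ltr_pM2l// -invfM mulrC ltr_pdivrMr; lra.
Qed.

Lemma sint_cavg (F : R -> R[i]) : rcont F ->
  sint 0 (2 * pi) F = (2 * pi)%:C * cavg F.
Proof.
move=> cF; have [F1 F2] := cintc_rcont cF.
have key (f : R -> R) : cint f -> \int[mu]_(x in `[0, 2 * pi]) f x = 2 * pi * ravg f.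
  move=> fi; rewrite /ravg mulrA divff ?mul1r ?gt_eqF ?two_pi_gt0//.
  by rewrite -Rintegral_itv_bndo_bndc.
by apply: complex_eq; rewrite !cplxE /= !mul0r ?subr0 ?addr0 -key.
Qed.

(** Goursat's theorem for [h] composed with [cexp] on the rectangle [ln a, ln b] x [0, 2 pi]: the
    horizontal sides cancel by periodicity, and the vertical sides are 2 pi times the two circular
    means. *)
Lemma annulus_const h (r1 r2 a b : R) : 0 <= r1 ->
  (forall z, r1 < cabs z < r2 -> cdiffable h z) ->
  r1 < a -> a <= b -> b < r2 ->
  cavg (fun t => h (a%:C * expi t)) = cavg (fun t => h (b%:C * expi t)).
Proof.
move=> r10 dh r1a ab br2.
have a0 : 0 < a by exact: le_lt_trans r1a.
have b0 : 0 < b by exact: lt_le_trans ab.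
have lnab : ln a <= ln b by rewrite ler_ln.
have ce x y : cexp (x +i* y) = (expR x)%:C * expi y by [].
have P := ltW (two_pi_gt0 R).
have dH x y : ln a <= x <= ln b -> 0 <= y <= 2 * pi -> cdiffable (fun z => h (cexp z)) (x +i* y).
  move=> /andP[ax xb] _; apply: cdiffable_comp; first exact: cexp_cdiff.
  apply: dh; rewrite ce cabs_scale ?expR_ge0//.
  rewrite (lt_le_trans r1a)/=; last by rewrite -{1}(lnK a0) ler_expR.
  by rewrite (le_lt_trans _ br2)// -(lnK b0) ler_expR.
have := goursat lnab P dH; rewrite /rectint.
rewrite [X in X - _ + _](_ : _ = sint (ln a) (ln b) (fun s => h (cexp (s +i* (2 * pi))))); last first.
  by congr sint; apply/funext => s; rewrite !ce -(expi2pi 0) add0r.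
rewrite subrr add0r => /eqP; rewrite mulf_eq0 => /orP[/eqP[] /eqP|]; first by rewrite oner_eq0.
have rc x : ln a <= x <= ln b -> rcont (fun t => h ((expR x)%:C * expi t)).
  move=> /andP[ax xb]; apply: rcont_circle; first exact: expR_ge0.
  move=> z zx; apply/cdiffable_ccont/dh; rewrite zx.
  rewrite (lt_le_trans r1a)/=; last by rewrite -{1}(lnK a0) ler_expR.
  by rewrite (le_lt_trans _ br2)// -(lnK b0) ler_expR.
rewrite subr_eq0 => /eqP.
rewrite sint_cavg; last by apply: rc; rewrite lnab lexx.
rewrite sint_cavg; last by apply: rc; rewrite lnab lexx.
have p0 : (2 * pi)%:C != 0 :> R[i] by rewrite -cabs_eq0 cabs_real normr_eq0 gt_eqF// two_pi_gt0.
move=> /(mulfI p0) H.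
have E x : 0 < x -> cavg (fun t => h (x%:C * expi t)) = cavg (fun t => h (cexp (ln x +i* t))).
  by move=> x0; apply: cavg_eq => t _; rewrite ce lnK.
by rewrite (E a a0) (E b b0); exact: (esym H).
Qed.

End PolarCauchy.

(** * The mean value property, Cauchy's formula and the Poisson kernel *)

Section DiscCauchy.
Variable R : realType.
Local Notation mu := (@lebesgue_measure R).
Local Notation Re := (@complex.Re R).
Local Notation Im := (@complex.Im R).
Implicit Types (s t x y e r : R) (z w a : R[i]) (f g h : R[i] -> R[i]).
Local Open Scope complex_scope.

Definition cmean h r : R[i] := cavg (fun t => h (r%:C * expi t)).

Lemma cmean0 h : cmean h 0 = h 0.
Proof.
rewrite -[RHS]cavg_cst; apply: cavg_eq => t _.
by rewrite (_ : 0%:C = 0) ?mul0r//.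
Qed.

Lemma cmean_cont h r e : (forall z, cabs z < 1 -> ccont h z) -> 0 <= r < 1 -> 0 < e ->
  exists2 d : R, 0 < d & forall s, 0 <= s < 1 -> `|s - r| < d -> cabs (cmean h s - cmean h r) <= e.
Proof.
move=> ch /andP[r0 r1] e0.
have e20 : 0 < e / 2 by lra.
(* Continuity in the radius, uniform in the angle, by bisection of [0, 2 pi]; the first side of the
   rectangle is degenerate. *)
have [d d0 Hd] : exists2 d : R, 0 < d & forall t s, 0 <= t <= 2 * pi -> 0 <= s < 1 ->
    `|s - r| < d -> cabs (h (s%:C * expi t) - h (r%:C * expi t)) <= e / 2.
  apply: (@cousin2 R (fun _ _ c d => exists2 dd : R, 0 < dd & forall t s, c <= t <= d ->
     0 <= s < 1 -> `|s - r| < dd -> cabs (h (s%:C * expi t) - h (r%:C * expi t)) <= e / 2)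
     0 0 0 (2 * pi)) => //; first exact: ltW (two_pi_gt0 R).
    move=> _ _ c d _ _ _ _ _ _ [d1 d10 H1] _ [d2 d20 H2] _.
    exists (Num.min d1 d2); first by rewrite lt_min d10.
    move=> t s /andP[ct td] s01; rewrite lt_min => /andP[sd1 sd2].
    have [tm|mt] := leP t ((c + d) / 2); first by apply: H1 => //; rewrite ct.
    by apply: H2 => //; rewrite td (ltW mt).
  move=> x0 t _ _ _ _.
  have e40 : 0 < e / 4 by lra.
  have zc : cabs (r%:C * expi t) < 1 by rewrite cabs_scale.
  have [d d0 H] := ch _ zc _ e40.
  have d20 : 0 < d / 2 by lra.
  have [d1 d10 H1] := cos_sin_near t d20.
  exists d1 => // a' b' c c' _ _ _ _ _ ct tc' _ _ cc'.
  exists (d / 2) => // u s /andP[cu uc'] /andP[s0 s1] sr.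
  have {}H1 : cabs (expi u - expi t) <= d / 2 by apply: H1; rewrite ltr_norml; apply/andP; split; lra.
  have K (x : R) : 0 <= x -> x < 1 -> `|x - r| < d / 2 ->
      cabs (h (x%:C * expi u) - h (r%:C * expi t)) <= e / 4.
    move=> xge0 x1 xr; apply: H.
    have -> : x%:C * expi u - r%:C * expi t = x%:C * (expi u - expi t) + (x - r)%:C * expi t.
      by rewrite rmorphB /=; ring.
    rewrite (le_lt_trans (cabsD _ _))// !cabsM cabs_expi mulr1 !cabs_real (ger0_norm xge0).
    have : x * cabs (expi u - expi t) <= 1 * (d / 2) by rewrite ler_pM ?cabs_ge0// ltW.
    lra.
  have k1 := K s s0 s1 sr; have k2 := K r r0 r1 _; rewrite subrr normr0 in k2.
  have {}k2 := k2 d20; rewrite cabsBC in k2.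
  have -> : h (s%:C * expi u) - h (r%:C * expi u) = (h (s%:C * expi u) - h (r%:C * expi t)) +
     (h (r%:C * expi t) - h (r%:C * expi u)) by ring.
  by rewrite (le_trans (cabsD _ _))//; lra.
exists d => // s s01 sr.
have rc x : 0 <= x < 1 -> rcont (fun t => h (x%:C * expi t)).
  move=> /andP[x0 x1]; apply: rcont_circle => // z zx; apply: ch; by rewrite zx.
have ci x : 0 <= x < 1 -> cintc (fun t => h (x%:C * expi t)) by move=> /rc/cintc_rcont.
rewrite /cmean -[- cavg _]mulN1r -[-1 * cavg _]cavgZ; last by apply: ci; rewrite r0.
rewrite -cavgD; [|exact: ci|apply: cintcZ; apply: ci; by rewrite r0].
rewrite (le_trans (@cabs_cavg_le _ _ (fun=> e / 2) _ _ _))//.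
- by apply: cintcD; [exact: ci|apply: cintcZ; apply: ci; rewrite r0].
- exact: cint_cst.
- move=> t; rewrite /carc /= in_itv /= => /andP[t0 tp].
  by rewrite mulN1r Hd// t0 ltW.
- by rewrite ravg_cst; lra.
Qed.

(** [annulus_const] makes the mean constant on either side of the circle |z| = s, and continuity of
    the mean joins the two sides and the origin. The exceptional circle is there for Cauchy's
    formula, where the difference quotient is only known to be continuous at one point of it. *)
Lemma cmean_const h s r : (forall z, cabs z < 1 -> ccont h z) -> 0 <= s < 1 ->
  (forall z, 0 < cabs z < 1 -> cabs z != s -> cdiffable h z) ->
  0 <= r < 1 -> cmean h r = h 0.
Proof.
move=> ch /andP[s0 s1] dh /andP[r0 r1].
have near u v : 0 <= u < 1 -> (forall d, 0 < d -> exists2 x, 0 <= x < 1 /\ `|x - u| < d & cmean h x = v) ->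
    v = cmean h u.
  move=> u01 H; apply/eqP; rewrite -subr_eq0 -cabs_eq0 eq_le cabs_ge0 andbT.
  apply/ler_addgt0Pl => e e0; rewrite addr0.
  have [d d0 Hd] := cmean_cont ch u01 e0; have [x [x01 xu] <-] := H d d0.
  exact: Hd.
rewrite -cmean0.
have A x : 0 <= x -> x < s -> cmean h x = cmean h 0.
  rewrite le_eqVlt => /predU1P[<-//|x0] xs; apply: near; rewrite ?lexx//= => d d0.
  exists (Num.min (d / 2) x).
    have [m1 m2 m3] : [/\ Num.min (d / 2) x <= x, Num.min (d / 2) x <= d / 2 & 0 < Num.min (d / 2) x].
      by split; rewrite ?ge_min ?lexx ?orbT// lt_min x0 andbT; lra.
    by rewrite subr0 (ltW m3) ger0_norm ?(ltW m3)//; split; lra.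
  apply: (@annulus_const _ h 0 s) => //.
  - move=> z /andP[z0 zs]; apply: dh; last by rewrite lt_eqF.
    by rewrite z0 (lt_trans zs).
  - by rewrite lt_min x0 andbT; lra.
  - by rewrite ge_min lexx orbT.
have B : cmean h s = cmean h 0.
  move: s0; rewrite le_eqVlt => /predU1P[<-//|s0]; apply/esym/near; first by rewrite ltW.
  move=> d d0; exists (s - Num.min (d / 2) s).
    have [m1 m2 m3] : [/\ Num.min (d / 2) s <= s, Num.min (d / 2) s <= d / 2 & 0 < Num.min (d / 2) s].
      by split; rewrite ?ge_min ?lexx ?orbT// lt_min s0 andbT; lra.
    split; first by apply/andP; split; lra.
    rewrite (_ : _ - _ - _ = - Num.min (d / 2) s); last by ring.
    by rewrite normrN ger0_norm ?(ltW m3)//; lra.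
  apply: A; first by rewrite subr_ge0 ge_min lexx orbT.
  by rewrite ltrBlDr ltrDl lt_min s0 andbT; lra.
have [rs|sr|->] := ltgtP r s; [exact: A| |exact: B].
rewrite -B; apply: near; first by rewrite s0.
move=> d d0; exists (s + Num.min (d / 2) (r - s)).
  have [m1 m2 m3] : [/\ Num.min (d / 2) (r - s) <= r - s, Num.min (d / 2) (r - s) <= d / 2 & 0 < Num.min (d / 2) (r - s)].
    by split; rewrite ?ge_min ?lexx ?orbT// lt_min subr_gt0 sr andbT; lra.
  split; first by apply/andP; split; lra.
  rewrite (_ : _ + _ - _ = Num.min (d / 2) (r - s)); last by ring.
  by rewrite ger0_norm ?(ltW m3)//; lra.
apply: (@annulus_const _ h s 1) => //.
- move=> z /andP[zs z1]; apply: dh; last by rewrite gt_eqF.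
  by rewrite z1 (le_lt_trans s0).
- by rewrite ltrDl lt_min subr_gt0 sr andbT; lra.
- have : Num.min (d / 2) (r - s) <= r - s by rewrite ge_min lexx orbT.
  lra.
Qed.

Definition analytic f := forall z, cabs z < 1 -> cdiffable f z.

Lemma analytic_ccont f z : analytic f -> cabs z < 1 -> ccont f z.
Proof. by move=> af /af /cdiffable_ccont. Qed.

Lemma cmean_analytic f r : analytic f -> 0 <= r < 1 -> cmean f r = f 0.
Proof.
move=> af r01; apply: (@cmean_const f 0) => //; rewrite ?lexx ?ltr01//.
- by move=> z z1; exact: analytic_ccont.
- by move=> z /andP[_ z1] _; exact: af.
Qed.

(** With zeta = [expi t] this is zeta / (zeta - a), the Cauchy kernel with respect to normalized arc
    length. *)
Definition ckernel a t : R[i] := (1 - a * conjc (expi t))^-1.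

Lemma one_sub_neq0 z : cabs z < 1 -> 1 - z != 0 :> R[i].
Proof.
move=> z1; rewrite subr_eq0; apply/eqP => E; move: z1; by rewrite -E cabs1 ltxx.
Qed.

Lemma rcont_expi : rcont (@expi R).
Proof. by move=> t e; exact: cos_sin_near. Qed.

Lemma cavg_geometric c : cabs c < 1 -> cavg (fun t => (1 - c * expi t)^-1) = 1.
Proof.
(* As |c| < k < 1, the function (1 - c w / k)^-1 is analytic in the unit disc, and its mean over |w|
   = k is the wanted one. *)
move=> c1; pose k := (1 + cabs c) / 2.
have ck : cabs c < k by rewrite /k; lra.
have k1 : k < 1 by rewrite /k; lra.
have k0 : 0 < k by exact: le_lt_trans (cabs_ge0 _) ck.
have ad : analytic (fun w => (1 - c * (k^-1)%:C * w)^-1).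
  move=> w w1; apply: cdiffableV.
    by apply: cdiffableB; [exact: cdiffable_cst|apply: cdiffableM; [exact: cdiffable_cst|exact: cdiffable_id]].
  apply: one_sub_neq0; rewrite !cabsM cabs_real ger0_norm ?invr_ge0 ?ltW//.
  rewrite (le_lt_trans _ w1)// ler_piMl ?cabs_ge0// ler_pdivrMr// mul1r ltW//.
have := cmean_analytic ad (r := k); rewrite ltW// k1 => /(_ isT).
rewrite mulr0 subr0 invr1 => E1; rewrite -[RHS]E1; apply: cavg_eq => t _; have E : (k^-1)%:C * (k%:C * expi t) = expi t.
  by rewrite mulrA -rmorphM /= mulVf ?gt_eqF// mul1r.
by rewrite -(mulrA c) E.
Qed.

Lemma cavg_ckernel a : cabs a < 1 -> cavg (ckernel a) = 1.
Proof.
move=> a1; have ca : cabs (conjc a) < 1 by rewrite cabs_conj.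
have ci : cintc (fun t => (1 - conjc a * expi t)^-1).
  apply: cintc_rcont => t e e0.
  have dd : cdiffable (fun w => (1 - conjc a * w)^-1) (expi t).
    apply: cdiffableV; last by apply: one_sub_neq0; rewrite cabsM cabs_expi mulr1.
    by apply: cdiffableB; [exact: cdiffable_cst|apply: cdiffableM; [exact: cdiffable_cst|exact: cdiffable_id]].
  have [d d0 H] := cdiffable_ccont dd e0.
  have d20 : 0 < d / 2 by lra.
  have [d1 d10 H1] := rcont_expi t d20.
  by exists d1 => // y /H1 h; apply: H; lra.
have := cavg_conj ci; rewrite cavg_geometric//.
have -> : conjc (1 : R[i]) = 1 by apply: complex_eq; rewrite //= oppr0.
move=> <-; apply: cavg_eq => t _; rewrite /ckernel.
have conjV z : conjc (z^-1) = (conjc z)^-1.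
  by apply: complex_eq; case: z => x y /=; rewrite ?sqrrN ?mulNr ?mulrN.
have conjM z w : conjc (z * w) = conjc z * conjc w.
  by apply: complex_eq; case: z => x y; case: w => x' y' /=; ring.
have conjB z w : conjc (z - w) = conjc z - conjc w.
  by apply: complex_eq; case: z => x y; case: w => x' y' /=; ring.
have conjK z : conjc (conjc z) = z by case: z => x y /=; rewrite opprK.
have conj1 : conjc (1 : R[i]) = 1 by apply: complex_eq; rewrite //= oppr0.
by rewrite conjV conjB conjM conjK conj1.
Qed.

Lemma rcontM (F G : R -> R[i]) : rcont F -> rcont G -> rcont (fun t => F t * G t).
Proof.
move=> cF cG x e e0.
have f1 : 0 < cabs (F x) + 1 by rewrite ltr_wpDl// cabs_ge0.
have g1 : 0 < cabs (G x) + 1 by rewrite ltr_wpDl// cabs_ge0.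
have e1 : 0 < e / 2 / (cabs (G x) + 1) by rewrite !divr_gt0.
have e2 : 0 < Num.min 1 (e / 2 / (cabs (F x) + 1)) by rewrite lt_min ltr01 !divr_gt0.
have [d1 d10 H1] := cF x _ e1; have [d2 d20 H2] := cG x _ e2.
exists (Num.min d1 d2); first by rewrite lt_min d10.
move=> y; rewrite lt_min => /andP[/H1 h1 /H2]; rewrite le_min => /andP[h2 h3].
have -> : F y * G y - F x * G x = (F y - F x) * G y + F x * (G y - G x) by ring.
rewrite (le_trans (cabsD _ _))// !cabsM (_ : e = e / 2 + e / 2); last by field.
have gy : cabs (G y) <= cabs (G x) + 1.
  by rewrite -(subrK (G x) (G y)) (le_trans (cabsD _ _))// addrC lerD2l.
rewrite lerD//.
  by rewrite (le_trans (ler_pM (cabs_ge0 _) (cabs_ge0 _) h1 gy))// mulfVK// gt_eqF.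
rewrite (le_trans (ler_wpM2l (cabs_ge0 _) h3))// mulrC mulrAC ler_pdivrMr//.
by rewrite ler_wpM2l ?lerDl//; lra.
Qed.

Lemma rcont_comp h (F : R -> R[i]) : rcont F -> (forall t, ccont h (F t)) -> rcont (fun t => h (F t)).
Proof.
move=> cF ch t e e0; have [d d0 H] := ch t e e0.
have d20 : 0 < d / 2 by lra.
by have [d1 d10 H1] := cF t _ d20; exists d1 => // y /H1 h1; apply: H; lra.
Qed.

Lemma rcont_ckernel a : cabs a < 1 -> rcont (ckernel a).
Proof.
move=> a1; apply: (@rcont_comp (fun w => (1 - a * w)^-1) (fun t => conjc (expi t))).
  move=> t e e0; have [d d0 H] := rcont_expi t e0; exists d => // y /H.
  by rewrite -(cabs_conj (_ - _)); congr (cabs _ <= _); apply: complex_eq => /=; ring.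
move=> t; apply: cdiffable_ccont; apply: cdiffableV.
  by apply: cdiffableB; [exact: cdiffable_cst|apply: cdiffableM; [exact: cdiffable_cst|exact: cdiffable_id]].
by apply: one_sub_neq0; rewrite cabsM cabs_conj cabs_expi mulr1.
Qed.

(** With z = r a, the function [G] is w (f w - f z) / (w - z), continued to z by z f'(z). The factor
    w makes [G] vanish at 0 and turns 1 / (w - z) into the kernel on |w| = r, so the vanishing of
    the mean of [G] is Cauchy's formula. *)
Lemma cauchy_scaled f r a : analytic f -> 0 < r < 1 -> cabs a < 1 ->
  cavg (fun t => f (r%:C * expi t) * ckernel a t) = f (r%:C * a).
Proof.
move=> af /andP[r0 r1] a1; have [z zE] : exists z, z = r%:C * a by exists (r%:C * a).
rewrite -zE.
have zr : cabs z < r by rewrite zE cabsM cabs_real (gtr0_norm r0) gtr_pMr.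
have z1 : cabs z < 1 by exact: lt_trans r1.
have [c Hc] := af z z1.
pose G w := if w == z then z * c else w * (f w - f z) / (w - z).
have dG w : cabs w < 1 -> w != z -> cdiffable G w.
  move=> w1 wz; have wz0 : 0 < cabs (w - z) by rewrite cabs_gt0 subr_eq0.
  apply: (@cdiffable_near _ (fun w => w * (f w - f z) / (w - z)) _ _ _ wz0).
    move=> v vw; rewrite /G; case: eqP => // E; move: vw; by rewrite E cabsBC ltxx.
  apply: cdiffableM; last first.
    apply: cdiffableV; last by rewrite subr_eq0.
    by apply: cdiffableB; [exact: cdiffable_id|exact: cdiffable_cst].
  apply: cdiffableM; first exact: cdiffable_id.
  by apply: cdiffableB; [exact: af|exact: cdiffable_cst].
have cG : ccont G z.
  move=> e e0.
  have c1 : 0 < cabs c + 1 by rewrite ltr_wpDl// cabs_ge0.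
  have e20 : 0 < e / 2 by lra.
  have [d d0 H] := Hc _ e20.
  exists (Num.min (Num.min d (1 - cabs z)) (e / 2 / (cabs c + 1))).
    by rewrite !lt_min d0 subr_gt0 z1 !divr_gt0.
  move=> w; rewrite !lt_min => /andP[/andP[wd wz1] we].
  have [->|wz] := eqVneq w z; first by rewrite subrr cabs0 ltW.
  rewrite /G eqxx (negbTE wz).
  have wz0 : w - z != 0 by rewrite subr_eq0.
  have w1 : cabs w <= 1.
    by rewrite -(subrK z w) (le_trans (cabsD _ _))//; lra.
  have -> : w * (f w - f z) / (w - z) - z * c =
     w * ((f w - f z - c * (w - z)) / (w - z)) + c * (w - z) by field.
  rewrite (le_trans (cabsD _ _))// (_ : e = e / 2 + e / 2); last by field.
  rewrite lerD//.
    rewrite !cabsM cabsV -[leRHS]mul1r ler_pM ?cabs_ge0// ?mulr_ge0 ?invr_ge0 ?cabs_ge0//.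
    by rewrite ler_pdivrMr ?cabs_gt0// H.
  rewrite cabsM; move: we; rewrite ltr_pdivlMr// => we.
  have := cabs_ge0 (w - z); nra.
have r01 : 0 <= r < 1 by rewrite ltW.
have := @cmean_const G (cabs z) r _ _ _ r01; rewrite cabs_ge0 z1.
have -> : G 0 = 0 by rewrite /G; case: eqP => [<-|_]; rewrite !mul0r.
move=> H; have {H} : cmean G r = 0.
  apply: H => //.
    move=> w w1; have [->//|wz] := eqVneq w z; apply: cdiffable_ccont; exact: dG.
  move=> w /andP[_ w1] wz; apply: dG => //; by apply: contra wz => /eqP ->.
have rc2 := rcont_ckernel a1.
have rc1 : cintc (fun t => f (r%:C * expi t) * ckernel a t).
  apply/cintc_rcont/rcontM => //; apply: rcont_circle; first exact: ltW.
  by move=> w wr; apply: analytic_ccont => //; rewrite wr.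
have {}rc2 := cintc_rcont rc2.
have -> : cmean G r = cavg (fun t => f (r%:C * expi t) * ckernel a t + - f z * ckernel a t).
  apply: cavg_eq => t _; rewrite /G.
  have wz : r%:C * expi t != z.
    by apply/eqP => E; move: zr; rewrite -E cabs_scale ?ltxx// ltW.
  have E0 : expi t != 0 :> R[i] by rewrite -cabs_eq0 cabs_expi oner_eq0.
  have r0' : r%:C != 0 :> R[i] by rewrite -cabs_eq0 cabs_real normr_eq0 gt_eqF.
  have -> : ckernel a t = r%:C * expi t / (r%:C * expi t - z).
    have -> : r%:C * expi t - z = r%:C * expi t * (1 - a * (expi t)^-1) by rewrite zE; field.
    by rewrite invfM mulrA mulfV ?mul1r ?mulf_neq0// /ckernel expi_conj.
  by rewrite (negbTE wz); ring.
rewrite cavgD//; last exact: cintcZ.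
by rewrite cavgZ// cavg_ckernel// mulr1 => /eqP; rewrite subr_eq0 => /eqP.
Qed.

(* [g] only needs to be holomorphic on a neighbourhood of the closed disc: rescale. *)
Lemma cauchy_unit g r a : 0 < r < 1 -> (forall w, r * cabs w < 1 -> cdiffable g w) ->
  cabs a < 1 -> cavg (fun t => g (expi t) * ckernel a t) = g a.
Proof.
move=> /andP[r0 r1] dg a1.
have K w : (r^-1)%:C * (r%:C * w) = w by rewrite mulrA -rmorphM /= mulVf ?gt_eqF// mul1r.
have ag : analytic (fun w => g ((r^-1)%:C * w)).
  move=> w w1; apply: cdiffable_comp.
    by apply: cdiffableM; [exact: cdiffable_cst|exact: cdiffable_id].
  by apply: dg; rewrite cabsM cabs_real gtr0_norm ?invr_gt0// mulrA divff ?gt_eqF// mul1r.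
have := cauchy_scaled ag (r := r) (a := a); rewrite r0 r1 => /(_ isT a1).
by rewrite K => <-; apply: cavg_eq => t _; rewrite K.
Qed.

Definition poisson a t : R := (1 - cabs a ^+ 2) / cabs (1 - conjc a * expi t) ^+ 2.

Lemma poissonE a t : cabs a < 1 ->
  (poisson a t)%:C = (1 - cabs a ^+ 2)%:C / (1 - conjc a * expi t) * ckernel a t.
Proof.
move=> a1; rewrite -mulrA /ckernel -invfM /poisson rmorphM /= fmorphV /=; congr (_ / _).
rewrite cabs_sqr; apply: complex_eq; case: a a1 => x y a1; rewrite /= ?cplxE /=; ring.
Qed.

Lemma poisson_ge0 a t : cabs a < 1 -> 0 <= poisson a t.
Proof.
move=> a1; rewrite mulr_ge0 ?invr_ge0 ?sqr_ge0// subr_ge0.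
by rewrite exprn_ile1 ?cabs_ge0// ltW.
Qed.

Lemma poisson_le a t : cabs a < 1 -> poisson a t <= 2 / (1 - cabs a).
Proof.
move=> a1; have a0 := cabs_ge0 a.
have h : 1 - cabs a <= cabs (1 - conjc a * expi t).
  have := cabs_dist 1 (conjc a * expi t); rewrite cabs1 cabsM cabs_expi mulr1 cabs_conj.
  by rewrite ler_norml => /andP[]; lra.
have p : 0 < 1 - cabs a by lra.
rewrite /poisson ler_pdivrMr; last by rewrite exprn_gt0// (lt_le_trans p).
rewrite mulrAC ler_pdivlMr//.
have : (1 - cabs a) ^+ 2 <= cabs (1 - conjc a * expi t) ^+ 2 by rewrite ler_pXn2r// ?nnegrE ?ltW// (lt_le_trans p).
have : 0 <= (1 - cabs a) ^+ 2 by rewrite sqr_ge0.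
move: (cabs _ ^+ 2) => X; nra.
Qed.

Lemma rcont_poisson a : cabs a < 1 -> rcont (fun t => (poisson a t)%:C).
Proof.
move=> a1; under eq_fun do rewrite poissonE//.
apply: rcontM; last exact: rcont_ckernel.
apply: (@rcont_comp (fun w => (1 - cabs a ^+ 2)%:C / (1 - conjc a * w)) (@expi R)); first exact: rcont_expi.
move=> t; apply/cdiffable_ccont/cdiffableM; first exact: cdiffable_cst.
apply: cdiffableV; last by apply: one_sub_neq0; rewrite cabsM cabs_expi mulr1 cabs_conj.
by apply: cdiffableB; [exact: cdiffable_cst|apply: cdiffableM; [exact: cdiffable_cst|exact: cdiffable_id]].
Qed.

(** Cauchy's formula for w -> f(r w) (1 - |a|^2) / (1 - conj(a) w), whose value at a is f(r a) and
    whose product with the Cauchy kernel is f(r w) times the Poisson kernel on the circle. Any k in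
    ]max(r, |a|), 1[ makes it holomorphic for k |w| < 1. *)
Lemma poisson_scaled f r a : analytic f -> 0 <= r < 1 -> cabs a < 1 ->
  cavg (fun t => (poisson a t)%:C * f (r%:C * expi t)) = f (r%:C * a).
Proof.
move=> af /andP[r0 r1] a1.
pose k := (1 + Num.max r (cabs a)) / 2.
have [rk ak] : r < k /\ cabs a < k.
  have m1 : r <= Num.max r (cabs a) by rewrite le_max lexx.
  have m2 : cabs a <= Num.max r (cabs a) by rewrite le_max lexx orbT.
  have : Num.max r (cabs a) < 1 by rewrite gt_max r1.
  by rewrite /k; split; lra.
have k1 : 0 < k < 1.
  have : Num.max r (cabs a) < 1 by rewrite gt_max r1.
  by rewrite (le_lt_trans r0 rk)/= /k; lra.
pose g w := f (r%:C * w) * ((1 - cabs a ^+ 2)%:C / (1 - conjc a * w)).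
have := @cauchy_unit g k a k1 _ a1.
have -> : g a = f (r%:C * a).
  rewrite /g; have -> : 1 - conjc a * a = (1 - cabs a ^+ 2)%:C.
    rewrite cabs_sqr; apply: complex_eq; case: (a) => x y /=; ring.
  rewrite divff ?mulr1// -cabs_eq0 cabs_real normr_eq0 gt_eqF// subr_gt0.
  by rewrite exprn_ilt1 ?cabs_ge0.
move=> <-.
  by apply: cavg_eq => t _; rewrite poissonE// /g; ring.
move=> w kw; have w0 := cabs_ge0 w; apply: cdiffableM.
  apply: (@cdiffable_comp _ (fun w => r%:C * w) f); last first.
    apply: af; rewrite cabsM cabs_real ger0_norm// (le_lt_trans _ kw)// ler_wpM2r// ltW//.
  by apply: cdiffableM; [exact: cdiffable_cst|exact: cdiffable_id].
apply: cdiffableM; first exact: cdiffable_cst.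
apply: cdiffableV; last first.
  apply: one_sub_neq0; rewrite cabsM cabs_conj (le_lt_trans _ kw)// ler_wpM2r// ltW//.
by apply: cdiffableB; [exact: cdiffable_cst|apply: cdiffableM; [exact: cdiffable_cst|exact: cdiffable_id]].
Qed.

Lemma cavg_poisson a : cabs a < 1 -> ravg (poisson a) = 1.
Proof.
move=> a1; have := @poisson_scaled (fun=> 1) 0 a _ _ a1; rewrite lexx ltr01.
move=> /(_ _ isT) H; have := H (fun z _ => cdiffable_cst _ _).
move=> /(congr1 Re) /= <-; apply: ravg_eq => t _ /=.
by rewrite mulr1 mulr0 subr0.
Qed.

End DiscCauchy.

(** * Montel's theorem *)

Section Montel.
Variable R : realType.
Local Notation mu := (@lebesgue_measure R).
Local Notation Re := (@complex.Re R).
Local Notation Im := (@complex.Im R).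
Local Notation carc := (@carc R).
Local Notation cmeas := (cmeasurable carc).
Implicit Types (s t x y e r : R) (z w a : R[i]) (f g h : R[i] -> R[i]) (F G K : R -> R[i]).
Local Open Scope complex_scope.

Lemma cmeas_cintc F : cintc F -> cmeas F.
Proof. by move=> [/cint_meas h1 /cint_meas h2]. Qed.

Lemma cmeas_rcont F : rcont F -> cmeas F.
Proof. by move=> /cintc_rcont/cmeas_cintc. Qed.

Lemma cint_cabs F : cintc F -> cint (fun t => cabs (F t)).
Proof.
move=> [h1 h2]; apply: (@cint_le _ _ (fun t => `|(Re \o F) t| + `|(Im \o F) t|)).
- by apply: measurable_cabs; split; exact: cint_meas.
- by apply: cintD; exact: cint_abs.
- by move=> t _; rewrite ger0_norm ?cabs_ge0// cabs_le_ReIm.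
Qed.

Lemma cintc_le F (g : R -> R) : cmeas F -> cint g -> (forall t, carc t -> cabs (F t) <= g t) -> cintc F.
Proof.
move=> [h1 h2] gi Fg; split; apply: (cint_le _ gi) => // t /Fg h /=.
  exact: le_trans (Re_le_cabs _) h.
exact: le_trans (Im_le_cabs _) h.
Qed.

Lemma cintc_mul F K (M : R) : cmeas F -> cintc K -> (forall t, carc t -> cabs (F t) <= M) ->
  cintc (fun t => F t * K t).
Proof.
move=> mF iK FM; apply: (@cintc_le _ (fun t => M * cabs (K t))).
- by apply: cmeasurableM => //; exact: cmeas_cintc.
- by apply: cintZ; exact: cint_cabs.
- by move=> t /FM h; rewrite cabsM ler_wpM2r ?cabs_ge0.
Qed.

Lemma cabs_ckernel a t : cabs a < 1 -> cabs (ckernel a t) <= (1 - cabs a)^-1.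
Proof.
move=> a1; rewrite /ckernel cabsV lef_pV2 ?posrE ?subr_gt0// ?cabs_gt0 ?one_sub_neq0//.
  have := cabs_dist 1 (a * conjc (expi t)); rewrite cabs1 cabsM cabs_conj cabs_expi mulr1.
  by rewrite ler_norml => /andP[]; lra.
by rewrite cabsM cabs_conj cabs_expi mulr1.
Qed.

(** The resolvent identity: it gives both the derivative of a Cauchy transform and the Lipschitz
    bound behind Montel's theorem. *)
Lemma ckernelB a b t : cabs a < 1 -> cabs b < 1 ->
  ckernel b t - ckernel a t = (b - a) * conjc (expi t) * ckernel a t * ckernel b t.
Proof.
move=> a1 b1; rewrite /ckernel; set E := conjc (expi t).
have En : cabs E = 1 by rewrite cabs_conj cabs_expi.
have ha : 1 - a * E != 0 by rewrite one_sub_neq0// cabsM En mulr1.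
have hb : 1 - b * E != 0 by rewrite one_sub_neq0// cabsM En mulr1.
by field; rewrite ha hb.
Qed.

Lemma rcont_conj_expi : rcont (fun t => conjc (@expi R t)).
Proof.
move=> t e e0; have [d d0 H] := rcont_expi t e0; exists d => // y /H.
by rewrite -(cabs_conj (_ - _)); congr (cabs _ <= _); apply: complex_eq => /=; ring.
Qed.

Lemma cauchy_transform_cdiffable G (M : R) : cmeas G -> (forall t, carc t -> cabs (G t) <= M) ->
  forall a, cabs a < 1 -> cdiffable (fun a => cavg (fun t => G t * ckernel a t)) a.
Proof.
move=> mG GM a a1.
have rK b : cabs b < 1 -> rcont (ckernel b) by exact: rcont_ckernel.
have M0 : 0 <= M by rewrite (le_trans (cabs_ge0 (G 0)))// GM// /carc /= in_itv /= lexx two_pi_gt0.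
pose D t : R[i] := conjc (expi t) * ckernel a t * ckernel a t.
have rD : rcont D by apply: rcontM; [apply: rcontM; [exact: rcont_conj_expi|exact: rK]|exact: rK].
have gi K : rcont K -> cintc (fun t => G t * K t).
  by move=> cK; apply: cintc_mul mG (cintc_rcont cK) GM.
exists (cavg (fun t => G t * D t)) => e e0.
set d := 1 - cabs a; have d0 : 0 < d by rewrite /d; lra.
pose C := 2 * (M * (d^-1 * d^-1 * (2 / d))).
have C0 : 0 <= C by rewrite !mulr_ge0// ?invr_ge0 ltW.
exists (Num.min (d / 2) (e / (C + 1))); first by rewrite lt_min !divr_gt0//; lra.
move=> b; rewrite lt_min => /andP[bd]; rewrite ltr_pdivlMr; last by lra.
move=> be.
have b1 : cabs b < 1 - d / 2.
  rewrite -(subrK a b) (le_lt_trans (cabsD _ _))//; rewrite /d in bd *; lra.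
have b1' : cabs b < 1 by lra.
rewrite -[X in _ - X - _]mul1r -mulNr -[X in _ + X - _]cavgZ; last exact/gi/rK.
rewrite [cavg (fun t => G t * D t) * _]mulrC -mulNr -[- (b - a) * _]cavgZ; last exact: gi.
rewrite -cavgD; [|exact/gi/rK|exact/cintcZ/gi/rK].
rewrite -cavgD; [|apply: cintcD; [exact/gi/rK|exact/cintcZ/gi/rK]|exact/cintcZ/gi].
set W := fun t => _.
(* Two applications of the resolvent identity show that the remainder is of second order in b -
   a. *)
have WE t : W t = G t * ((b - a) ^+ 2 * (conjc (expi t) ^+ 2 * (ckernel a t * ckernel a t * ckernel b t))).
  rewrite /W /D; have := ckernelB t a1 b1'; move: (conjc _) => E.
  move: (ckernel a t) (ckernel b t) => A B /(canRL (subrK _)) BE.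
  have E2 : B - A = (b - a) * E * A * B by rewrite [X in X - _]BE addrK.
  have -> : (b - a) ^+ 2 * (E ^+ 2 * (A * A * B)) = (b - a) * E * A * (B - A) by rewrite E2; ring.
  have -> : G t * B + -1 * (G t * A) + - (b - a) * (G t * (E * A * A)) =
     G t * ((B - A) - (b - a) * E * A * A) by ring.
  by rewrite {1}E2; ring.
have iW : cintc W.
  apply: cintcD; first apply: cintcD; [exact/gi/rK|exact/cintcZ/gi/rK|exact/cintcZ/gi].
have -> : e * cabs (b - a) = cabs (b - a) * e by rewrite mulrC.
apply: (le_trans (@cabs_cavg_le _ W (fun=> M * (cabs (b - a) ^+ 2 * (d^-1 * d^-1 * (2 / d)))) iW _ _)).
- exact: cint_cst.
- move=> t ct; rewrite WE cabsM ler_pM ?cabs_ge0 ?GM//.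
  rewrite cabsM cabsX ler_wpM2l ?sqr_ge0// cabsM cabsX cabs_conj cabs_expi expr1n mul1r.
  rewrite !cabsM; apply: ler_pM; rewrite ?mulr_ge0 ?cabs_ge0//.
    by apply: ler_pM; rewrite ?cabs_ge0// cabs_ckernel.
  rewrite (le_trans (cabs_ckernel _ b1'))// -[2 / d]invf_div lef_pV2 ?posrE ?divr_gt0//; lra.
rewrite ravg_cst.
have -> : 2 * (M * (cabs (b - a) ^+ 2 * (d^-1 * d^-1 * (2 / d)))) = cabs (b - a) * (C * cabs (b - a)).
  by rewrite /C; ring.
rewrite ler_wpM2l ?cabs_ge0//; have := cabs_ge0 (b - a); nra.
Qed.

Definition locally_bounded (f_ : nat -> R[i] -> R[i]) := forall r, r < 1 ->
  exists M : R, forall n z, cabs z <= r -> cabs (f_ n z) <= M.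

Lemma ae_all (P : R -> Prop) : (forall t, P t) -> {ae mu, forall t, P t}.
Proof. by move=> H; apply: aeW => t. Qed.

Lemma ccvg_unique (u : nat -> R[i]) (l l' : R[i]) : ccvg u l -> ccvg u l' -> l = l'.
Proof.
move=> /ccvgP[h1 h2] /ccvgP[h3 h4]; apply: complex_eq.
  exact: (cvg_unique _ h1 h3).
exact: (cvg_unique _ h2 h4).
Qed.

Lemma ccvgZ (u : nat -> R[i]) (l k : R[i]) : ccvg u l -> ccvg (fun n => u n * k) (l * k).
Proof.
move=> h; have : cabs (u n - l) * cabs k @[n --> \oo] --> 0 * cabs k by exact: cvgMl.
by rewrite mul0r /ccvg; under [in X in _ -> X]eq_fun do rewrite -mulrBl cabsM.
Qed.

Lemma ccvg_le (u : nat -> R[i]) (l : R[i]) (M : R) : ccvg u l -> (forall n, cabs (u n) <= M) -> cabs l <= M.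
Proof.
move=> /cvgrPdist_le h uM; apply/ler_addgt0Pl => e e0.
have [N _ /(_ N (leqnn N)) /=] := h e e0.
rewrite sub0r normrN ger0_norm ?cabs_ge0// cabsBC => hN.
rewrite -(subrK (u N) l) (le_trans (cabsD _ _))// lerD//.
Qed.

(** Cauchy's formula on a circle around z passes to the limit by dominated convergence, so near z
    the limit is a Cauchy transform of a bounded measurable function. *)
Lemma analytic_lim (f_ : nat -> R[i] -> R[i]) f : (forall n, analytic (f_ n)) ->
  locally_bounded f_ -> (forall z, cabs z < 1 -> ccvg (f_ ^~ z) (f z)) -> analytic f.
Proof.
move=> af lb cf z z1; pose r := (1 + cabs z) / 2.
have zr : cabs z < r by rewrite /r; lra.
have r1 : r < 1 by rewrite /r; lra.
have r0 : 0 < r by exact: le_lt_trans (cabs_ge0 _) zr.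
have [M HM] := lb r r1.
have cr t : cabs (r%:C * expi t) = r by rewrite cabs_scale// ltW.
pose G t := f (r%:C * expi t).
have rc n : rcont (fun t => f_ n (r%:C * expi t)).
  by apply: rcont_circle => [|w wr]; [exact: ltW|apply: analytic_ccont => //; rewrite wr].
have mG : cmeas G.
  apply: (@cmeasurable_lim _ _ _ carc (fun n t => f_ n (r%:C * expi t))) => [n|t _]; first exact: cmeas_rcont.
  by apply: cf; rewrite cr.
have GM t : carc t -> cabs (G t) <= M.
  move=> _; apply: (@ccvg_le (fun n => f_ n (r%:C * expi t))).
    by apply: cf; rewrite cr.
  by move=> n; apply: HM; rewrite cr.
have key a : cabs a < 1 -> f (r%:C * a) = cavg (fun t => G t * ckernel a t).
  move=> a1; have ra1 : cabs (r%:C * a) < 1.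
    rewrite cabsM cabs_real gtr0_norm//; have := cabs_ge0 a; nra.
  have h1 := cf _ ra1.
  have iK := cintc_rcont (rcont_ckernel a1).
  have [|||||||_ h2] := @cavg_dct _ (fun n t => f_ n (r%:C * expi t) * ckernel a t)
    (fun t => G t * ckernel a t) (fun t => M * cabs (ckernel a t)).
  - by move=> n; case: (cmeasurableM (cmeas_rcont (rc n)) (cmeas_cintc iK)).
  - by move=> n; case: (cmeasurableM (cmeas_rcont (rc n)) (cmeas_cintc iK)).
  - by case: (cmeasurableM mG (cmeas_cintc iK)).
  - by case: (cmeasurableM mG (cmeas_cintc iK)).
  - by apply: ae_all => t _; apply: ccvgZ; apply: cf; rewrite cr.
  - by apply: cintZ; exact: cint_cabs.
  - by move=> n t _; rewrite cabsM ler_wpM2r ?cabs_ge0// HM// cr.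
  apply: ccvg_unique h1 _; move: h2; congr (ccvg _ _); apply/funext => n.
  by rewrite cauchy_scaled// r0 r1.
have d0 : 0 < r - cabs z by lra.
have K w : r%:C * ((r^-1)%:C * w) = w by rewrite mulrA -rmorphM /= mulfV ?gt_eqF// mul1r.
apply: (@cdiffable_near _ (fun w => cavg (fun t => G t * ckernel ((r^-1)%:C * w) t)) _ _ _ d0).
  move=> w wz; rewrite -key ?K// cabsM cabs_real gtr0_norm ?invr_gt0// mulrC ltr_pdivrMr// mul1r.
  by rewrite -(subrK z w) (le_lt_trans (cabsD _ _))//; lra.
apply: (@cdiffable_comp _ (fun w => (r^-1)%:C * w) (fun a => cavg (fun t => G t * ckernel a t))).
  by apply: cdiffableM; [exact: cdiffable_cst|exact: cdiffable_id].
apply: (cauchy_transform_cdiffable mG GM).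
by rewrite cabsM cabs_real gtr0_norm ?invr_gt0// mulrC ltr_pdivrMr// mul1r.
Qed.

(** Compactness gives a cluster point of the image filter, and for an ultrafilter a cluster point is
    a limit. *)
Lemma ultra_bounded_cvg (U : set_system nat) (u : nat -> R) (M : R) : UltraFilter U ->
  (forall n, `|u n| <= M) -> exists p, forall e, 0 < e -> U [set n | `|u n - p| < e].
Proof.
move=> UU uM.
have pU : ProperFilter U by exact: ultra_proper.
have sub : U (u @^-1` `[- M, M]).
  by apply: filterS filterT => n _ /=; rewrite in_itv /= -ler_norml.
have [p [_ cp]] := @segment_compact R (- M) M (u @ U) (fmap_proper_filter u pU) sub.
exists p => e e0.
have [//|nU] := in_ultra_setVsetC [set n | `|u n - p| < e] UU.
have A : (u @ U) (~` ball p e).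
  have : U (u @^-1` (~` ball p e)); last by [].
  by apply: (@filterS _ U _ _ _ _ nU) => n /= h1 h2; apply: h1; move: h2; rewrite /ball /= distrC.
by have [x [h1 h2]] := cp _ _ A (nbhsx_ballx p e e0).
Qed.

(** The constant depends on [f] only through its bound [M], so a locally bounded family is
    equi-Lipschitz on smaller discs. *)
Lemma cauchy_lipschitz f (M r s : R) : analytic f -> 0 < r < 1 -> s < r ->
  (forall z, cabs z <= r -> cabs (f z) <= M) ->
  forall z w, cabs z <= s -> cabs w <= s ->
  cabs (f z - f w) <= 2 * (M * (r^-1 * (1 - s / r)^-1 ^+ 2)) * cabs (z - w).
Proof.
move=> af /andP[r0 r1] sr fM z w zs ws.
have s0 : 0 <= s by exact: le_trans (cabs_ge0 _) zs.
have K v : r%:C * ((r^-1)%:C * v) = v by rewrite mulrA -rmorphM /= mulfV ?gt_eqF// mul1r.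
have ab v : cabs v <= s -> cabs ((r^-1)%:C * v) <= s / r.
  by move=> vs; rewrite cabsM cabs_real gtr0_norm ?invr_gt0// mulrC ler_wpM2r// invr_ge0 ltW.
have sr1 : s / r < 1 by rewrite ltr_pdivrMr// mul1r.
set a := (r^-1)%:C * z; set b := (r^-1)%:C * w.
have a1 : cabs a < 1 by exact: le_lt_trans (ab _ zs) sr1.
have b1 : cabs b < 1 by exact: le_lt_trans (ab _ ws) sr1.
have r01 : 0 < r < 1 by rewrite r0.
have := cauchy_scaled af r01 a1; have := cauchy_scaled af r01 b1; rewrite !K => Ew Ez.
have cr t : cabs (r%:C * expi t) = r by rewrite cabs_scale// ltW.
have rc : rcont (fun t => f (r%:C * expi t)).
  by apply: rcont_circle => [|v vr]; [exact: ltW|apply: analytic_ccont => //; rewrite vr].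
have ci c : cabs c < 1 -> cintc (fun t => f (r%:C * expi t) * ckernel c t).
  by move=> c1; apply: cintc_rcont; apply: rcontM => //; exact: rcont_ckernel.
rewrite -{1}Ez -{1}Ew -[X in _ - X]mul1r -mulNr -cavgZ; last exact: ci.
rewrite -cavgD; [|exact: ci|exact/cintcZ/ci].
have M0 : 0 <= M by apply: le_trans (cabs_ge0 (f 0)) (fM 0 _); rewrite cabs0 ltW.
rewrite (le_trans (@cabs_cavg_le _ _ (fun=> M * (r^-1 * (1 - s / r)^-1 ^+ 2) * cabs (z - w)) _ _ _))//.
- by apply: cintcD; [exact: ci|exact/cintcZ/ci].
- exact: cint_cst.
- move=> t _; rewrite mulN1r -mulrBr ckernelB// !cabsM cabs_conj cabs_expi mulr1 -[leRHS]mulrA.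
  rewrite ler_pM ?mulr_ge0 ?cabs_ge0 ?fM ?cr//.
  have -> : a - b = (r^-1)%:C * (z - w) by rewrite /a /b; ring.
  rewrite cabsM cabs_real gtr0_norm ?invr_gt0//.
  have k c : cabs c <= s / r -> cabs c < 1 -> cabs (ckernel c t) <= (1 - s / r)^-1.
    move=> cs c1; rewrite (le_trans (cabs_ckernel _ c1))// lef_pV2 ?posrE; lra.
  have ka := k a (ab _ zs) a1; have kb := k b (ab _ ws) b1.
  rewrite [leRHS]mulrAC -mulrA ler_wpM2l ?mulr_ge0 ?cabs_ge0 ?invr_ge0 ?(ltW r0)// expr2.
  by rewrite ler_pM ?cabs_ge0.
- by rewrite ravg_cst mulrA.
Qed.

Definition ratpoint (j : nat) : R[i] :=
  if @unpickle (rat * rat)%type j is Some q then Complex (ratr q.1) (ratr q.2) else 0.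

Lemma ratpoint_dense z e : 0 < e -> exists j, cabs (ratpoint j - z) < e.
Proof.
move=> e0; have e20 : 0 < e / 2 by lra.
have near x : exists q : rat, `|ratr q - x| < e / 2.
  have [|q] := @rat_in_itvoo R (x - e / 2) (x + e / 2); first by lra.
  rewrite in_itv /= => /andP[h1 h2]; exists q; rewrite ltr_norml; apply/andP; split; lra.
have [p hp] := near (Re z); have [q hq] := near (Im z).
exists (pickle (p, q)); rewrite /ratpoint pickleK /=.
apply: le_lt_trans (cabs_le_ReIm _) _; rewrite !cplxE /=; lra.
Qed.

(** An ultrafilter containing the tails yields a limit f at all points of the disc at once. Then
    [sigma n] is picked so that its function is within 1 / (n + 1) of f at those of the first n
    rational points that lie in the disc, and equicontinuity spreads convergence from these points
    to the disc. *)
Theorem montel (f_ : nat -> R[i] -> R[i]) : (forall n, analytic (f_ n)) -> locally_bounded f_ ->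
  exists (sigma : nat -> nat) f, [/\ (forall m n, (m < n)%N -> (sigma m < sigma n)%N), analytic f &
    forall z, cabs z < 1 -> ccvg (fun n => f_ (sigma n) z) (f z)].
Proof.
move=> af lb.
have [U [UU oU]] := ultraFilterLemma (eventually_filter : ProperFilter (@eventually)).
have pU : ProperFilter U by exact: ultra_proper.
have ex z : exists p : R[i], cabs z < 1 -> forall e, 0 < e -> U [set n | cabs (f_ n z - p) < e].
  have [z1|] := boolP (cabs z < 1); last by exists 0.
  have [M HM] := lb _ z1.
  have [p Hp] := @ultra_bounded_cvg U (fun n => Re (f_ n z)) M UU
    (fun n => le_trans (Re_le_cabs _) (HM n z (lexx _))).
  have [q Hq] := @ultra_bounded_cvg U (fun n => Im (f_ n z)) M UU
    (fun n => le_trans (Im_le_cabs _) (HM n z (lexx _))).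
  exists (Complex p q) => _ e e0; have e20 : 0 < e / 2 by lra.
  apply: filterS2 (Hp _ e20) (Hq _ e20) => n /= h1 h2.
  apply: le_lt_trans (cabs_le_ReIm _) _; rewrite !cplxE /=; lra.
have [f Hf] := choice ex.
pose V n := [set m | forall j, (j < n)%N -> cabs (ratpoint j) < 1 ->
  cabs (f_ m (ratpoint j) - f (ratpoint j)) < n.+1%:R^-1].
have UV n : U (V n).
  have : U [set m | forall j, (j < n)%N -> cabs (ratpoint j) < 1 ->
    cabs (f_ m (ratpoint j) - f (ratpoint j)) < n.+1%:R^-1].
    have : 0 < n.+1%:R^-1 :> R by rewrite invr_gt0.
    move: (n.+1%:R^-1) => d d0.
    elim: n => [|n IH]; first by apply: filterS filterT => m _ j.
    have [q1|q1] := boolP (cabs (ratpoint n) < 1).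
      apply: filterS2 IH (Hf _ q1 d d0) => m h1 h2 j; rewrite ltnS leq_eqVlt.
      by move=> /predU1P[->//|/h1].
    apply: filterS IH => m h1 j; rewrite ltnS leq_eqVlt => /predU1P[-> q1'|/h1//].
    by rewrite q1' in q1.
  by [].
have nxt n N : exists m, (N < m)%N /\ V n m.
  have : U (V n `&` [set m | (N < m)%N]).
    by apply: filterI; [exact: UV|apply: oU; exists N.+1].
  by move=> /filter_ex[m [h1 h2]]; exists m.
have [F HF] := choice (fun p : nat * nat => nxt p.1 p.2).
pose sigma := fix s n := if n is k.+1 then F (k.+1, s k) else F (0%N, 0%N).
have sV n : V n (sigma n).
  by case: n => [|n]; [have [] := HF (0%N, 0%N)|have [] := HF (n.+1, sigma n)].
have sS n : (sigma n < sigma n.+1)%N by have [] := HF (n.+1, sigma n).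
have smono m n : (m < n)%N -> (sigma m < sigma n)%N.
  elim: n => // n IH; rewrite ltnS leq_eqVlt => /predU1P[->//|/IH h]; exact: ltn_trans h (sS n).
have conv z : cabs z < 1 -> ccvg (fun n => f_ (sigma n) z) (f z).
  move=> z1; pose s := (2 * cabs z + 1) / 3; pose r := (cabs z + 2) / 3.
  have [zs sr r1] : [/\ cabs z < s, s < r & r < 1] by rewrite /s /r; split; lra.
  have s0 : 0 < s by exact: le_lt_trans (cabs_ge0 _) zs.
  have r0 : 0 < r by exact: lt_trans sr.
  have [M HM] := lb _ r1.
  pose L := 2 * (M * (r^-1 * (1 - s / r)^-1 ^+ 2)).
  have r01 : 0 < r < 1 by rewrite r0.
  have lip n v w : cabs v <= s -> cabs w <= s -> cabs (f_ n v - f_ n w) <= L * cabs (v - w).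
    by apply: (cauchy_lipschitz (af n) r01 sr); exact: HM.
  have M0 : 0 <= M by apply: le_trans (cabs_ge0 (f_ 0%N 0)) (HM 0%N 0 _); rewrite cabs0 ltW.
  have L0 : 0 <= L.
    by rewrite !mulr_ge0// ?invr_ge0 ?(ltW r0)// subr_ge0 ler_pdivrMr// mul1r ltW.
  apply/cvgrPdist_le => e e0.
  pose d := Num.min (s - cabs z) (e / (6 * (L + 1))).
  have d0 : 0 < d by rewrite lt_min subr_gt0 zs divr_gt0//; lra.
  have [j qj] := ratpoint_dense z d0; set q := ratpoint j in qj.
  have [qz qe] : cabs (q - z) < s - cabs z /\ cabs (q - z) < e / (6 * (L + 1)).
    by apply/andP; move: qj; rewrite lt_min.
  have qs : cabs q <= s by rewrite -(subrK z q) (le_trans (cabsD _ _))//; lra.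
  have q1 : cabs q < 1 by exact: le_lt_trans qs (lt_trans sr r1).
  have Lqz : L * cabs (q - z) <= e / 6.
    move: qe; rewrite ltr_pdivlMr; last by lra.
    have := cabs_ge0 (q - z); nra.
  have e60 : 0 < e / 6 by lra.
  (* The limit inherits the Lipschitz estimate through one index m, supplied by the ultrafilter,
     that approximates f at q and at z simultaneously. *)
  have lipf : cabs (f q - f z) <= e / 2.
    have [m [/= h1 h2]] := filter_ex (filterI (Hf q q1 _ e60) (Hf z z1 _ e60)).
    have -> : f q - f z = - (f_ m q - f q) + (f_ m q - f_ m z) + (f_ m z - f z) by ring.
    have h3 := lip m q z qs (ltW zs).
    by rewrite (le_trans (cabsD _ _))// (le_trans (lerD (cabsD _ _) (lexx _)))// cabsN; lra.
  pose N := maxn j (Num.truncn (6 / e)).+1.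
  exists N.+1 => // n /= Nn.
  rewrite sub0r normrN ger0_norm ?cabs_ge0//.
  have jn : (j < n)%N by rewrite (leq_ltn_trans _ Nn)// leq_maxl.
  have h1 : cabs (f_ (sigma n) q - f q) < n.+1%:R^-1 := sV n j jn q1.
  have ne : n.+1%:R^-1 <= e / 6 :> R.
    rewrite -[e / 6]invf_div lef_pV2 ?posrE ?divr_gt0// ltW// (lt_le_trans (truncnS_gt _))//.
    by rewrite ler_nat (leq_trans _ (leqnSn _))// (leq_trans _ (ltnW Nn))// leq_maxr.
  have {}h1 := lt_le_trans h1 ne.
  have -> : f_ (sigma n) z - f z = - (f_ (sigma n) q - f_ (sigma n) z) +
      (f_ (sigma n) q - f q) + (f q - f z) by ring.
  have h3 := lip (sigma n) q z qs (ltW zs).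
  by rewrite (le_trans (cabsD _ _))// (le_trans (lerD (cabsD _ _) (lexx _)))// cabsN; lra.
exists sigma, f; split => //.
apply: (@analytic_lim (fun n => f_ (sigma n))) => // r1 r11.
by have [M HM] := lb _ r11; exists M => n z; exact: HM.
Qed.

End Montel.

(** * Fatou's theorem *)

Section PoissonMaximal.
Variable R : realType.
Local Notation mu := (@lebesgue_measure R).
Local Notation Re := (@complex.Re R).
Local Notation Im := (@complex.Im R).
Local Notation carc := (@carc R).
Implicit Types (a b c t x y e r : R) (u v k : R -> R).
Local Open Scope complex_scope.

Lemma cont_integrable u a b : continuous u -> mu.-integrable `[a, b] (EFin \o u).
Proof.
move=> cu; apply: continuous_compact_integrable; first exact: segment_compact.
exact: continuous_subspaceT.
Qed.

Lemma Rintegral_shift u a x : continuous u -> 0 < x ->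
  \int[mu]_(t in `[a, a + x]) u t = \int[mu]_(t in `[0, x]) u (a + t).
Proof.
move=> cu x0; rewrite /Rintegral.
have D : derive1 (fun t : R => a + t) = cst 1.
  apply/funext => t; rewrite derive1E deriveD// derive_cst derive_id add0r//.
have dF t : derivable (fun t : R => a + t) t 1 by apply: derivableD.
have cF : continuous (fun t : R => a + t).
  by move=> t; apply: differentiable_continuous; apply/derivable1_diffP.
rewrite -{1}(addr0 a).
rewrite (@integration_by_substitution_increasing _ (fun t => a + t) u 0 x (ltW x0)) ?D.
- by congr fine; apply: eq_integral => t _ /=; rewrite mulr1.
- by move=> y z _ _; rewrite ltrD2l.
- by move=> t _; exact: cvg_cst.
- exact: is_cvg_cst.
- exact: is_cvg_cst.
- by split => //; [exact: cvg_at_right_filter (cF _)|exact: cvg_at_left_filter (cF _)].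
- exact: continuous_subspaceT.
Qed.

Lemma Rintegral_reflect u a x : continuous u -> 0 < x ->
  \int[mu]_(t in `[a - x, a]) u t = \int[mu]_(t in `[0, x]) u (a - t).
Proof.
move=> cu x0; rewrite /Rintegral.
have dF t : derivable (fun t : R => a - t) t 1 by apply: derivableB.
have D : derive1 (fun t : R => a - t) = cst (- 1).
  apply/funext => t; rewrite derive1E deriveB// derive_cst derive_id add0r//.
have cF : continuous (fun t : R => a - t).
  by move=> t; apply: differentiable_continuous; apply/derivable1_diffP.
rewrite -{2}(subr0 a).
rewrite (@integration_by_substitution_decreasing _ (fun t => a - t) u 0 x (ltW x0)) ?D.
- by congr fine; apply: eq_integral => t _ /=; rewrite opprK mulr1.
- by move=> y z _ _; rewrite ltrD2l ltrN2.
- by move=> t _; exact: cvg_cst.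
- exact: is_cvg_cst.
- exact: is_cvg_cst.
- by split => //; [exact: cvg_at_right_filter (cF _)|exact: cvg_at_left_filter (cF _)].
- exact: continuous_subspaceT.
Qed.

Lemma Rintegral_chasles u a b c : a <= b -> b <= c -> continuous u ->
  \int[mu]_(x in `[a, c]) u x = \int[mu]_(x in `[a, b]) u x + \int[mu]_(x in `[b, c]) u x.
Proof.
move=> ab bc cu; rewrite -(Rintegral_itv_obnd_cbnd (r := b)).
  rewrite -(@Rintegral_itvB _ u (BLeft a) (BRight c) b)//; first by rewrite addrC subrK.
  exact: cont_integrable.
by apply: integrableS (cont_integrable b c cu) => //; exact: subset_itv_oc_cc.
Qed.

Lemma continuous_shift u a : continuous u -> continuous (fun t => u (a + t)).
Proof.
move=> cu t; apply: (@continuous_comp _ _ _ (fun t => a + t) u); last exact: cu.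
by apply: continuousD; [exact: cvg_cst|exact: cvg_id].
Qed.

Lemma continuous_reflect u a : continuous u -> continuous (fun t => u (a - t)).
Proof.
move=> cu t; apply: (@continuous_comp _ _ _ (fun t => a - t) u); last exact: cu.
by apply: continuousB; [exact: cvg_cst|exact: cvg_id].
Qed.

Lemma Rintegral_fold u a x : continuous u -> 0 < x ->
  \int[mu]_(t in `[a - x, a + x]) u t = \int[mu]_(t in `[0, x]) (u (a + t) + u (a - t)).
Proof.
move=> cu x0; rewrite (@Rintegral_chasles _ _ a)//; [|lra|lra].
rewrite Rintegral_shift// Rintegral_reflect// RintegralD//; first by rewrite addrC.
  by apply: cont_integrable; exact: continuous_shift.
by apply: cont_integrable; exact: continuous_reflect.
Qed.

Lemma Rintegral_derive u x : continuous u -> 0 < x ->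
  is_derive x 1 (fun y => \int[mu]_(t in `[0, y]) u t) (u x).
Proof.
move=> cu x0.
have x1 : x < x + 1 by lra.
have [d1 d2] := @continuous_FTC1_closed R u 0 x (x + 1) x1 (cont_integrable 0 (x + 1) cu) x0 (cu x).
by split; [exact: d1|rewrite -derive1E].
Qed.

(* Integration by parts in disguise: the derivative of
   [\int_0^x p (2 H - k) - p x * (2 H x - \int_0^x k)] is [- p' (2 H x - \int_0^x k) >= 0]. *)
Lemma decreasing_kernel_average (p dp k : R -> R) (b H : R) : 0 < b ->
  (forall x, is_derive x 1 p (dp x)) -> continuous k -> (forall x, 0 < x < b -> dp x <= 0) ->
  0 <= p b ->
  (forall x, 0 < x <= b -> \int[mu]_(t in `[0, x]) k t <= 2 * H * x) ->
  \int[mu]_(t in `[0, b]) (p t * k t) <= 2 * H * \int[mu]_(t in `[0, b]) p t.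
Proof.
move=> b0 dpx ck dp0 pb kH.
have cp : continuous p.
  by move=> x; apply: differentiable_continuous; apply/derivable1_diffP; exact: ex_derive.
pose q t := p t * (2 * H - k t).
have cq : continuous q.
  by move=> t; apply: cvgM; [exact: cp|apply: cvgB; [exact: cvg_cst|exact: ck]].
pose A x := \int[mu]_(t in `[0, x]) k t.
pose S x := \int[mu]_(t in `[0, x]) q t - p x * (2 * H * x - A x).
have dS x : 0 < x -> is_derive x 1 S (- (dp x * (2 * H * x - A x))).
  move=> x0; have d1 := Rintegral_derive cq x0; have d2 := Rintegral_derive ck x0.
  have d3 := dpx x.
  rewrite /S /A; apply: is_derive_eq; rewrite /GRing.scale /= /q; ring.
have c0 v : continuous v -> {within `[0, b], continuous (fun x => \int[mu]_(t in `[0, x]) v t)}.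
  by move=> cv; apply: parameterized_integral_continuous; [exact: ltW|exact: cont_integrable].
have cS : {within `[0, b], continuous S}.
  move=> x; apply: cvgB; first exact: c0.
  apply: cvgM; first exact: continuous_subspaceT.
  apply: cvgB; last exact: c0.
  by apply: continuous_subspaceT => y; apply: cvgM; [exact: cvg_cst|exact: cvg_id].
have S0 : S 0 = 0.
  by rewrite /S /A !set_itv1 !Rintegral_set1 mulr0 subrr mulr0 subrr.
have Sb : S 0 <= S b.
  apply: (@ger0_derive1_le_cc _ S 0 b) => //.
  - by move=> x; rewrite in_itv /= => /andP[x0 _]; have [] := dS x x0.
  - move=> x; rewrite in_itv /= => /andP[x0 xb].
    have [_ dv] := dS x x0; rewrite derive1E dv -mulNr mulr_ge0//.
      by rewrite oppr_ge0 dp0// x0.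
    by rewrite subr_ge0 kH// x0 ltW.
  - by rewrite in_itv /= lexx ltW.
  - by rewrite in_itv /= lexx ltW.
  - exact: ltW.
have B0 : 0 <= p b * (2 * H * b - A b) by rewrite mulr_ge0// subr_ge0 kH// b0 lexx.
have ip := cont_integrable 0 b cp.
have ipk : mu.-integrable `[0, b] (EFin \o (fun t => p t * k t)).
  by apply: cont_integrable => t; apply: cvgM; [exact: cp|exact: ck].
have : \int[mu]_(t in `[0, b]) q t = 2 * H * \int[mu]_(t in `[0, b]) p t - \int[mu]_(t in `[0, b]) (p t * k t).
  rewrite -RintegralZl// -RintegralB//; first by apply: eq_Rintegral => t _; rewrite /q; ring.
  by apply: cont_integrable => t; apply: cvgM; [exact: cvg_cst|exact: cp].
by move: Sb; rewrite S0 /S; lra.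
Qed.

(** The Poisson kernel as a function of the angular distance [t]; it is even in [t] and
    nonincreasing on [0, pi], as [decreasing_kernel_average] requires. *)
Definition pker r t : R := (1 - r ^+ 2) / (1 - 2 * r * cos t + r ^+ 2).

Lemma pker_den r t : 0 <= r < 1 -> 0 < 1 - 2 * r * cos t + r ^+ 2.
Proof.
move=> /andP[r0 r1]; have c1 := cos_le1 t.
have : 0 < (1 - r) ^+ 2 by rewrite exprn_gt0// subr_gt0.
have : 0 <= r * (1 - cos t) by rewrite mulr_ge0// subr_ge0.
nra.
Qed.

Lemma pker_ge0 r t : 0 <= r < 1 -> 0 <= pker r t.
Proof.
move=> r01; rewrite mulr_ge0 ?invr_ge0 ?(ltW (pker_den t r01))//.
by case/andP: r01 => r0 r1; rewrite subr_ge0 exprn_ile1// ltW.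
Qed.

Lemma pker_derive r t : 0 <= r < 1 -> is_derive t 1 (pker r)
  (- ((1 - r ^+ 2) * (2 * r * sin t) / (1 - 2 * r * cos t + r ^+ 2) ^+ 2)).
Proof.
move=> r01; have d0 := lt0r_neq0 (pker_den t r01).
have dc := is_derive_cos t.
have dd : is_derive t 1 (fun t => 1 - 2 * r * cos t + r ^+ 2) (2 * r * sin t).
  by apply: is_derive_eq; rewrite /GRing.scale /=; ring.
have dV := @is_deriveV R (fun t : R => 1 - 2 * r * cos t + r ^+ 2) t _ 1 d0 dd.
rewrite /pker; apply: is_derive_eq; rewrite /GRing.scale /=; field.
exact: d0.
Qed.

Lemma pker_continuous r : 0 <= r < 1 -> continuous (pker r).
Proof.
move=> r01 t; apply: differentiable_continuous; apply/derivable1_diffP.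
by have [] := pker_derive t r01.
Qed.

(** The point [- r] puts the maximum of the kernel at the angle pi, the midpoint of [0, 2 pi], so
    the integral folds symmetrically without wrapping around. *)
Lemma poisson_pker r t : 0 <= r < 1 -> poisson (- r%:C) (pi + t) = pker r t.
Proof.
move=> r01; case/andP: (r01) => r0 r1.
rewrite /poisson cabsN cabs_real (ger0_norm r0) /pker cabs_sqr; congr (_ / _).
rewrite !cplxE /= -[pi + t]addrC cosDpi sinDpi.
have -> : (1 - (- r * - cos t - - - 0 * - sin t)) ^+ 2 + (0 - (- r * - sin t + - - 0 * - cos t)) ^+ 2 =
  1 - 2 * r * cos t + r ^+ 2 * (cos t ^+ 2 + sin t ^+ 2) by ring.
by rewrite cos2Dsin2 mulr1.
Qed.

Lemma pker_cosN r t : pker r (- t) = pker r t.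
Proof. by rewrite /pker cosN. Qed.

Lemma pker_integral r : 0 <= r < 1 -> \int[mu]_(t in `[0, pi]) pker r t = pi.
Proof.
move=> r01; have p0 := pi_gt0 R.
have a1 : cabs (- r%:C : R[i]) < 1 by case/andP: r01 => ? ?; rewrite cabsN cabs_real ger0_norm.
have := cavg_poisson a1; rewrite /ravg => /(canRL (mulKf _)).
rewrite mulr1 invr_eq0 gt_eqF ?two_pi_gt0// => /(_ isT); rewrite invrK.
have cP : continuous (poisson (- r%:C)).
  by have [] := rcont_continuous (rcont_poisson a1).
have : \int[mu]_(t in carc) poisson (- r%:C) t = \int[mu]_(t in `[pi - pi, pi + pi]) poisson (- r%:C) t.
  rewrite subrr -mulr2n -mulr_natl -Rintegral_itv_bndo_bndc//.
  exact: cint_continuous.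
move=> -> ; rewrite Rintegral_fold//.
have -> : \int[mu]_(t in `[0, pi]) (poisson (- r%:C) (pi + t) + poisson (- r%:C) (pi - t)) =
    \int[mu]_(t in `[0, pi]) (2 * pker r t).
  by apply: eq_Rintegral => t _; rewrite !poisson_pker// pker_cosN; ring.
by rewrite RintegralZl//; [lra|apply: cont_integrable; exact: pker_continuous].
Qed.

(* The hypothesis says that [H] dominates the averages of [u] over the arcs centred at [x]. *)
Lemma poisson_average_le u r x H : continuous u -> (forall t, 0 <= u t) -> 0 <= r < 1 ->
  (forall d, 0 < d <= pi -> \int[mu]_(t in `[x - d, x + d]) u t <= 2 * H * d) ->
  ravg (fun t => poisson (- r%:C) t * u (x - pi + t)) <= H.
Proof.
move=> cu u0 r01 uH; have p0 := pi_gt0 R.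
have a1 : cabs (- r%:C : R[i]) < 1 by case/andP: r01 => ? ?; rewrite cabsN cabs_real ger0_norm.
have cP : continuous (poisson (- r%:C)).
  by have [] := rcont_continuous (rcont_poisson a1).
pose v t := poisson (- r%:C) t * u (x - pi + t).
have cv : continuous v by move=> t; apply: cvgM; [exact: cP|exact: continuous_shift].
pose k t := u (x + t) + u (x - t).
have ck : continuous k by move=> t; apply: cvgD; [exact: continuous_shift|exact: continuous_reflect].
have E : \int[mu]_(t in carc) v t = \int[mu]_(t in `[0, pi]) (pker r t * k t).
  have -> : \int[mu]_(t in carc) v t = \int[mu]_(t in `[pi - pi, pi + pi]) v t.
    rewrite subrr -mulr2n -mulr_natl -Rintegral_itv_bndo_bndc//.
    exact: cint_continuous.
  rewrite Rintegral_fold//; apply: eq_Rintegral => t _; rewrite /v /k !poisson_pker// pker_cosN mulrDr.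
  by congr (_ * u _ + _ * u _); ring.
rewrite /ravg -/v E ler_pdivrMl ?two_pi_gt0//.
have := @decreasing_kernel_average (pker r) _ k pi H p0 (fun t => pker_derive t r01) ck.
rewrite pker_integral// => /(_ _ _ _)/le_trans; apply; first last.
- by rewrite le_eqVlt; apply/orP; left; apply/eqP; ring.
- move=> d d0; have := uH d d0; rewrite Rintegral_fold//; by case/andP: d0.
- exact: pker_ge0.
- move=> t t0; rewrite oppr_le0 !mulr_ge0// ?invr_ge0 ?sqr_ge0//.
  + by case/andP: r01 => r0 r1; rewrite subr_ge0 exprn_ile1// ltW.
  + by case/andP: r01.
  + by case/andP: t0 => h1 h2; rewrite sin_ge0_pi// (ltW h1) (ltW h2).
Qed.

End PoissonMaximal.

(** * Square means of dilations *)

Section MeanSquare.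
Variable R : realType.
Local Notation mu := (@lebesgue_measure R).
Local Notation Re := (@complex.Re R).
Local Notation Im := (@complex.Im R).
Local Notation carc := (@carc R).
Implicit Types (a b c t x y e r s : R) (f g h : R[i] -> R[i]).
Local Open Scope complex_scope.

Lemma conjcM (z w : R[i]) : conjc (z * w) = conjc z * conjc w.
Proof. by apply: complex_eq; case: z => x y; case: w => x' y' /=; ring. Qed.

Lemma conjcB (z w : R[i]) : conjc (z - w) = conjc z - conjc w.
Proof. by apply: complex_eq; case: z => x y; case: w => x' y' /=; ring. Qed.

Lemma conjcK (z : R[i]) : conjc (conjc z) = z.
Proof. by case: z => x y /=; rewrite opprK. Qed.

Lemma cdiffable_conj f (z : R[i]) : cdiffable f (conjc z) -> cdiffable (fun w => conjc (f (conjc w))) z.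
Proof.
move=> [c H]; exists (conjc c) => e /H[d d0 {}H]; exists d => // w wz.
have := H (conjc w); rewrite -conjcB cabs_conj => /(_ wz).
by rewrite -(cabs_conj (f _ - _ - _)) !conjcB conjcM !conjcB !conjcK.
Qed.

Lemma conjcV_scale c a t : 0 < a -> conjc (c%:C / (a%:C * expi t)) = (c / a)%:C * expi t :> R[i].
Proof.
move=> a0; rewrite invfM -expi_conj mulrA conjcM conjcK -fmorphV -rmorphM /=.
by congr (_ * _); apply: complex_eq => //=; rewrite oppr0.
Qed.

Lemma rcont_analytic f r : analytic f -> 0 <= r < 1 -> rcont (fun t => f (r%:C * expi t)).
Proof.
by move=> af /andP[r0 r1]; apply: rcont_circle => // z zr; apply: analytic_ccont => //; rewrite zr.
Qed.

Lemma rcont_conj (F : R -> R[i]) : rcont F -> rcont (fun t => conjc (F t)).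
Proof.
move=> cF t e e0; have [d d0 H] := cF t e e0; exists d => // y /H.
by rewrite -conjcB cabs_conj.
Qed.

Definition cinner f a b : R[i] := cavg (fun t => f (a%:C * expi t) * conjc (f (b%:C * expi t))).

(** On |w| = a the point conj(c / w) is (c / a) [expi t], so the integrand is the restriction of
    f(w) conj(f(conj(c / w))), holomorphic for c < |w| < 1. The inner product of two dilations thus
    depends only on the product c of their radii. *)
Lemma cinner_eq f c a b : analytic f -> 0 < c -> c < a -> a <= b -> b < 1 ->
  cinner f a (c / a) = cinner f b (c / b).
Proof.
move=> af c0 ca ab b1.
have a0 : 0 < a by exact: lt_trans ca.
have b0 : 0 < b by exact: lt_le_trans ab.
have E x : 0 < x -> cinner f x (c / x) =
    cavg (fun t => (fun w => f w * conjc (f (conjc (c%:C / w)))) (x%:C * expi t)).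
  by move=> x0; apply: cavg_eq => t _; rewrite conjcV_scale.
rewrite (E a a0) (E b b0); apply: (@annulus_const _ (fun w => f w * conjc (f (conjc (c%:C / w)))) c 1) => //; first exact: ltW.
move=> z /andP[cz z1]; apply: cdiffableM; first exact: af.
apply: (@cdiffable_comp _ (fun w => c%:C / w) (fun w => conjc (f (conjc w)))).
  apply: cdiffableM; first exact: cdiffable_cst.
  by apply: cdiffableV; [exact: cdiffable_id|rewrite -cabs_gt0 (lt_trans c0)].
apply: cdiffable_conj; apply: af; rewrite cabs_conj cabsM cabsV cabs_real gtr0_norm//.
by rewrite ltr_pdivrMr ?mul1r// (lt_trans c0).
Qed.

Definition sqmean f r := ravg (fun t => cabs (f (r%:C * expi t)) ^+ 2).

Lemma cint_sq (F : R -> R[i]) : rcont F -> cint (fun t => cabs (F t) ^+ 2).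
Proof.
by move=> /rcont_abs cF; apply: cint_continuous => t; rewrite /=; apply: cvgM; exact: cF.
Qed.

Lemma sqmean_inner f r : Re (cinner f r r) = sqmean f r.
Proof.
apply: ravg_eq => t _ /=; rewrite cabs_sqr.
by case: (f _) => x y /=; ring.
Qed.

Lemma sqmean_diff f a b : analytic f -> 0 <= a < 1 -> 0 <= b < 1 ->
  ravg (fun t => cabs (f (a%:C * expi t) - f (b%:C * expi t)) ^+ 2) =
  sqmean f a + sqmean f b - 2 * Re (cinner f a b).
Proof.
move=> af a1 b1; have ca := rcont_analytic af a1; have cb := rcont_analytic af b1.
have [i1 _] := cintc_rcont (rcontM ca (rcont_conj cb)).
have i2 := cint_sq ca; have i3 := cint_sq cb.
rewrite /sqmean -mulNr -[in X in _ + X]ravgZ// -ravgD// -ravgD//; last 2 first.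
- exact: cintD.
- exact: cintZ.
apply: ravg_eq => t _ /=; rewrite !cabs_sqr.
by case: (f _) => x y; case: (f _) => x' y' /=; ring.
Qed.

(** The radii r and s^2 r have the same product as s r and s r, so the cross term of the expanded
    square is the square mean at s r. *)
Lemma sqmean_second_difference f r s : analytic f -> 0 < r < 1 -> 0 < s < 1 ->
  ravg (fun t => cabs (f (r%:C * expi t) - f ((s ^+ 2 * r)%:C * expi t)) ^+ 2) =
  sqmean f r + sqmean f (s ^+ 2 * r) - 2 * sqmean f (s * r).
Proof.
move=> af /andP[r0 r1] /andP[s0 s1].
have sr0 : 0 < s * r by rewrite mulr_gt0.
have srr : s * r < r by rewrite gtr_pMl.
have ssr : s ^+ 2 * r < s * r by rewrite expr2 -mulrA gtr_pMl.
have ssr0 : 0 < s ^+ 2 * r by rewrite mulr_gt0// exprn_gt0.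
rewrite sqmean_diff//; [|by rewrite ltW|by rewrite ltW//; lra].
rewrite -(sqmean_inner f (s * r)).
have := @cinner_eq f ((s * r) ^+ 2) (s * r) r af _ _ (ltW srr) r1.
have -> : (s * r) ^+ 2 / (s * r) = s * r by rewrite expr2 mulfK// gt_eqF.
have -> : (s * r) ^+ 2 / r = s ^+ 2 * r by rewrite exprMn -mulrA (expr2 r) mulfK// gt_eqF.
by move=> ->//; [rewrite exprn_gt0|rewrite expr2 gtr_pMr//; lra].
Qed.

(** Along r, s r, s^2 r, ... the square means form a convex sequence, their second differences being
    means of squares. A bounded convex sequence cannot increase at its first step, since it would
    then grow linearly. *)
Lemma sqmean_le f (M r s : R) : analytic f -> (forall z, cabs z < 1 -> cabs (f z) <= M) ->
  0 < r < 1 -> 0 < s < 1 -> sqmean f (s * r) <= sqmean f r.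
Proof.
move=> af fM /andP[r0 r1] /andP[s0 s1].
have sk k : 0 < s ^+ k * r < 1.
  by rewrite mulr_gt0 ?exprn_gt0//= (le_lt_trans _ r1)// ler_piMl ?exprn_ile1// ltW.
pose n k := sqmean f (s ^+ k * r).
have n0 k : 0 <= n k by apply: ravg_ge0 => t _; exact: sqr_ge0.
have M0 : 0 <= M by apply: le_trans (cabs_ge0 (f 0)) (fM 0 _); rewrite cabs0.
have nM k : n k <= M ^+ 2.
  rewrite -(ravg_cst (M ^+ 2)); apply: ravg_le; [|exact: cint_cst|].
    by apply: cint_sq; apply: rcont_analytic => //; case/andP: (sk k) => h1 h2; rewrite ltW.
  move=> t _; rewrite ler_pXn2r// ?nnegrE ?cabs_ge0// fM// cabs_scale//.
    by case/andP: (sk k).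
  by case/andP: (sk k) => /ltW.
have cvx k : n k.+1 - n k.+2 <= n k - n k.+1.
  have s01 : 0 < s < 1 by rewrite s0.
  have := sqmean_second_difference af (sk k) s01.
  have E1 : s ^+ 2 * (s ^+ k * r) = s ^+ k.+2 * r by rewrite mulrA -exprD add2n.
  have E2 : s * (s ^+ k * r) = s ^+ k.+1 * r by rewrite mulrA -exprS.
  rewrite E1 E2 => E.
  have : 0 <= ravg (fun t => cabs (f ((s ^+ k * r)%:C * expi t) - f ((s ^+ k.+2 * r)%:C * expi t)) ^+ 2).
    by apply: ravg_ge0 => t _; exact: sqr_ge0.
  by rewrite E /n; lra.
have dec k : n k - n k.+1 <= n 0%N - n 1%N.
  by elim: k => // k IH; exact: le_trans (cvx k) IH.
rewrite -subr_ge0 leNgt; apply/negP => neg.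
have {}neg : n 0%N - n 1%N < 0 by rewrite /n expr0 expr1 mul1r.
pose d := n 1%N - n 0%N; have d0 : 0 < d by rewrite /d; lra.
have lin k : n k >= k%:R * d.
  elim: k => [|k IH]; first by rewrite mul0r.
  by have := dec k; rewrite -natr1 mulrDl mul1r /d in IH *; lra.
pose k := (Num.truncn (M ^+ 2 / d)).+1.
have : M ^+ 2 < k%:R * d by rewrite -ltr_pdivrMr// truncnS_gt.
by have := lin k; have := nM k; lra.
Qed.

(* The increments of the bounded monotone function [sqmean f] control [f_r - f_(pr)]. *)
Lemma dilation_close f (M e : R) : analytic f -> (forall z, cabs z < 1 -> cabs (f z) <= M) -> 0 < e ->
  exists p r1, [/\ 0 < p < 1, 0 < r1 < 1 & forall r, r1 <= r < 1 ->
  ravg (fun t => cabs (f (r%:C * expi t) - f ((p * r)%:C * expi t))) <= e].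
Proof.
move=> af fM e0.
pose E := [set x | exists2 r, 0 < r < 1 & x = sqmean f r].
have M0 : 0 <= M by apply: le_trans (cabs_ge0 (f 0)) (fM 0 _); rewrite cabs0.
have nM r : 0 < r < 1 -> sqmean f r <= M ^+ 2.
  move=> /andP[r0 r1].
  rewrite -(ravg_cst (M ^+ 2)); apply: ravg_le; [|exact: cint_cst|].
    by apply: cint_sq; apply: rcont_analytic => //; rewrite ltW.
  by move=> t _; rewrite ler_pXn2r// ?nnegrE ?cabs_ge0// fM// cabs_scale// ltW.
have half : (0 < 2^-1 :> R) && (2^-1 < 1 :> R) by apply/andP; split; lra.
have supE : has_sup E.
  split; first by exists (sqmean f 2^-1), 2^-1.
  by exists (M ^+ 2) => _ [r r01 ->]; exact: nM.
have e20 : 0 < e ^+ 2 by rewrite exprn_gt0.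
have [_ [r0 r01 ->] Hr0] := sup_adherent e20 supE.
have [r00 r0lt] := andP r01.
have le_sup r : 0 < r < 1 -> sqmean f r <= sup E.
  by move=> r1; apply: ub_le_sup; [exact: supE.2|exists r].
have mono a b : 0 < a -> a <= b -> b < 1 -> sqmean f a <= sqmean f b.
  move=> a0; rewrite le_eqVlt => /predU1P[->//|ab] b1.
  have b0 : 0 < b by exact: lt_trans ab.
  have -> : a = a / b * b by rewrite mulfVK// gt_eqF.
  by apply: (sqmean_le af fM); rewrite ?b0// divr_gt0//= ltr_pdivrMr// mul1r.
(* If r >= r0 / s then s r >= r0, so the square mean at s r is within e^2 of the supremum, and the
   second difference is below e^2. *)
pose s := (1 + r0) / 2.
have [s0 s1 r0s] : [/\ 0 < s, s < 1 & r0 < s] by rewrite /s; split; lra.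
exists (s ^+ 2), (r0 / s); split.
- by rewrite exprn_gt0//= exprn_ilt1// ltW.
- by rewrite divr_gt0//= ltr_pdivrMr// mul1r.
move=> r /andP[]; rewrite ler_pdivrMr// => rs r1.
have rp : 0 < r by nra.
have r01' : 0 < r < 1 by rewrite rp.
have s01 : 0 < s < 1 by rewrite s0.
have sr1 : 0 < s * r < 1 by rewrite mulr_gt0//= (le_lt_trans _ r1)// ler_piMl// ltW.
have ssr1 : 0 < s ^+ 2 * r < 1.
  by rewrite mulr_gt0 ?exprn_gt0//= (le_lt_trans _ r1)// ler_piMl ?exprn_ile1// ltW.
have D := sqmean_second_difference af r01' s01.
have m1 := sqmean_le af fM sr1 s01; rewrite (_ : s * (s * r) = s ^+ 2 * r) in m1; last by ring.
have m2 := le_sup _ r01'.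
have m3 : sqmean f r0 <= sqmean f (s * r).
  by apply: mono => //; [rewrite mulrC|case/andP: sr1].
have rw a : 0 < a < 1 -> rcont (fun t => f (a%:C * expi t)).
  by move=> /andP[a0 a1]; apply: rcont_analytic => //; rewrite ltW.
have rc : rcont (fun t => f (r%:C * expi t) - f ((s ^+ 2 * r)%:C * expi t)).
  move=> t d d0; have d20 : 0 < d / 2 by rewrite divr_gt0.
  have [x x0 Hx] := rw _ r01' t _ d20; have [y y0 Hy] := rw _ ssr1 t _ d20.
  exists (Num.min x y); first by rewrite lt_min x0.
  move=> u; rewrite lt_min => /andP[/Hx h1 /Hy h2].
  rewrite [X in cabs X](_ : _ = (f (r%:C * expi u) - f (r%:C * expi t)) -
    (f ((s ^+ 2 * r)%:C * expi u) - f ((s ^+ 2 * r)%:C * expi t))); last by ring.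
  by rewrite (le_trans (cabsB _ _))// [leRHS]splitr lerD.
have i1 : cint (fun t => cabs (f (r%:C * expi t) - f ((s ^+ 2 * r)%:C * expi t))).
  by apply: cint_cabs; exact: cintc_rcont.
have i2 := cint_sq rc.
set F := fun t : R => f (r%:C * expi t) - f ((s ^+ 2 * r)%:C * expi t) in rc i1 i2 D *.
have h : ravg (fun t => cabs (F t) ^+ 2) <= e ^+ 2 by rewrite D; clear -Hr0 m1 m2 m3; lra.
(* The inequality 2 e x <= e^2 + x^2 plays the part of Cauchy-Schwarz in passing from the square
   mean to the mean. *)
have : ravg (fun t => 2 * e * cabs (F t)) <= ravg (fun t => e ^+ 2 + cabs (F t) ^+ 2).
  apply: ravg_le; [exact: cintZ|by apply: cintD => //; exact: cint_cst|].
  move=> t _; have := sqr_ge0 (e - cabs (F t)); clear; nra.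
rewrite ravgZ// ravgD//; last exact: cint_cst.
rewrite ravg_cst => h2; clear -e0 h h2; nra.
Qed.

End MeanSquare.

(** * The radial maximal inequality and almost everywhere radial limits *)

Section Fatou.
Variable R : realType.
Local Notation mu := (@lebesgue_measure R).
Local Notation Re := (@complex.Re R).
Local Notation Im := (@complex.Im R).
Local Notation carc := (@carc R).
Implicit Types (a b c t x y e r s : R) (f g h : R[i] -> R[i]).
Local Open Scope complex_scope.

Lemma expi_sub_pi x : expi (x - pi) = - expi x :> R[i].
Proof.
apply: complex_eq; rewrite cplxE /=.
  by rewrite cosB cospi sinpi; ring.
by rewrite sinB cospi sinpi; ring.
Qed.

(** If every arc centred at [x] had average at most c / 2, the Poisson average of |g| would be at
    most c / 2 by [poisson_average_le], and the value of [g] at most c, because of the factor 2 in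
    [cabs_cavg_le]. *)
Lemma radial_value_arc g r s x c : analytic g -> 0 <= r < 1 -> 0 <= s < 1 -> 0 < c ->
  c < cabs (g ((r * s)%:C * expi x)) ->
  exists2 d, 0 < d <= pi & c * d < \int[mu]_(t in `[x - d, x + d]) cabs (g (r%:C * expi t)).
Proof.
move=> ag r01 s01 c0 cg; apply: contrapT => /forall2NP H.
pose u t := cabs (g (r%:C * expi t)).
have cu : continuous u by apply: rcont_abs; exact: rcont_analytic.
have := @poisson_average_le R u s x (c / 2) cu (fun t => cabs_ge0 _) s01.
move=> /(_ _)/wrap[].
  move=> d d0; have [//|/negP] := H d; rewrite -leNgt /u => /le_trans; apply.
  by rewrite le_eqVlt; apply/orP; left; apply/eqP; field.
case/andP: (s01) => s0 s1.
have a1 : cabs (- s%:C : R[i]) < 1 by rewrite cabsN cabs_real ger0_norm.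
(* Rotation by [x - pi] carries the peak at pi of the kernel of [- s] to the angle [x]. *)
have ag' : analytic (fun z => g (z * expi (x - pi))).
  move=> z z1; apply: cdiffable_comp.
    by apply: cdiffableM; [exact: cdiffable_id|exact: cdiffable_cst].
  by apply: ag; rewrite cabsM cabs_expi mulr1.
have := poisson_scaled ag' r01 a1.
have -> : r%:C * - s%:C * expi (x - pi) = (r * s)%:C * expi x.
  by rewrite expi_sub_pi rmorphM /=; ring.
move=> E; rewrite -{}E in cg.
have cP := rcont_poisson a1.
have cF : rcont (fun t => (poisson (- s%:C) t)%:C * g (r%:C * expi t * expi (x - pi))).
  by apply: rcontM => //; exact: (rcont_analytic ag' r01).
have cv : cint (fun t => poisson (- s%:C) t * u (x - pi + t)).
  apply: cint_continuous => t; apply: cvgM; last exact: continuous_shift.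
  by have [cPr _] := rcont_continuous cP; exact: cPr.
have := @cabs_cavg_le _ _ _ (cintc_rcont cF) cv.
move=> /(_ _)/wrap[].
  move=> t _; rewrite cabsM cabs_real ger0_norm ?poisson_ge0// /u.
  by rewrite -mulrA -expiD [t + _]addrC.
by move: cg; set A := cabs _; set B := ravg _; lra.
Qed.

Definition maximal_set g r c : set R :=
  [set x | carc x /\ exists2 s : R, 0 <= s < 1 & c < cabs (g ((r * s)%:C * expi x))].

(** The union over [s] is uncountable, but its members are open. *)
Lemma measurable_maximal_set g r c : analytic g -> 0 <= r < 1 -> measurable (maximal_set g r c).
Proof.
move=> ag r01.
have -> : maximal_set g r c =
    carc `&` \bigcup_(s in [set s : R | 0 <= s < 1]) [set x | c < cabs (g ((r * s)%:C * expi x))].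
  apply/seteqP; split => x /=; first by move=> [cx [s s01 h]]; split => //; exists s.
  by move=> [cx [s s01 h]]; split => //; exists s.
apply: measurableI; first exact: measurable_carc.
apply: open_measurable; apply: bigcup_open => s /= /andP[s0 s1].
have cs : continuous (fun x => cabs (g ((r * s)%:C * expi x))).
  apply: rcont_abs; apply: rcont_analytic => //; case/andP: r01 => r0 r1.
  by rewrite mulr_ge0//= (le_lt_trans _ r1)// ler_piMr// ltW.
exact: (@open_comp _ _ (fun x => cabs (g ((r * s)%:C * expi x))) [set y | c < y]
    (fun x _ => cs x) (@open_gt R c)).
Qed.

Lemma maximal_set_measure g r c : analytic g -> 0 <= r < 1 -> 0 < c ->
  (mu (maximal_set g r c) <= (36 * pi / c * ravg (fun t => cabs (g (r%:C * expi t))))%:E)%E.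
Proof.
move=> ag r01 c0; have p0 := pi_gt0 R.
pose u t := cabs (g (r%:C * expi t)).
have cu : continuous u by apply: rcont_abs; exact: rcont_analytic.
have u0 t : 0 <= u t by exact: cabs_ge0.
have per t : u (t + 2 * pi) = u t by rewrite /u expi2pi.
(* Three periods, containing every arc of half-length at most pi centred in [carc]. The constant 36
   pi / c is 3 / (c / 2), from the Hardy-Littlewood inequality, times 6 pi, the length of [D]. *)
pose D : set R := `[(- (2 * pi)), (4 * pi)]%classic.
have mD : measurable D by exact: measurable_itv.
have iD : mu.-integrable D (EFin \o u) by exact: cont_integrable.
have lG : locally_integrable [set: R] (u \_ D) by apply: integrable_locally.
have c20 : 0 < c / 2 by rewrite divr_gt0.
have sub : maximal_set g r c `<=` [set x | ((c / 2)%:E < HL_maximal (u \_ D) x)%E].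
  move=> x [cx [s s01 h]]; have [d /andP[d0 dp] hd] := radial_value_arc ag r01 s01 c0 h.
  have xd : carc x := cx; rewrite /carc /= in_itv /= in xd; case/andP: xd => x0 xp.
  apply: (@lt_le_trans _ _ (iavg (u \_ D) (ball x d))); last first.
    by apply: ereal_sup_ubound => /=; exists d => //; rewrite in_itv /= d0.
  rewrite /iavg lebesgue_measure_ball ?(ltW d0)//.
  have -> : (\int[mu]_(y in ball x d) `|((u \_ D) y)%:E| = (\int[mu]_(t in `[x - d, x + d]) u t)%R%:E)%E.
    have iu := cont_integrable (x - d) (x + d) cu.
    rewrite /Rintegral fineK; last exact: integrable_fin_num.
    rewrite ball_itv (@integral_itv_bndoo _ (x - d) (x + d) _ true false); last first.
      apply: measurable_funS (measurable_int mu iu) => //; exact: subset_itv_oo_cc.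
    apply: eq_integral => y; rewrite inE /= in_itv /= => /andP[h1 h2].
    rewrite patchE mem_set; last by rewrite /D /= in_itv /=; apply/andP; split; lra.
    by rewrite ger0_norm.
  rewrite inver mulrn_eq0/= gt_eqF// -EFinM lte_fin ltr_pdivlMl ?pmulrn_lgt0//.
  by rewrite -mulr_natl; move: hd; rewrite -/u; lra.
apply: le_trans (le_measure mu _ _ sub) _; rewrite ?inE//.
- exact: measurable_maximal_set.
- rewrite -[X in measurable X]setTI; apply: emeasurable_fun_o_infty => //.
  exact: measurable_HL_maximal.
apply: le_trans (maximal_inequality lG c20) _.
have -> : (\int[mu]_(y in [set: R]) `|((u \_ D) y)%:E| = (\int[mu]_(t in D) u t)%R%:E)%E.
  rewrite /Rintegral fineK; last exact: integrable_fin_num.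
  rewrite [RHS]integral_mkcond; apply: eq_integral => y _.
  by rewrite !patchE; case: ifP => _ /=; rewrite ?normr0// ger0_norm.
have tp : 0 < 2 * pi :> R by exact: two_pi_gt0.
have base : \int[mu]_(t in `[0, 2 * pi]) u t = 2 * pi * ravg u.
  rewrite /ravg mulrA divff ?gt_eqF// mul1r -Rintegral_itv_bndo_bndc//.
  exact: cint_continuous.
have -> : \int[mu]_(t in D) u t = 6 * pi * ravg u.
  rewrite /D (@Rintegral_chasles _ u _ 0)//; [|lra|lra].
  rewrite (@Rintegral_chasles _ u 0 (2 * pi))//; [|lra|lra].
  have -> : \int[mu]_(t in `[(- (2 * pi)), 0]) u t = \int[mu]_(t in `[0, 2 * pi]) u t.
    transitivity (\int[mu]_(t in `[- (2 * pi), - (2 * pi) + 2 * pi]) u t); first by rewrite addNr.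
    rewrite Rintegral_shift//; apply: eq_Rintegral => t _.
    by rewrite -[LHS]per; congr u; ring.
  have -> : \int[mu]_(t in `[2 * pi, 4 * pi]) u t = \int[mu]_(t in `[0, 2 * pi]) u t.
    have -> : 4 * pi = 2 * pi + 2 * pi :> R by ring.
    rewrite Rintegral_shift//; apply: eq_Rintegral => t _.
    by rewrite addrC per.
  by rewrite base; ring.
rewrite -EFinM lee_fin le_eqVlt; apply/orP; left; apply/eqP; rewrite -/u; field.
by rewrite gt_eqF.
Qed.

Definition radial_cvg f t (l : R[i]) := forall e : R, 0 < e ->
  exists2 d : R, 0 < d & forall r : R, 1 - d < r -> r < 1 -> cabs (f (r%:C * expi t) - l) <= e.

Definition oscillates f t c := forall d, 0 < d -> exists r s : R,
  [/\ 1 - d < r < 1, 1 - d < s < 1 & c < cabs (f (r%:C * expi t) - f (s%:C * expi t))].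

Lemma cauchy_left (F : R -> R) : (forall e, 0 < e -> exists2 d : R, 0 < d &
    forall r s, 1 - d < r < 1 -> 1 - d < s < 1 -> `|F r - F s| <= e) ->
  exists l, forall e, 0 < e -> exists2 d : R, 0 < d & forall r, 1 - d < r -> r < 1 -> `|F r - l| <= e.
Proof.
move=> H; have /cvg_ex[l Hl] : cvg (F @ at_left (1 : R)).
  apply/cauchy_cvgP/cauchy_exP => e e0.
  have e20 : 0 < e / 2 by rewrite divr_gt0.
  have [d d0 Hd] := H _ e20; exists (F (1 - d / 2)).
  have : \forall r \near (1 : R)^'-, ball (F (1 - d / 2)) e (F r); last by [].
  near=> r; rewrite /ball /=; apply: le_lt_trans (Hd _ _ _ _) _; [| |lra].
    by apply/andP; split; lra.
  apply/andP; split; near: r; [|exact: nbhs_left_lt].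
  by apply: nbhs_left_gt; lra.
exists l => e e0; move/cvgrPdist_le : Hl => /(_ _ e0).
rewrite near_withinE => /nbhs_ballP[d /= d0 Hd]; exists d => // r rd r1.
rewrite distrC; apply: Hd => //=; rewrite /ball /= ger0_norm; lra.
Unshelve. all: by end_near. Qed.

Lemma radial_cvg_oscillates f t : (forall n : nat, ~ oscillates f t n.+1%:R^-1) ->
  exists l, radial_cvg f t l.
Proof.
move=> H.
have C e : 0 < e -> exists2 d : R, 0 < d & forall r s, 1 - d < r < 1 -> 1 - d < s < 1 ->
    cabs (f (r%:C * expi t) - f (s%:C * expi t)) <= e.
  move=> e0; pose n := Num.truncn (e^-1).
  have ne : n.+1%:R^-1 <= e by rewrite -[e]invrK lef_pV2 ?posrE ?invr_gt0// ltW// truncnS_gt.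
  have /existsNP[d /not_implyP[d0 nd]] := H n.
  exists d => // r s rd sd; rewrite leNgt; apply/negP => h; apply: nd; exists r, s; split => //.
  exact: le_lt_trans ne h.
have [|a Ha] := @cauchy_left (fun r => Re (f (r%:C * expi t))).
  move=> e /C[d d0 Hd]; exists d => // r s rd sd; apply: le_trans (Hd r s rd sd).
  by rewrite -ReN -ReD Re_le_cabs.
have [|b Hb] := @cauchy_left (fun r => Im (f (r%:C * expi t))).
  move=> e /C[d d0 Hd]; exists d => // r s rd sd; apply: le_trans (Hd r s rd sd).
  by rewrite -ImN -ImD Im_le_cabs.
exists (a +i* b) => e e0; have e20 : 0 < e / 2 by rewrite divr_gt0.
have [d1 d10 H1] := Ha _ e20; have [d2 d20 H2] := Hb _ e20.
exists (Num.min d1 d2); first by rewrite lt_min d10.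
move=> r rd r1; rewrite (le_trans (cabs_le_ReIm _))// !cplxE /=.
have [m1 m2] : Num.min d1 d2 <= d1 /\ Num.min d1 d2 <= d2 by rewrite !ge_min !lexx orbT.
have := H1 r _ r1; have := H2 r _ r1; move=> /(_ _)/wrap[]; first lra.
move=> h2 /(_ _)/wrap[]; first lra.
by move=> h1; lra.
Qed.

(** Write f(z) = f(p z) + g(z). The dilation is continuous up to the circle, so near the end of the
    radius its values differ by at most 2 c / 4; an oscillation exceeding c then forces |g| > c / 4
    somewhere on the radius. The dilations of [g] of radius near 1 have mean at most e, and the
    weak-type bound applies. *)
Lemma oscillates_cover f (M c e : R) : analytic f -> (forall z, cabs z < 1 -> cabs (f z) <= M) ->
  0 < c -> 0 < e -> exists V : set R, [/\ measurable V,
  (mu V <= (36 * pi / (c / 4) * e)%:E)%E & carc `&` [set t | oscillates f t c] `<=` V].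
Proof.
move=> af fM c0 e0; have [p [r1 [/andP[p0 p1] /andP[r10 r11] Hr]]] := dilation_close af fM e0.
have c40 : 0 < c / 4 by rewrite divr_gt0.
pose g z := f z - f (p%:C * z).
have ag : analytic g.
  move=> z z1; apply: cdiffableB; first exact: af.
  apply: (@cdiffable_comp _ (fun z => p%:C * z) f).
    by apply: cdiffableM; [exact: cdiffable_cst|exact: cdiffable_id].
  by apply: af; rewrite cabsM cabs_real gtr0_norm// (le_lt_trans _ z1)// ler_piMl ?cabs_ge0// ltW.
(* Radii increasing from r1 to 1: the corresponding maximal sets increase and obey one common bound,
   which their union inherits. *)
pose rr (n : nat) := 1 - (1 - r1) / n.+1%:R.
have rrE n : r1 <= rr n < 1.
  have n0 : 0 < n.+1%:R :> R by [].
  rewrite /rr; apply/andP; split; last by rewrite ltrBlDr ltrDl divr_gt0// subr_gt0.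
  rewrite lerBrDr -lerBrDl ler_pdivrMr// ler_peMr ?subr_ge0 ?(ltW r11)//.
  by rewrite ler1n.
have rr01 n : 0 <= rr n < 1 by case/andP: (rrE n) => h1 ->; rewrite andbT; lra.
pose A n := maximal_set g (rr n) (c / 4).
have mA n : measurable (A n) by exact: measurable_maximal_set.
have muA n : (mu (A n) <= (36 * pi / (c / 4) * e)%:E)%E.
  apply: le_trans (maximal_set_measure ag (rr01 n) c40) _; rewrite lee_fin ler_wpM2l//.
    by rewrite divr_ge0 ?(ltW c40)// mulr_ge0// pi_ge0.
  apply: le_trans (Hr _ (rrE n)); rewrite le_eqVlt; apply/orP; left; apply/eqP.
  by apply: ravg_eq => t _; rewrite /g mulrA -rmorphM.
have incr : {homo A : n m / (n <= m)%N >-> (n <= m)%O}.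
  move=> n m nm; apply/subsetPset => x [cx [s /andP[s0 s1] h]]; split => //.
  have rn0 : 0 < rr n by case/andP: (rrE n) => ? ?; lra.
  have rnm : rr n <= rr m.
    rewrite /rr lerD2l lerN2 ler_pM2l ?subr_gt0// lef_pV2 ?posrE//.
    by rewrite ler_nat ltnS.
  have rm0 : 0 < rr m by exact: lt_le_trans rnm.
  have rq : rr n / rr m <= 1 by rewrite ler_pdivrMr// mul1r.
  exists (rr n / rr m * s).
    rewrite mulr_ge0 ?divr_ge0 ?(ltW rn0) ?(ltW rm0)//= (le_lt_trans _ s1)// ler_piMl//.
  by rewrite mulrA [rr m * _]mulrC mulfVK// gt_eqF.
exists (\bigcup_n A n); split; first exact: bigcupT_measurable.
- have := @nondecreasing_cvg_mu _ _ _ mu A mA (bigcupT_measurable A mA) incr.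
  move=> H; rewrite -(cvg_lim _ H)//; apply: lime_le; first by apply/cvg_ex; eexists; exact: H.
  by apply: nearW => n /=.
- move=> x [cx osc].
  have zx : cabs (p%:C * expi x) < 1 by rewrite cabs_scale// ltW.
  have [d d0 Hd] := analytic_ccont af zx c40.
  have d10 : 0 < Num.min d 1 by rewrite lt_min d0 /=.
  have [r [s [/andP[rd r1'] /andP[sd s1'] h]]] := osc (Num.min d 1) d10.
  have [] : Num.min d 1 <= d /\ Num.min d 1 <= 1 by rewrite !ge_min !lexx orbT.
  move=> m1 m2.
  have near v : 1 - Num.min d 1 < v -> v < 1 -> cabs (f (p%:C * (v%:C * expi x)) - f (p%:C * expi x)) <= c / 4.
    move=> vd v1; apply: Hd; rewrite -mulrBr cabsM cabs_real gtr0_norm//.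
    have -> : v%:C * expi x - expi x = (v - 1)%:C * expi x by rewrite rmorphB /=; ring.
    rewrite cabsM cabs_expi mulr1 cabs_real ltr0_norm ?subr_lt0//.
    have : 0 < 1 - v by lra.
    nra.
  have nr := near r rd r1'; have ns := near s sd s1'.
  have [v [v0 v1 gv]] : exists v, [/\ 0 <= v, v < 1 & c / 4 < cabs (g (v%:C * expi x))].
    apply: contrapT => /forallNP K.
    have kr : cabs (g (r%:C * expi x)) <= c / 4.
      by rewrite leNgt; apply/negP => k; apply: (K r); split => //; lra.
    have ks : cabs (g (s%:C * expi x)) <= c / 4.
      by rewrite leNgt; apply/negP => k; apply: (K s); split => //; lra.
    move: h; rewrite ltNge => /negP; apply.
    have -> : f (r%:C * expi x) - f (s%:C * expi x) = (g (r%:C * expi x) - g (s%:C * expi x)) +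
       ((f (p%:C * (r%:C * expi x)) - f (p%:C * expi x)) - (f (p%:C * (s%:C * expi x)) - f (p%:C * expi x))).
      by rewrite /g; ring.
    rewrite (le_trans (cabsD _ _))// (le_trans (lerD (cabsB _ _) (cabsB _ _)))//; lra.
  pose n := Num.truncn ((1 - r1) / (1 - v)).
  have v10 : 0 < 1 - v by rewrite subr_gt0.
  have vn : v < rr n.
    rewrite /rr ltrBrDr -ltrBrDl ltr_pdivrMr// mulrC -ltr_pdivrMr//.
    exact: truncnS_gt.
  exists n => //; split => //.
  have rn0 : 0 < rr n by exact: le_lt_trans vn.
  exists (v / rr n); first by rewrite divr_ge0 ?(ltW rn0)//= ltr_pdivrMr// mul1r.
  rewrite (_ : rr n * (v / rr n) = v)//; by rewrite mulrC mulfVK// gt_eqF.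
Qed.

Lemma oscillates_negligible f (M c : R) : analytic f -> (forall z, cabs z < 1 -> cabs (f z) <= M) ->
  0 < c -> mu.-negligible (carc `&` [set t | oscillates f t c]).
Proof.
move=> af fM c0.
have /choice[V HV] : forall n : nat, exists V : set R, [/\ measurable V,
  (mu V <= (36 * pi / (c / 4) * n.+1%:R^-1)%:E)%E & carc `&` [set t | oscillates f t c] `<=` V].
  by move=> n; apply: oscillates_cover => //; exact: fM.
have mV : measurable (\bigcap_n V n) by apply: bigcapT_measurable => n; case: (HV n).
exists (\bigcap_n V n); split => //; last by move=> t ht n _; case: (HV n) => _ _; exact.
pose K : R := 36 * pi / (c / 4).
have K0 : 0 <= K by rewrite divr_ge0 ?divr_ge0 ?(ltW c0)// mulr_ge0// pi_ge0.
apply/eqP; rewrite eq_le measure_ge0 andbT; apply/lee_addgt0Pr => e e0; rewrite add0e.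
pose n := Num.truncn (K / e); have [mVn muVn _] := HV n.
apply: le_trans (le_measure mu _ _ _) (le_trans muVn _); rewrite ?inE//.
  by move=> t; exact.
rewrite lee_fin -/K ler_pdivrMr// mulrC -ler_pdivrMr// ltW//.
exact: truncnS_gt.
Qed.

Theorem fatou_radial f (M : R) : analytic f -> (forall z, cabs z < 1 -> cabs (f z) <= M) ->
  {ae mu, forall t, carc t -> exists l, radial_cvg f t l}.
Proof.
move=> af fM.
have := @negligible_bigcup _ _ _ mu (fun n => carc `&` [set t | oscillates f t n.+1%:R^-1])
  (fun n => oscillates_negligible af fM (_ : 0 < n.+1%:R^-1)).
move=> /(_ (fun n => _))/wrap[]; first by [].
apply: negligibleS => t /= /not_implyP[ct nl].
apply: contrapT => H; apply: nl; apply: radial_cvg_oscillates => n osc.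
by apply: H; exists n.
Qed.

End Fatou.

(** * Boundary values of H^1 functions *)

Section Boundary.
Variable R : realType.
Local Notation mu := (@lebesgue_measure R).
Local Notation Re := (@complex.Re R).
Local Notation Im := (@complex.Im R).
Local Notation carc := (@carc R).
Local Notation cmeas := (cmeasurable carc).
Implicit Types (c t x y e r s M : R) (a z w : R[i]) (f g h W : R[i] -> R[i]) (F G H K : R -> R[i]).
Local Open Scope complex_scope.

(** The upper limit clipped to [-M, M] is measurable and bounded everywhere, and is the limit
    wherever one exists, so the null set without a limit needs no separate treatment. *)
Lemma bounded_measurable_limit (u : nat -> R -> R) M :
  (forall n, measurable_fun carc (u n)) -> (forall n t, carc t -> `|u n t| <= M) ->
  exists v : R -> R, [/\ measurable_fun carc v, forall t, `|v t| <= M &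
    forall t l, carc t -> u n t @[n --> \oo] --> l -> v t = l].
Proof.
move=> mu_ uM.
have M0 : 0 <= M.
  by apply: le_trans (uM 0%N 0 _) => //; rewrite /carc /= in_itv /= lexx two_pi_gt0.
pose v t := Num.max (- M) (Num.min M (limn_sup (fun n => u n t))).
exists v; split.
- apply: measurable_maxr; first exact: measurable_cst.
  apply: measurable_minr; first exact: measurable_cst.
  apply: measurable_fun_limn_sup => // t ct.
    by exists M => _ [n _ <-]; have := uM n t ct; rewrite ler_norml => /andP[].
  by exists (- M) => _ [n _ <-]; have := uM n t ct; rewrite ler_norml => /andP[].
- move=> t; rewrite ler_norml /v le_max lexx /= ge_max ge_min lexx /= andbT; lra.
- move=> t l ct cl; rewrite /v cvg_limn_supE; last by apply/cvg_ex; exists l.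
  have -> : limn (fun n => u n t) = l by exact/cvg_lim.
  have : `|l| <= M.
    have cn : `|u n t| @[n --> \oo] --> `|l| by apply: cvg_norm.
    rewrite -(cvg_lim _ cn)//; apply: limr_le; first by apply/cvg_ex; exists `|l|.
    by apply: nearW => n; exact: uM.
  by rewrite ler_norml => /andP[h1 h2]; rewrite (min_idPr h2) (max_idPr h1).
Qed.

(** The shift by 2 makes every radius positive. *)
Definition rad (n : nat) : R := 1 - n.+2%:R^-1.

Lemma rad01 n : 0 < rad n < 1.
Proof.
have h : n.+2%:R^-1 <= 2^-1 :> R by rewrite lef_pV2 ?posrE ?ltr0n// ler_nat.
have h0 : 0 < n.+2%:R^-1 :> R by rewrite invr_gt0 ltr0n.
rewrite /rad; move: (n.+2%:R^-1) h h0 => q h h0; apply/andP; split; lra.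
Qed.

Lemma rad_cvg : rad n @[n --> \oo] --> (1 : R).
Proof.
rewrite -[X in _ --> X]subr0; apply: cvgB; first exact: cvg_cst.
have := @cvg_harmonic R; rewrite -(cvg_shiftS) /harmonic; apply.
Qed.

Lemma ccvg_comp f (u : nat -> R[i]) z : ccont f z -> ccvg u z -> ccvg (fun n => f (u n)) (f z).
Proof.
move=> cf /cvgrPdist_lt cu; apply/cvgrPdist_le => e e0; have [d d0 H] := cf e e0.
apply: filterS (cu d d0) => n; rewrite !sub0r !normrN !ger0_norm ?cabs_ge0//; exact: H.
Qed.

Lemma ccvg_scale (u : nat -> R) x z : u n @[n --> \oo] --> x -> ccvg (fun n => (u n)%:C * z) (x%:C * z).
Proof.
move=> cu; apply: ccvgZ; apply/ccvgP; split => /=; [exact: cu|exact: cvg_cst].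
Qed.

Lemma radial_cvg_rad f t l : radial_cvg f t l -> ccvg (fun n => f ((rad n)%:C * expi t)) l.
Proof.
move=> H; apply/cvgrPdist_le => e e0; have [d d0 {}H] := H e e0.
have := rad_cvg => /cvgrPdist_lt/(_ d d0); apply: filterS => n.
have /andP[r0 r1] := rad01 n.
rewrite gtr0_norm ?subr_gt0// => h; rewrite sub0r normrN ger0_norm ?cabs_ge0//.
by apply: H => //; lra.
Qed.

(** The Poisson formula on the circles of radius [rad n] passes to the limit by dominated
    convergence, using Fatou's theorem. The bound is [M + M] because real and imaginary parts are
    clipped separately. *)
Lemma bounded_representation h M : analytic h -> (forall z, cabs z < 1 -> cabs (h z) <= M) ->
  exists H, [/\ cmeas H, forall t, cabs (H t) <= M + M,
    {ae mu, forall t, carc t -> radial_cvg h t (H t)} &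
    forall a, cabs a < 1 -> h a = cavg (fun t => (poisson a t)%:C * H t)].
Proof.
move=> ah hM.
have rc n : rcont (fun t => h ((rad n)%:C * expi t)).
  by apply: rcont_analytic => //; have /andP[/ltW -> ->] := rad01 n.
have cb n t : cabs (h ((rad n)%:C * expi t)) <= M.
  by have /andP[r0 r1] := rad01 n; apply: hM; rewrite cabs_scale// ltW.
have [||v1 [mv1 v1M v1l]] := @bounded_measurable_limit (fun n t => Re (h ((rad n)%:C * expi t))) M.
- by move=> n; have [] := cmeas_rcont (rc n).
- by move=> n t _; rewrite (le_trans (Re_le_cabs _)).
have [||v2 [mv2 v2M v2l]] := @bounded_measurable_limit (fun n t => Im (h ((rad n)%:C * expi t))) M.
- by move=> n; have [] := cmeas_rcont (rc n).
- by move=> n t _; rewrite (le_trans (Im_le_cabs _)).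
pose H t := Complex (v1 t) (v2 t).
have mH : cmeas H by split.
have HM t : cabs (H t) <= M + M by apply: le_trans (cabs_le_ReIm _) _; exact: lerD (v1M t) (v2M t).
have rad_ae : {ae mu, forall t, carc t -> radial_cvg h t (H t)}.
  apply: ae_sub (fatou_radial ah hM) => t ht ct; have [l Hl] := ht ct.
  suff -> : H t = l by [].
  by have /ccvgP[l1 l2] := radial_cvg_rad Hl; apply: complex_eq; [exact: v1l|exact: v2l].
exists H; split => // a a1.
have mp : cmeas (fun t => (poisson a t)%:C) by exact/cmeas_rcont/rcont_poisson.
pose F n t := (poisson a t)%:C * h ((rad n)%:C * expi t).
have mF n : cmeas (F n) by apply: cmeasurableM => //; exact: cmeas_rcont.
have [|||||||_ L] := @cavg_dct _ F (fun t => (poisson a t)%:C * H t) (fun t => 2 / (1 - cabs a) * M).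
- by move=> n; have [] := mF n.
- by move=> n; have [] := mF n.
- by have [] := cmeasurableM mp mH.
- by have [] := cmeasurableM mp mH.
- apply: ae_sub rad_ae => t ht ct; have := radial_cvg_rad (ht ct).
  move=> /(@ccvgZ _ _ _ (poisson a t)%:C); rewrite mulrC; under eq_fun do rewrite mulrC.
  exact.
- exact: cint_cst.
- move=> n t _; rewrite cabsM cabs_real ger0_norm ?poisson_ge0//.
  by apply: ler_pM; rewrite ?cabs_ge0 ?poisson_ge0// poisson_le.
apply: ccvg_unique L.
have FE n : cavg (F n) = h ((rad n)%:C * a).
  by apply: poisson_scaled => //; have /andP[/ltW -> ->] := rad01 n.
under eq_fun do rewrite FE.
apply: ccvg_comp; first exact: analytic_ccont.
by have := ccvg_scale a rad_cvg; rewrite (_ : 1%:C = 1)// mul1r.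
Qed.

Lemma radial_cvg_boundary f t l : radial_cvg f t l -> boundary f (expi t) = l.
Proof.
move=> H.
have L : (fun r : R => (f (r%:C * expi t) : R[i]^o)) @ at_left (1 : R) --> (l : R[i]^o).
  move=> P /nbhs_cabsP[e e0 He].
  have e20 : 0 < e / 2 by lra.
  have [d d0 Hd] := H _ e20.
  have h1 : 1 - d < 1 by lra.
  have : \forall r \near (1 : R)^'-, 1 - d < r /\ r < 1.
    by near=> r; split; near: r; [exact: nbhs_left_gt|exact: nbhs_left_lt].
  apply: filterS => r [r1 r2]; apply: He; apply: le_lt_trans (Hd r r1 r2) _; lra.
rewrite /boundary; case: asboolP => [_|[]]; last by apply/cvg_ex; exists (l : R[i]^o).
by apply: (@cvg_lim R[i]^o) L; exact: norm_hausdorff.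
Unshelve. all: by end_near. Qed.


Lemma ravg_le_ae (f g : R -> R) : cint f -> cint g -> (forall t, carc t -> 0 <= f t) ->
  {ae mu, forall t, carc t -> f t <= g t} -> ravg f <= ravg g.
Proof.
move=> fi gi f0 fg; rewrite ler_wpM2l ?invr_ge0 ?(ltW (two_pi_gt0 _))//.
have gi' := cint_abs gi.
(* The minimum agrees with [f] almost everywhere and lies below [g] everywhere. *)
have -> : (\int[mu]_(t in carc) f t)%R = (\int[mu]_(t in carc) (Num.min (f t) (g t)))%R.
  rewrite /Rintegral; congr fine; apply: ae_eq_integral => //.
  - by apply: measurable_carc.
  - by apply/measurable_EFinP; exact: cint_meas.
  - by apply/measurable_EFinP/measurable_minr; exact: cint_meas.
  - by apply: ae_sub fg => t h ct; rewrite (min_idPl (h ct)).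
apply: le_Rintegral => //; first exact: measurable_carc.
  apply: (@cint_le _ _ (fun t => `|f t| + `|g t|)).
  - by apply: measurable_minr; exact: cint_meas.
  - by apply: cintD; exact: cint_abs.
  - move=> t _; rewrite /Num.min; case: ifP => _; [rewrite lerDl//|rewrite lerDr//].
by move=> t _; rewrite ge_min lexx orbT.
Qed.

Lemma cabs_cavg_le_ae F (g : R -> R) : cintc F -> cint g ->
  {ae mu, forall t, carc t -> cabs (F t) <= g t} -> cabs (cavg F) <= 2 * ravg g.
Proof.
move=> Fi gi Fg; apply: le_trans (cabs_cavg_le Fi (cint_cabs Fi) (fun t _ => lexx _)) _.
rewrite ler_pM2l//; apply: ravg_le_ae => //; first exact: cint_cabs.
by move=> t _; exact: cabs_ge0.
Qed.

Lemma rcont_bounded F : rcont F -> exists M, forall t, carc t -> cabs (F t) <= M.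
Proof.
move=> cF; have ci := rcont_abs cF.
have [x _ Hx] := @EVT_max R (fun t => cabs (F t)) 0 (2 * pi) (ltW (two_pi_gt0 R)) (continuous_subspaceT ci).
exists (cabs (F x)) => t; rewrite /carc /= !in_itv /= => /andP[t0 t1].
by apply: Hx; rewrite in_itv /= t0 ltW.
Qed.

(* The Herglotz kernel is [2 (1 - z / expi t)^-1 - 1]; its real part is the Poisson kernel. *)
Lemma Re_herglotz z t : cabs z < 1 -> Re (2%:R * ckernel z t - 1) = poisson z t.
Proof.
move=> z1; have k0 : 1 - conjc z * expi t != 0 by apply: one_sub_neq0; rewrite cabsM cabs_expi mulr1 cabs_conj.
rewrite /poisson.
have -> : ckernel z t = (1 - conjc z * expi t) / (cabs (1 - conjc z * expi t) ^+ 2)%:C.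
  rewrite /ckernel.
  have E : (1 - z * conjc (expi t)) = conjc (1 - conjc z * expi t).
    by apply: complex_eq; rewrite ?cplxE /=; case: z {z1 k0} => x y /=; ring.
  have : (cabs (1 - conjc z * expi t) ^+ 2)%:C = (1 - conjc z * expi t) * conjc (1 - conjc z * expi t).
    by rewrite cabs_sqr; case: (1 - conjc z * expi t) => x y; apply: complex_eq => /=; ring.
  by rewrite E => ->; rewrite invfM mulrA divff// mul1r.
have c0 : cabs (1 - conjc z * expi t) ^+ 2 != 0 by rewrite sqrf_eq0 cabs_eq0.
rewrite -fmorphV.
have e1 : cabs (1 - conjc z * expi t) ^+ 2 = 1 - 2 * Re (conjc z * expi t) + cabs z ^+ 2.
  rewrite !cabs_sqr !cplxE /=.
  have := cos2Dsin2 t; move: (cos t) (sin t) => c s; case: (z) => x y /= cs.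
  have cs' : x ^+ 2 + y ^+ 2 = (x ^+ 2 + y ^+ 2) * (c ^+ 2 + s ^+ 2) by rewrite cs mulr1.
  rewrite cs'; ring.
move: c0 e1; move: (cabs _ ^+ 2) => Q; move: (conjc z * expi t) => w Q0 E.
rewrite !cplxE /= .
apply: (mulIf Q0); rewrite mulfVK//.
case: w E => x y /= E; rewrite E in Q0 *; field; exact: Q0.
Qed.


Lemma Re_scale x w : Re (x%:C * w) = x * Re w.
Proof. by case: w => u v /=; rewrite mul0r subr0. Qed.

Lemma cabs_nat n : cabs (n%:R : R[i]) = n%:R.
Proof. by have := cabs_real (n%:R : R); rewrite rmorph_nat ger0_norm. Qed.

Lemma increasing_geq (sg : nat -> nat) n : (forall i j, (i < j)%N -> (sg i < sg j)%N) -> (n <= sg n)%N.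
Proof. by move=> sgi; elim: n => // n IH; exact: leq_ltn_trans IH (sgi _ _ (ltnSn n)). Qed.

(** [U n] is the Herglotz integral of |f| over the circle of radius [rad n]; twice its real part, a
    Poisson integral, dominates the dilated |f|. The bound on the means of |f| makes the [U n]
    locally bounded, and W is twice a Montel limit. *)
Lemma analytic_majorant f M : analytic f ->
  (forall r, 0 <= r < 1 -> ravg (fun t => cabs (f (r%:C * expi t))) <= M) ->
  exists W, analytic W /\ forall z, cabs z < 1 -> cabs (f z) <= Re (W z).
Proof.
move=> af fM.
pose A n t := cabs (f ((rad n)%:C * expi t)).
have rn n : 0 <= rad n < 1 by have /andP[/ltW -> ->] := rad01 n.
have rc n : rcont (fun t => f ((rad n)%:C * expi t)) by apply: rcont_analytic.
have iA n : cint (A n) by apply: cint_cabs; exact: cintc_rcont.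
have cA n : rcont (fun t => (A n t)%:C).
  move=> t e e0; have [d d0 H] := rc n t e e0; exists d => // y /H.
  apply: le_trans; have := cabs_real (A n y - A n t); rewrite rmorphB /= => ->; exact: cabs_dist.
pose U n z := cavg (fun t => (A n t)%:C * (2%:R * ckernel z t - 1)).
have iK n z : cabs z < 1 -> cintc (fun t => (A n t)%:C * ckernel z t).
  by move=> z1; apply/cintc_rcont/rcontM => //; exact: rcont_ckernel.
have iH n z : cabs z < 1 -> cintc (fun t => (A n t)%:C * (2%:R * ckernel z t - 1)).
  move=> z1; rewrite [X in cintc X](_ : _ = fun t => 2%:R * ((A n t)%:C * ckernel z t) + (-1) * (A n t)%:C).
    by apply: cintcD; apply: cintcZ; [exact: iK|exact: cintc_rcont].
  by apply/funext => t; ring.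
have UE n z : cabs z < 1 -> U n z =
    2%:R * cavg (fun t => (A n t)%:C * ckernel z t) + (-1) * cavg (fun t => (A n t)%:C).
  move=> z1; rewrite -(cavgZ 2%:R (iK n z z1)) -(cavgZ (- 1) (cintc_rcont (cA n))).
  rewrite -cavgD; [|by apply: cintcZ; exact: iK|by apply: cintcZ; exact: cintc_rcont].
  by apply: cavg_eq => t _; ring.
have aU n : analytic (U n).
  move=> z z1; have d0 : 0 < 1 - cabs z by lra.
  apply: (@cdiffable_near _ (fun z => 2%:R * cavg (fun t => (A n t)%:C * ckernel z t) + (-1) * cavg (fun t => (A n t)%:C)) _ _ _ d0 _ _).
    move=> w wz; rewrite UE//; have := cabsD (w - z) z; rewrite subrK; lra.
  apply: cdiffableD; last exact: cdiffable_cst.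
  apply: cdiffableM; first exact: cdiffable_cst.
  have [B HB] := rcont_bounded (cA n).
  by apply: (@cauchy_transform_cdiffable _ _ B) => //; exact: cmeas_rcont.
have lU : locally_bounded U.
  move=> r r1; exists (2 * ((2 / (1 - r) + 1) * M)) => n z zr.
  have z1 : cabs z < 1 by exact: le_lt_trans r1.
  have k0 : 0 < (1 - r)^-1 by rewrite invr_gt0; lra.
  apply: le_trans (@cabs_cavg_le _ _ (fun t => (2 / (1 - r) + 1) * A n t) (iH n z z1) _ _) _.
  - exact: cintZ.
  - move=> t _; rewrite cabsM cabs_real ger0_norm ?cabs_ge0// mulrC ler_wpM2r ?cabs_ge0//.
    apply: le_trans (cabsB _ _) _; rewrite cabs1 lerD2r cabsM.
    rewrite cabs_nat.
    rewrite ler_pM2l//; apply: le_trans (cabs_ckernel t z1) _.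
    by rewrite lef_pV2 ?posrE ?subr_gt0// lerD2l lerN2.
  - rewrite ravgZ// ler_pM2l// ler_wpM2l// ?fM//.
    by rewrite addr_ge0// mulr_ge0// ltW.
have ReU n z : cabs z < 1 -> cabs (f ((rad n)%:C * z)) <= 2 * Re (U n z).
  move=> z1; rewrite -(@poisson_scaled _ f (rad n) z)//=.
  have cP := rcont_poisson z1.
  have ci : cintc (fun t => (poisson z t)%:C * f ((rad n)%:C * expi t)) by apply/cintc_rcont/rcontM.
  apply: le_trans (cabs_cavg_le ci (cint_cabs ci) (fun t _ => lexx _)) _.
  rewrite ler_pM2l// le_eqVlt; apply/orP; left; apply/eqP; apply: ravg_eq => t _.
  rewrite /= cabsM cabs_real ger0_norm ?poisson_ge0// mulrC.
  by rewrite Re_scale Re_herglotz.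
have [sg [V [sgi aV cV]]] := montel aU lU.
exists (fun z => 2%:R * V z); split.
  by move=> z z1; apply: cdiffableM; [exact: cdiffable_cst|exact: aV].
move=> z z1.
have rs : rad (sg n) @[n --> \oo] --> (1 : R).
  move=> P /rad_cvg [N _ HN]; exists N => // n /= nN; apply: HN => /=.
  exact: leq_trans nN (increasing_geq n sgi).
have cf := ccvg_comp (analytic_ccont af (_ : cabs (1%:C * z) < 1)) (ccvg_scale z rs).
rewrite mul1r in cf; move: (cf z1) => {}cf.
have h1 : cabs (f ((rad (sg n))%:C * z)) @[n --> \oo] --> cabs (f z).
  apply/cvgrPdist_le => e e0; move/cvgrPdist_le : cf => /(_ e e0); apply: filterS => n.
  rewrite sub0r normrN ger0_norm ?cabs_ge0// => h; apply: le_trans h; rewrite distrC; exact: cabs_dist.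
have /ccvgP[h2 _] := cV z z1.
have h3 : 2 * Re (U (sg n) z) @[n --> \oo] --> 2 * Re (V z) by exact: cvgMr.
have -> : Re (2%:R * V z) = 2 * Re (V z) by rewrite -Re_scale rmorph_nat.
rewrite -(cvg_lim _ h1)// -(cvg_lim _ h3)//; apply: ler_lim.
- by apply/cvg_ex; eexists; exact: h1.
- by apply/cvg_ex; eexists; exact: h3.
- by apply: nearW => n; exact: ReU.
Qed.

Lemma radial_cvgM f g t (l k : R[i]) : radial_cvg f t l -> radial_cvg g t k ->
  radial_cvg (fun z => f z * g z) t (l * k).
Proof.
move=> cf cg e e0; have l1 : 0 < cabs l + 1 by rewrite ltr_wpDl ?cabs_ge0.
have k1 : 0 < cabs k + 1 by rewrite ltr_wpDl ?cabs_ge0.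
have ek : 0 < e / 2 / (cabs k + 1) by rewrite !divr_gt0.
have el : 0 < e / 2 / (cabs l + 1) by rewrite !divr_gt0.
pose m := Num.min 1 (e / 2 / (cabs k + 1)).
have m0 : 0 < m by rewrite lt_min ltr01.
have [d1 d10 H1] := cf _ m0; have [d2 d20 H2] := cg _ el.
exists (Num.min d1 d2); first by rewrite lt_min d10.
move=> r rd r1.
have m1 : Num.min d1 d2 <= d1 by rewrite ge_min lexx.
have m2 : Num.min d1 d2 <= d2 by rewrite ge_min lexx orbT.
have h1 := H1 r (ltac:(lra) : 1 - d1 < r) r1; have h2 := H2 r (ltac:(lra) : 1 - d2 < r) r1.
have mE1 : m <= 1 by rewrite ge_min lexx.
have mE2 : m <= e / 2 / (cabs k + 1) by rewrite ge_min lexx orbT.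
set a := f _ in h1 *; set b := g _ in h2 *.
have -> : a * b - l * k = a * (b - k) + (a - l) * k by ring.
apply: le_trans (cabsD _ _) _; rewrite !cabsM.
have a1 : cabs a <= cabs l + 1 by have := cabsD (a - l) l; rewrite subrK; lra.
have p1 : cabs a * cabs (b - k) <= e / 2.
  apply: le_trans (ler_pM (cabs_ge0 _) (cabs_ge0 _) a1 h2) _.
  by rewrite mulrC divfK// gt_eqF.
have p2 : cabs (a - l) * cabs k <= e / 2.
  apply: le_trans (ler_pM (cabs_ge0 _) (cabs_ge0 _) (le_trans h1 mE2) (_ : _ <= cabs k + 1)) _; first lra.
  by rewrite divfK// gt_eqF.
lra.
Qed.

Lemma radial_cvgV f t (l : R[i]) : radial_cvg f t l -> l != 0 -> radial_cvg (fun z => (f z)^-1) t l^-1.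
Proof.
move=> cf l0 e e0.
have cV : ccont (fun w : R[i] => w^-1) l.
  by apply: cdiffable_ccont; apply: cdiffableV => //; exact: cdiffable_id.
have [d d0 H] := cV e e0; have d20 : 0 < d / 2 by lra.
have [d1 d10 H1] := cf _ d20; exists d1 => // r rd r1; apply: H.
apply: le_lt_trans (H1 r rd r1) _; lra.
Qed.


Lemma radial_cvg_eq f g t l : (forall z, cabs z < 1 -> f z = g z) -> radial_cvg f t l -> radial_cvg g t l.
Proof.
move=> fg cf e e0; have [d d0 H] := cf e e0; exists (Num.min d 1); first by rewrite lt_min d0 ltr01.
move=> r rd r1; have m1 : Num.min d 1 <= d by rewrite ge_min lexx.
have m2 : Num.min d 1 <= 1 by rewrite ge_min lexx orbT.
rewrite -fg; first by apply: H => //; lra.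
by rewrite cabs_scale//; lra.
Qed.

(* With [b k = (1 + W / k)^-1], the square in [h k = f * b k * b k] makes the radial
   limit of [h k] vanish wherever that of [b k] does, since [f * b k] is bounded. *)
Theorem boundary_majorant f M F : analytic f ->
  (forall r, 0 <= r < 1 -> ravg (fun t => cabs (f (r%:C * expi t))) <= M) ->
  (forall t, F t = boundary f (expi t)) -> cmeas F -> cint (fun t => cabs (F t)) ->
  forall a, cabs a < 1 -> cabs (f a) <= 2 * ravg (fun t => poisson a t * cabs (F t)).
Proof.
move=> af fM FE mF iF a a1; have [W [aW fW]] := analytic_majorant af fM.
pose c (k : nat) : R := k.+1%:R^-1.
have c0 k : 0 < c k by rewrite invr_gt0 ltr0n.
pose d k z := 1 + (c k)%:C * W z.
(* As Re W dominates |f|, this gives both |b k| <= 1 and |f b k| <= k + 1, without any bound on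
   f. *)
have dW k z : cabs z < 1 -> 1 + c k * cabs (f z) <= cabs (d k z).
  move=> /fW h; apply: le_trans (le_trans (ler_norm _) (Re_le_cabs _)).
  have -> : Re (d k z) = 1 + c k * Re (W z) by rewrite /d; case: (W z) => u v /=; rewrite mul0r subr0.
  by rewrite lerD2l ler_pM2l.
have d1 k z : cabs z < 1 -> 1 <= cabs (d k z).
  by move=> z1; apply: le_trans (dW k z z1); rewrite lerDl mulr_ge0 ?cabs_ge0// ltW.
have dn k z : cabs z < 1 -> d k z != 0.
  by move=> z1; rewrite -cabs_gt0 (lt_le_trans ltr01)// d1.
pose b k z := (d k z)^-1.
have b1 k z : cabs z < 1 -> cabs (b k z) <= 1.
  by move=> z1; rewrite cabsV invf_le1 ?d1// (lt_le_trans ltr01)// d1.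
have fb k z : cabs z < 1 -> cabs (f z * b k z) <= k.+1%:R.
  move=> z1; rewrite cabsM cabsV ler_pdivrMr ?(lt_le_trans ltr01) ?d1//.
  apply: (@le_trans _ _ (k.+1%:R * (1 + c k * cabs (f z)))); last by rewrite ler_pM2l ?dW ?ltr0n.
  by rewrite mulrDr mulrA mulfV ?mul1r ?lerDr ?mulr1// pnatr_eq0.
pose h k z := f z * b k z * b k z.
have hM k z : cabs z < 1 -> cabs (h k z) <= k.+1%:R.
  by move=> z1; rewrite cabsM -[leRHS]mulr1 ler_pM ?cabs_ge0 ?fb ?b1.
have ab k : analytic (b k).
  move=> z z1; apply: cdiffableV; last exact: dn.
  by apply: cdiffableD; [exact: cdiffable_cst|apply: cdiffableM; [exact: cdiffable_cst|exact: aW]].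
have ah k : analytic (h k).
  by move=> z z1; apply: cdiffableM; [apply: cdiffableM; [exact: af|exact: ab]|exact: ab].
have hF k : cabs (h k a) <= 2 * ravg (fun t => poisson a t * cabs (F t)).
  have [B [mB _ radB _]] := bounded_representation (ab k) (b1 k).
  have [H [mH HM radH HE]] := bounded_representation (ah k) (hM k).
  have cP := cmeas_rcont (rcont_poisson a1).
  have Pi : cint (poisson a) by have [] := cintc_rcont (rcont_poisson a1).
  have p2 t := poisson_le t a1.
  rewrite HE//; apply: cabs_cavg_le_ae.
  - apply: (@cintc_le _ _ (fun t => poisson a t * (k.+1%:R + k.+1%:R))).
    + exact: cmeasurableM.
    + by under eq_fun do rewrite mulrC; exact: cintZ.
    + move=> t _; rewrite cabsM cabs_real ger0_norm ?poisson_ge0// ler_wpM2l ?poisson_ge0//; exact: HM.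
  - apply: (@cint_le _ _ (fun t => 2 / (1 - cabs a) * cabs (F t))).
    + by apply: measurable_funM; [exact: cint_meas|exact: cint_meas].
    + exact: cintZ.
    + move=> t _; rewrite normrM !ger0_norm ?cabs_ge0 ?poisson_ge0//.
      by rewrite ler_wpM2r ?cabs_ge0 ?p2.
  apply: (filterS2 (ae_filter_ringOfSetsType mu) _ radB radH) => t hB hH ct.
  move: (hB ct) (hH ct) => {}hB {}hH.
  rewrite cabsM cabs_real ger0_norm ?poisson_ge0// ler_wpM2l ?poisson_ge0//.
  have cexp n : cabs ((rad n)%:C * expi t) < 1.
    by have /andP[r0 r1] := rad01 n; rewrite cabs_scale// ltW.
  have cH := radial_cvg_rad hH; have cB := radial_cvg_rad hB.
  have B1 : cabs (B t) <= 1 by apply: (ccvg_le cB) => n; exact: b1.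
  have [Bt0|Bt0] := eqVneq (B t) 0.
    suff -> : H t = 0 by rewrite cabs0 cabs_ge0.
    apply: ccvg_unique cH _; rewrite Bt0 in cB.
    have cB' : k.+1%:R * cabs (b k ((rad n)%:C * expi t) - 0) @[n --> \oo] --> (0 : R).
      by rewrite -[X in _ --> X](mulr0 k.+1%:R); apply: cvgMr.
    apply: (squeeze_cvgr _ (cvg_cst 0) cB'); apply: nearW => n.
    by rewrite cabs_ge0 !subr0 /= cabsM ler_wpM2r ?cabs_ge0// fb.
  have cf : radial_cvg f t (H t * (B t)^-1 * (B t)^-1).
    apply: (@radial_cvg_eq (fun z => h k z * (b k z)^-1 * (b k z)^-1)).
      by move=> z z1; rewrite /h mulrAC !mulfK ?invr_eq0 ?dn.
    by apply: radial_cvgM; [apply: radial_cvgM => //|]; exact: radial_cvgV.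
  have HE' : H t = F t * B t * B t by rewrite FE (radial_cvg_boundary cf) !mulfVK.
  rewrite HE' !cabsM -[leRHS]mulr1 -mulrA ler_wpM2l ?cabs_ge0//.
  by rewrite -[leRHS]mulr1 ler_pM ?cabs_ge0.
apply: (@ccvg_le _ (fun k => h k a)) => //.
(* [h k a] is [q] at the real point [c k], which tends to 0, and [q 0] is [f a]. *)
pose q w : R[i] := f a * (1 + w * W a)^-1 * (1 + w * W a)^-1.
have q0 : ccont q 0.
  have dq : cdiffable (fun w => (1 + w * W a)^-1) 0.
    apply: cdiffableV; last by rewrite mul0r addr0 oner_neq0.
    by apply: cdiffableD; [exact: cdiffable_cst|apply: cdiffableM; [exact: cdiffable_id|exact: cdiffable_cst]].
  by apply/cdiffable_ccont/cdiffableM => //; apply: cdiffableM => //; exact: cdiffable_cst.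
have -> : f a = q 0 by rewrite /q mul0r addr0 invr1 !mulr1.
apply: (ccvg_comp q0).
apply/ccvgP; split => /=; last exact: cvg_cst.
exact: cvg_harmonic.
Qed.

End Boundary.

(** * The Orlicz function and the self-map *)

Section Construction.
Variable R : realType.
Local Notation Re := (@complex.Re R).
Local Notation Im := (@complex.Im R).
Local Notation mu := (@lebesgue_measure R).
Local Notation carc := (@carc R).
Implicit Types (c t x y e r s M : R) (z w : R[i]).
Local Open Scope complex_scope.

Definition hinge (k : nat) : R := 2 ^+ (12 ^ k).

Lemma hingeS k : hinge k.+1 = hinge k ^+ 12.
Proof. by rewrite /hinge expnSr exprM. Qed.

Lemma hinge_ge_exp k : 2 ^+ k.+1 <= hinge k.
Proof.
apply: ler_weXn2l; first by rewrite ler1n.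
exact: ltn_expl.
Qed.

Lemma hinge_ge2 k : 2 <= hinge k.
Proof. by apply: le_trans (hinge_ge_exp k); rewrite exprS ler_peMr// exprn_ege1// ler1n. Qed.

Lemma hinge_gt0 k : 0 < hinge k.
Proof. exact: lt_le_trans (hinge_ge2 k). Qed.
Hint Resolve hinge_gt0 : core.

Lemma hinge_ge1 k : 1 <= hinge k.
Proof. by apply: le_trans (hinge_ge2 k); rewrite ler1n. Qed.
Hint Resolve hinge_ge1 : core.

Lemma hinge_ge0 k : 0 <= hinge k.
Proof. exact: ltW. Qed.
Hint Resolve hinge_ge0 : core.

Lemma hinge_leS k : hinge k <= hinge k.+1.
Proof. by rewrite hingeS -{1}(expr1 (hinge k)) ler_weXn2l. Qed.

Lemma hinge_mono j k : (j <= k)%N -> hinge j <= hinge k.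
Proof. by elim: k => [|k IH]; rewrite leq_eqVlt => /orP[/eqP->//|]//; rewrite ltnS => /IH h; exact: le_trans (hinge_leS k). Qed.

Lemma hinge_unbounded M : exists N, forall k, (N <= k)%N -> M <= hinge k.
Proof.
exists (Num.truncn M).+1 => k Nk; apply: le_trans (hinge_ge_exp k).
apply: (@le_trans _ _ k.+1%:R); last first.
  by rewrite -natrX ler_nat ltnW// ltn_expl.
have [M0|M0] := leP M 0; first exact: le_trans M0 _.
apply: ltW; apply: lt_le_trans (truncnS_gt M) _; by rewrite ler_nat; exact: leqW.
Qed.

Definition hinge_values x := [set y | y = x \/ exists k, y = hinge k ^+ 3 * (x - hinge k)].
Definition Psi x := sup (hinge_values x).

(** Below [hinge k.+1] the lines of index above k are nonpositive, and the remaining slopes are at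
    most [hinge k ^+ 3]. *)
Lemma hinge_values_le k x y : 0 <= x -> x <= hinge k.+1 -> hinge_values x y -> y <= hinge k ^+ 3 * x.
Proof.
move=> x0 xT [->|[j ->]].
  by rewrite ler_peMl// exprn_ege1.
have [jk|kj] := leqP j k.
  apply: (@le_trans _ _ (hinge j ^+ 3 * x)).
    by rewrite ler_pM2l ?exprn_gt0// gerBl.
  by rewrite ler_wpM2r// lerXn2r ?nnegrE// hinge_mono.
apply: (@le_trans _ _ 0); last by rewrite mulr_ge0// exprn_ge0.
by rewrite pmulr_rle0 ?exprn_gt0// subr_le0 (le_trans xT)// hinge_mono.
Qed.

(** Negative [x] are included, so [sup] never takes its default value and [Psi] is monotone on the
    whole line, which [measurable_Psi] uses. *)
Lemma hinge_values_has_sup x : has_sup (hinge_values x).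
Proof.
split; first by exists x; left.
have [x0|x0] := leP 0 x.
  have [N HN] := hinge_unbounded x; exists (hinge N ^+ 3 * x) => y; apply: hinge_values_le => //.
  by apply: HN.
exists 0 => y [->|[k ->]]; first exact: ltW.
by rewrite pmulr_rle0 ?exprn_gt0// subr_le0 (le_trans (ltW x0)).
Qed.

Lemma Psi_ge x : x <= Psi x.
Proof. by apply: ub_le_sup; [case: (hinge_values_has_sup x)|left]. Qed.

Lemma Psi_hinge k x : hinge k ^+ 3 * (x - hinge k) <= Psi x.
Proof. by apply: ub_le_sup; [case: (hinge_values_has_sup x)|right; exists k]. Qed.

Lemma Psi_le k x : 0 <= x -> x <= hinge k.+1 -> Psi x <= hinge k ^+ 3 * x.
Proof. move=> x0 xT; apply: sup_le_ub; [by exists x; left|move=> y; exact: hinge_values_le]. Qed.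

Lemma Psi_mono x y : x <= y -> Psi x <= Psi y.
Proof.
move=> xy; apply: sup_le_ub; first by exists x; left.
move=> _ [->|[k ->]]; first exact: le_trans (Psi_ge y).
by apply: le_trans (Psi_hinge k y); rewrite ler_pM2l ?exprn_gt0// lerD2r.
Qed.

Lemma Psi_convex x y c : 0 <= c -> c <= 1 -> Psi (c * x + (1 - c) * y) <= c * Psi x + (1 - c) * Psi y.
Proof.
move=> c0 c1; have c1' : 0 <= 1 - c by lra.
apply: sup_le_ub; first by eexists; left.
move=> _ [->|[k ->]].
  by apply: lerD; rewrite ler_wpM2l// Psi_ge.
rewrite (_ : _ * _ = c * (hinge k ^+ 3 * (x - hinge k)) + (1 - c) * (hinge k ^+ 3 * (y - hinge k))); last by ring.
by apply: lerD; rewrite ler_wpM2l// Psi_hinge.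
Qed.

Lemma Psi0 : Psi 0 = 0.
Proof. by apply/eqP; rewrite eq_le Psi_ge andbT; have := @Psi_le 0 0; rewrite mulr0; apply. Qed.

Lemma Psi_Orlicz : Orlicz Psi.
Proof.
split.
- exact: Psi0.
- by move=> x x0; exact: lt_le_trans (Psi_ge x).
- by move=> x y _; exact: Psi_mono.
- by move=> x y c _ _; exact: Psi_convex.
- by move=> M; exists M => x Mx; exact: le_trans (Psi_ge x).
Qed.

Lemma Psi_ge0 x : 0 <= x -> 0 <= Psi x.
Proof. by move=> x0; exact: le_trans (Psi_ge x). Qed.

Lemma Psi_scale x c : 1 <= c -> 0 <= x -> Psi (x / c) <= Psi x / c.
Proof.
move=> c1 x0; have c0 : 0 < c by lra.
have := @Psi_convex x 0 c^-1; rewrite Psi0 !mulr0 !addr0 ![c^-1 * _]mulrC; apply.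
  by rewrite invr_ge0 ltW.
by rewrite invf_le1.
Qed.

Lemma measurable_Psi (D : set R) : measurable D -> measurable_fun D Psi.
Proof. by move=> mD; apply: nondecreasing_measurable => // x y; exact: Psi_mono. Qed.

(* [x / Psi x] is nonincreasing *)
Lemma Psi_slope x s : 0 < x -> 0 <= s -> s <= x + x / Psi x * Psi s.
Proof.
move=> x0 s0; have Px : 0 < Psi x by exact: lt_le_trans (Psi_ge x).
have [sx|xs] := leP s x.
  by rewrite (le_trans sx)// lerDl mulr_ge0 ?Psi_ge0// divr_ge0// ltW.
apply: (@le_trans _ _ (x / Psi x * Psi s)); last by rewrite lerDr ltW.
have h := @Psi_scale s (s / x).
have sx1 : 1 <= s / x by rewrite ler_pdivlMr// mul1r ltW.
move: (h sx1 s0); rewrite invf_div mulrCA divff ?gt_eqF ?(lt_trans x0 xs)// mulr1 => {}h.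
have s00 : 0 < s by exact: lt_trans xs.
rewrite mulrAC ler_pdivlMr// mulrC -ler_pdivlMr ?divr_gt0//.
by rewrite (_ : x * Psi s / s = Psi s * (x / s))//; ring.
Qed.


(** * The weights b_k, the offsets e_k and the self-map *)

Definition weight k := hinge k ^- 10.
Definition offset k := hinge k ^- 11.

Lemma weight_gt0 k : 0 < weight k.
Proof. by rewrite invr_gt0 exprn_gt0. Qed.

Lemma offset_gt0 k : 0 < offset k.
Proof. by rewrite invr_gt0 exprn_gt0. Qed.
Hint Resolve weight_gt0 offset_gt0 : core.

Lemma weight_ge0 k : 0 <= weight k.
Proof. exact: ltW. Qed.
Hint Resolve weight_ge0 : core.

Lemma weightS k : weight k.+1 <= weight k / 2.
Proof.
rewrite /weight hingeS -exprM -invfM lef_pV2 ?posrE ?mulr_gt0 ?exprn_gt0//.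
rewrite (exprD _ 119 1) expr1 ler_pM ?exprn_ge0 ?hinge_ge2//.
by rewrite ler_weXn2l.
Qed.

Lemma offset_mono j k : (j <= k)%N -> offset k <= offset j.
Proof. by move=> jk; rewrite lef_pV2 ?posrE ?exprn_gt0// lerXn2r ?nnegrE// hinge_mono. Qed.

Definition bsum n := \sum_(k < n) weight k.

(** The subtracted term [2 * weight m] is what lets the induction absorb the next weight, since
    weights at least halve. *)
Lemma bsumD n m : (n <= m)%N -> bsum n <= bsum m /\ bsum m - bsum n <= 2 * weight n - 2 * weight m.
Proof.
elim: m => [|m IH]; first by rewrite leqn0 => /eqP->; split; lra.
rewrite leq_eqVlt => /orP[/eqP->|]; first by split; lra.
rewrite ltnS => /IH[h1 h2]; rewrite /bsum big_ord_recr /= -/(bsum m) -/(bsum n).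
have := weight_gt0 m; have := weightS m; split; lra.
Qed.

Lemma bsum01 n : 0 <= bsum n <= 1.
Proof.
have [h1 h2] := bsumD (leq0n n); rewrite /bsum big_ord0 -/(bsum n) in h1 h2.
rewrite h1 /=; have := weight_gt0 n; suff : weight 0 <= 1 / 2 by lra.
rewrite div1r lef_pV2 ?posrE ?exprn_gt0// (le_trans (hinge_ge2 0))// -[leLHS]expr1.
by rewrite ler_weXn2l.
Qed.

(** The estimates below hold on the half-plane Re z <= 1, hence in the disc and on the circle alike,
    including the point 1. *)
Definition vterm k z : R[i] := (1 - z) / (1 - z + (offset k.+1)%:C).

Lemma vterm_den k z : Re z <= 1 -> offset k.+1 <= cabs (1 - z + (offset k.+1)%:C).
Proof.
move=> z1; apply: le_trans (le_trans (ler_norm _) (Re_le_cabs _)).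
by case: z z1 => x y /=; lra.
Qed.

Lemma vterm_den_ge k z : Re z <= 1 -> cabs (1 - z) <= cabs (1 - z + (offset k.+1)%:C).
Proof.
move=> z1; rewrite -(@ler_pXn2r _ 2)// ?nnegrE ?cabs_ge0// !cabs_sqr.
have := offset_gt0 k.+1; case: z z1 => x y /= ; set e := offset _; nra.
Qed.

Lemma vterm_den_gt0 k z : Re z <= 1 -> 0 < cabs (1 - z + (offset k.+1)%:C).
Proof. by move=> z1; apply: lt_le_trans (vterm_den k z1). Qed.

Lemma vterm_le1 k z : Re z <= 1 -> cabs (vterm k z) <= 1.
Proof. by move=> z1; rewrite cabsM cabsV ler_pdivrMr ?vterm_den_gt0// mul1r vterm_den_ge. Qed.

Lemma vterm_small k z : Re z <= 1 -> cabs (vterm k z) <= cabs (1 - z) / offset k.+1.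
Proof.
move=> z1; rewrite cabsM cabsV ler_wpM2l ?cabs_ge0// lef_pV2 ?posrE ?vterm_den//.
exact: vterm_den_gt0.
Qed.

(** With u = 1 - z and e the offset, the difference is (u - e) / (2 (u + e)), and |u - e| <= |u + e|
    because Re u >= 0. *)
Lemma vterm_half k z : Re z <= 1 -> cabs (vterm k z - (2^-1)%:C) <= 2^-1.
Proof.
move=> z1; have h := vterm_den_gt0 k z1.
have n0 : 1 - z + (offset k.+1)%:C != 0 by rewrite -cabs_gt0.
have -> : vterm k z - (2^-1)%:C = (1 - z - (offset k.+1)%:C) / (1 - z + (offset k.+1)%:C) * (2^-1)%:C.
  rewrite /vterm; set e := (offset _)%:C in n0 *.
  have t0 : 2%:R != 0 :> R[i] by rewrite -cabs_eq0 cabs_nat pnatr_eq0.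
  have -> : (2^-1)%:C = 2%:R^-1 :> R[i] by rewrite fmorphV rmorph_nat.
  by field; exact: n0.
rewrite cabsM cabs_real ger0_norm// -[leRHS]mul1r ler_wpM2r//.
rewrite cabsM cabsV ler_pdivrMr// mul1r.
rewrite -(@ler_pXn2r _ 2)// ?nnegrE ?cabs_ge0// !cabs_sqr.
have := offset_gt0 k.+1; case: z z1 {h n0} => x y /= ; set e := offset _; nra.
Qed.

(** The real part is (|u|^2 + e Re u) / |u + e|^2, and |u + e| <= 2 |u| once e <= |u|. *)
Lemma vterm_Re k z : Re z <= 1 -> offset k.+1 <= cabs (1 - z) -> 4^-1 <= Re (vterm k z).
Proof.
move=> z1 ez; have h := vterm_den_gt0 k z1.
have D0 : 0 < cabs (1 - z + (offset k.+1)%:C) ^+ 2 by rewrite exprn_gt0.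
suff -> : Re (vterm k z) = (cabs (1 - z) ^+ 2 + offset k.+1 * (1 - Re z)) / cabs (1 - z + (offset k.+1)%:C) ^+ 2.
  rewrite ler_pdivlMr//.
  have : cabs (1 - z + (offset k.+1)%:C) <= 2 * cabs (1 - z).
    apply: le_trans (cabsD _ _) _; rewrite cabs_real ger0_norm; [lra|exact: ltW].
  move=> h2; have h3 : cabs (1 - z + (offset k.+1)%:C) ^+ 2 <= 4 * cabs (1 - z) ^+ 2.
    by have := cabs_ge0 (1 - z); nra.
  have : 0 <= offset k.+1 * (1 - Re z) by rewrite mulr_ge0 ?subr_ge0// ltW.
  lra.
move: D0; rewrite !cabs_sqr /vterm; case: z {z1 ez h} => x y /=; set e := offset _.
move=> D0; field; rewrite gt_eqF//.
by move: D0; rewrite sub0r addr0.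
Qed.


Definition wsum n z : R[i] := \sum_(k < n) (weight k)%:C * vterm k z.

Lemma wsumS n z : wsum n.+1 z = wsum n z + (weight n)%:C * vterm n z.
Proof. by rewrite /wsum big_ord_recr. Qed.

(** The induction carries the disc with diameter [0, bsum n], to which each term adds a disc with
    diameter [0, weight n]; as [bsum n <= 1], it lies in the disc with diameter [0, 1]. *)
Lemma wsum_half n z : Re z <= 1 -> cabs (wsum n z - (2^-1)%:C) <= 2^-1.
Proof.
move=> z1; suff h : cabs (wsum n z - (bsum n / 2)%:C) <= bsum n / 2.
  have /andP[s0 s1] := bsum01 n.
  have -> : wsum n z - (2^-1)%:C = wsum n z - (bsum n / 2)%:C - ((1 - bsum n) / 2)%:C.
    by rewrite -addrA -opprD -rmorphD /=; congr (_ - _%:C); field.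
  apply: le_trans (cabsB _ _) _; rewrite cabs_real ger0_norm; [lra|rewrite divr_ge0//; lra].
elim: n => [|n IH]; first by rewrite /wsum /bsum !big_ord0 mul0r subr0 cabs0.
rewrite wsumS /bsum big_ord_recr /= -/(bsum n).
have -> : wsum n z + (weight n)%:C * vterm n z - ((bsum n + weight n) / 2)%:C =
  (wsum n z - (bsum n / 2)%:C) + (weight n)%:C * (vterm n z - (2^-1)%:C).
  have -> : ((bsum n + weight n) / 2)%:C = (bsum n / 2)%:C + (weight n)%:C * (2^-1)%:C :> R[i].
    by rewrite -rmorphM -rmorphD /=; congr (_%:C); field.
  by ring.
apply: le_trans (cabsD _ _) _; rewrite mulrDl lerD// cabsM cabs_real ger0_norm ?ler_wpM2l ?vterm_half// ltW//.
Qed.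

Lemma wsum_tail n m z : Re z <= 1 -> (n <= m)%N -> cabs (wsum m z - wsum n z) <= 2 * weight n.
Proof.
move=> z1 nm; have [_ h] := bsumD nm; have := weight_gt0 m.
suff : cabs (wsum m z - wsum n z) <= bsum m - bsum n by lra.
elim: m nm {h} => [|m IH]; first by rewrite leqn0 => /eqP->; rewrite !subrr cabs0.
rewrite leq_eqVlt => /orP[/eqP->|]; first by rewrite !subrr cabs0.
rewrite ltnS => /IH h; rewrite wsumS /bsum big_ord_recr /= -/(bsum m) -/(bsum n).
rewrite addrAC [X in _ <= X]addrAC; apply: le_trans (cabsD _ _) _; rewrite lerD//.
by rewrite cabsM cabs_real ger0_norm// ler_piMr// vterm_le1.
Qed.

Lemma weight_small e : 0 < e -> exists n, 2 * weight n <= e.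
Proof.
move=> e0; have [N HN] := hinge_unbounded (2 / e); exists N.
rewrite /weight ler_pdivrMr ?exprn_gt0// mulrC -ler_pdivrMr//; apply: le_trans (HN N _) _ => //.
by rewrite -[leLHS]expr1 ler_weXn2l.
Qed.

Lemma wsum_ccvg z : Re z <= 1 -> exists l, ccvg (wsum ^~ z) l.
Proof.
move=> z1.
have C (P : R[i] -> R) : (forall a b, `|P a - P b| <= cabs (a - b)) -> cvg (P (wsum n z) @[n --> \oo]).
  move=> HP; apply/cauchy_cvgP/cauchy_exP => e e0.
  have e20 : 0 < e / 2 by lra.
  have [n bn] := weight_small e20; exists (P (wsum n z)); exists n => // m /= nm.
  rewrite /ball /= (le_lt_trans (HP _ _))// cabsBC (le_lt_trans (wsum_tail z1 nm))//; lra.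
have /cvg_ex[l1 h1] : cvg (Re (wsum n z) @[n --> \oo]).
  by apply: C => a b; rewrite (_ : Re a - Re b = Re (a - b)) ?Re_le_cabs//; case: a b => ? ? [].
have /cvg_ex[l2 h2] : cvg (Im (wsum n z) @[n --> \oo]).
  by apply: C => a b; rewrite (_ : Im a - Im b = Im (a - b)) ?Im_le_cabs//; case: a b => ? ? [].
by exists (Complex l1 l2); apply/ccvgP.
Qed.

Definition wser z : R[i] := Complex (limn (fun n => Re (wsum n z))) (limn (fun n => Im (wsum n z))).

Lemma wsum_wser z : Re z <= 1 -> ccvg (wsum ^~ z) (wser z).
Proof.
move=> z1; have [l /ccvgP[l1 l2]] := wsum_ccvg z1; apply/ccvgP; split => /=.
  by rewrite (cvg_lim _ l1).
by rewrite (cvg_lim _ l2).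
Qed.

Lemma ccvg_shift (u : nat -> R[i]) l n : ccvg u l -> ccvg (fun m => u (m + n)%N) l.
Proof. by move=> h; rewrite /ccvg (cvg_shiftn n (fun m => cabs (u m - l))). Qed.

Lemma ccvgB_cst (u : nat -> R[i]) l k : ccvg u l -> ccvg (fun m => u m - k) (l - k).
Proof. by rewrite /ccvg; under [in X in _ -> X]eq_fun do rewrite opprB addrA subrK. Qed.

Lemma wser_tail n z : Re z <= 1 -> cabs (wser z - wsum n z) <= 2 * weight n.
Proof.
move=> z1; have := ccvgB_cst (wsum n z) (ccvg_shift n (wsum_wser z1)).
move=> /ccvg_le; apply => m; apply: wsum_tail => //; exact: leq_addl.
Qed.

Lemma wser_sqr z : Re z <= 1 -> cabs (wser z) ^+ 2 <= Re (wser z).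
Proof.
move=> z1; have : cabs (wser z - (2^-1)%:C) <= 2^-1.
  by have := ccvgB_cst (2^-1)%:C (wsum_wser z1) => /ccvg_le; apply => m; exact: wsum_half.
rewrite -(@ler_pXn2r _ 2)// ?nnegrE ?cabs_ge0// !cabs_sqr.
by case: (wser z) => x y /=; lra.
Qed.

Lemma vterm_Re_ge0 k z : Re z <= 1 -> 0 <= Re (vterm k z).
Proof.
move=> /(vterm_half k) h.
have := le_trans (Re_le_cabs _) h; rewrite ler_norml => /andP[+ _].
by case: (vterm k z) => x y /=; lra.
Qed.

Lemma Re_sum (I : Type) (r : seq I) (P : pred I) (E : I -> R[i]) :
  Re (\sum_(i <- r | P i) E i) = \sum_(i <- r | P i) Re (E i).
Proof. exact: raddf_sum. Qed.

(** All terms have nonnegative real part, so the term of index k alone gives the bound. *)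
Lemma wser_Re k z : Re z <= 1 -> offset k.+1 <= cabs (1 - z) -> weight k / 4 <= Re (wser z).
Proof.
move=> z1 ek; have /(ccvg_shift k.+1)/ccvgP[h _] := wsum_wser z1.
rewrite -(cvg_lim _ h)//; apply: limr_ge; first by apply/cvg_ex; eexists; exact: h.
apply: nearW => m; have km : (k < m + k.+1)%N by rewrite addnS ltnS leq_addl.
rewrite /wsum Re_sum (bigD1 (Ordinal km))//= -[leLHS]addr0 lerD//.
  by rewrite Re_scale ler_wpM2l ?vterm_Re.
by apply: sumr_ge0 => i _; rewrite Re_scale mulr_ge0 ?vterm_Re_ge0.
Qed.

(** Each quotient of index n < k is at most |u| / e_(n+1) <= |u| / e_k <= b_k, and their weights sum
    to at most 1; the tail from k on contributes 2 b_k. The offset of index k + 1 in [vterm k] is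
    what makes e_k suffice here. *)
Lemma wser_small k z : Re z <= 1 -> cabs (1 - z) <= weight k * offset k -> cabs (wser z) <= 3 * weight k.
Proof.
move=> z1 zk; have h := wser_tail k z1.
suff : cabs (wsum k z) <= weight k.
  have := cabsD (wser z - wsum k z) (wsum k z); rewrite subrK; lra.
have /andP[s0 s1] := bsum01 k.
apply: (@le_trans _ _ (bsum k * weight k)); last by rewrite ler_piMl.
suff H n : (n <= k)%N -> cabs (wsum n z) <= bsum n * weight k by exact: H.
elim: n => [|n IH]; first by rewrite /wsum /bsum !big_ord0 mul0r cabs0.
move=> nk; rewrite wsumS /bsum big_ord_recr /= -/(bsum n) mulrDl.
apply: le_trans (cabsD _ _) _; rewrite lerD ?IH ?(ltnW nk)//.
rewrite cabsM cabs_real ger0_norm// ler_wpM2l// (le_trans (vterm_small _ z1))//.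
by rewrite ler_pdivrMr// (le_trans zk)// ler_wpM2l// offset_mono.
Qed.

Definition phi z : R[i] := 1 - wser z.

Lemma phi_bound k z : Re z <= 1 -> offset k.+1 <= cabs (1 - z) -> cabs (phi z) <= 1 - weight k / 8.
Proof.
move=> z1 ek; have h1 := wser_sqr z1; have h2 := wser_Re z1 ek; have b0 := weight_gt0 k.
have : cabs (phi z) ^+ 2 <= 1 - weight k / 4.
  move: h1 h2; rewrite /phi !cabs_sqr; case: (wser z) => x y /=; lra.
(* Only [weight k <= 1] is extracted from the sums: it makes 1 - b_k / 8 nonnegative, so squares may
   be compared. *)
have := bsum01 k.+1; rewrite /bsum big_ord_recr /= -/(bsum k); have /andP[s0 _] := bsum01 k.
move=> /andP[_ b1] h; rewrite -(@ler_pXn2r _ 2)// ?nnegrE ?cabs_ge0//; nra.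
Qed.

Lemma offset_small e : 0 < e -> exists N, forall n, (N <= n)%N -> offset n <= e.
Proof.
move=> e0; have [N HN] := hinge_unbounded e^-1; exists N => n /HN h.
rewrite /offset -[leRHS]invrK lef_pV2 ?posrE ?invr_gt0 ?exprn_gt0// (le_trans h)//.
by rewrite -[leLHS]expr1 ler_weXn2l.
Qed.

Lemma phi_lt1 z : Re z <= 1 -> z != 1 -> cabs (phi z) < 1.
Proof.
move=> z1 zn; have u0 : 0 < cabs (1 - z) by rewrite cabs_gt0 subr_eq0 eq_sym.
have [N HN] := offset_small u0; have := phi_bound z1 (HN N.+1 (leqnSn N)).
have := weight_gt0 N; lra.
Qed.

Lemma cdiffable_wsum n z : Re z <= 1 -> cdiffable (wsum n) z.
Proof.
move=> z1; rewrite /wsum; elim: n => [|n IH].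
  by under eq_fun do rewrite big_ord0; exact: cdiffable_cst.
under eq_fun do rewrite big_ord_recr /=; apply: cdiffableD => //.
apply: cdiffableM; first exact: cdiffable_cst.
have d1 : cdiffable (fun w => 1 - w) z by apply: cdiffableB; [exact: cdiffable_cst|exact: cdiffable_id].
apply: cdiffableM => //; apply: cdiffableV; first by apply: cdiffableD => //; exact: cdiffable_cst.
by rewrite -cabs_gt0 vterm_den_gt0.
Qed.

(** The tail bound is uniform on the closed half-plane, so continuity reaches the circle, and in
    particular the point 1. *)
Lemma phi_continuous z e : Re z <= 1 -> 0 < e ->
  exists2 d, 0 < d & forall w, Re w <= 1 -> cabs (w - z) < d -> cabs (phi w - phi z) <= e.
Proof.
move=> z1 e0; have e30 : 0 < e / 3 by lra.
have [n bn] := weight_small e30.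
have cw : ccont (wsum n) z.
  by apply: cdiffable_ccont; exact: cdiffable_wsum.
have [d d0 H] := cw _ e30; exists d => // w w1 wz.
have h1 := wser_tail n z1; have h2 := wser_tail n w1; have h3 := H w wz.
have -> : phi w - phi z = - ((wser w - wsum n w) + ((wsum n w - wsum n z) - (wser z - wsum n z))).
  by rewrite /phi; ring.
rewrite cabsN; apply: le_trans (cabsD _ _) _.
have := cabsB (wsum n w - wsum n z) (wser z - wsum n z); lra.
Qed.


Lemma cabs_Re_le1 z : cabs z <= 1 -> Re z <= 1.
Proof. by move=> h; apply: le_trans h; apply: le_trans (ler_norm _) (Re_le_cabs _). Qed.

Lemma Re_expi_le1 r t : 0 <= r <= 1 -> Re (r%:C * expi t) <= 1.
Proof. by move=> /andP[r0 r1]; apply: cabs_Re_le1; rewrite cabs_scale. Qed.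

Lemma phi_analytic : analytic phi.
Proof.
apply: (@analytic_lim R (fun n z => 1 - wsum n z)).
- move=> n z z1; apply: cdiffableB; first exact: cdiffable_cst.
  by apply: cdiffable_wsum; exact/cabs_Re_le1/ltW.
- move=> r r1; exists 2 => n z zr.
  have z1 : Re z <= 1 by apply/cabs_Re_le1/ltW/(le_lt_trans zr).
  have := cabsB (1 - (2^-1)%:C) (wsum n z - (2^-1)%:C).
  rewrite opprB addrA subrK => /le_trans; apply.
  have h : cabs (1 - (2^-1)%:C) <= 1 :> R.
    by have := cabs_real (1 - 2^-1 : R); rewrite rmorphB /= => ->; rewrite ger0_norm; lra.
  have := wsum_half n z1; lra.
- move=> z z1; have := wsum_wser (cabs_Re_le1 (ltW z1)); rewrite /ccvg /phi.
  rewrite (_ : (fun n => cabs (1 - wsum n z - (1 - wser z))) = fun n => cabs (wsum n z - wser z))//.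
  by apply/funext => n; rewrite -cabsN; congr cabs; ring.
Qed.

Lemma phi_selfmap : analytic_selfmap phi.
Proof.
split; first by move=> z /phi_analytic /derivable_cdiff.
move=> z z1; apply: phi_lt1; first exact/cabs_Re_le1/ltW.
by apply/eqP => E; move: z1; rewrite E cabs1 ltxx.
Qed.

Lemma phi_radial t : radial_cvg phi t (phi (expi t)).
Proof.
move=> e e0; have z1 : Re (expi t) <= 1 by apply: cabs_Re_le1; rewrite cabs_expi.
have [d d0 H] := phi_continuous z1 e0; exists (Num.min d 1); first by rewrite lt_min d0 ltr01.
move=> r rd r1; have m1 : Num.min d 1 <= d by rewrite ge_min lexx.
have m2 : Num.min d 1 <= 1 by rewrite ge_min lexx orbT.
have r0 : 0 <= r by lra.
apply: H; first by apply: Re_expi_le1; rewrite r0 ltW.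
have -> : r%:C * expi t - expi t = (r - 1)%:C * expi t by rewrite rmorphB /=; ring.
by rewrite cabsM cabs_expi mulr1 cabs_real ltr0_norm ?subr_lt0//; lra.
Qed.

Lemma rcont_phi_expi : rcont (fun t => phi (expi t)).
Proof.
move=> t e e0; have zE s : Re (expi s) <= 1 by apply: cabs_Re_le1; rewrite cabs_expi.
have [d d0 H] := phi_continuous (zE t) e0; have d20 : 0 < d / 2 by lra.
have [d1 d10 H1] := @rcont_expi R t _ d20; exists d1 => // s /H1 h; apply: H => //; lra.
Qed.

(** * Arcs around the point 1 and an integrable envelope *)

Lemma cos_2pi_sub t : cos (2 * pi - t) = cos t.
Proof. by rewrite mulr_natl cosB cos2pi sin2pi; ring. Qed.

Lemma sin_2pi_sub t : sin (2 * pi - t) = - sin t.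
Proof. by rewrite mulr_natl sinB cos2pi sin2pi; ring. Qed.

Lemma expi_neq1 t : 0 < t < 2 * pi -> expi t != 1 :> R[i].
Proof.
move=> /andP[t0 t2]; apply/eqP => -[c1 s0].
have p0 := pi_gt0 R.
have [tp|pt] := ltP t pi.
  have := @ltr_cos R 0 t; rewrite !in_itv /= lexx ltW//= (ltW t0) (ltW tp) => /(_ isT isT).
  by rewrite cos0 c1 ltxx t0.
have := @ltr_cos R 0 (2 * pi - t); rewrite !in_itv /= lexx (ltW p0) /=.
rewrite cos_2pi_sub.
rewrite cos0 c1 ltxx => /(_ isT) h.
have : (0 <= 2 * pi - t <= pi) by apply/andP; split; lra.
by move=> /h; lra.
Qed.

(** By the mean value theorem, the cosine being at least cos t on [0, t]. *)
Lemma sin_ge_half t : 0 <= t <= pi -> 2^-1 <= cos t -> t / 2 <= sin t.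
Proof.
move=> /andP[]; rewrite le_eqVlt => /orP[/eqP<-|t0] tp ct; first by rewrite mul0r sin0.
have [|c cI] := @MVT R sin cos 0 t t0.
  by apply: continuous_subspaceT => x; exact: continuous_sin.
rewrite sin0 !subr0 => ->.
move: cI; rewrite in_itv /= => /andP[c0 ct'].
have : cos t < cos c.
  by rewrite ltr_cos// in_itv /=; apply/andP; split; lra.
move=> h; rewrite mulrC ler_wpM2r ?ltW//; lra.
Qed.

Definition near_one e : set R := carc `&` [set t | cabs (1 - expi t) < e].

Lemma measurable_near_one e : measurable (near_one e).
Proof.
have c : continuous (fun t => cabs (1 - @expi R t)).
  apply: rcont_abs => t d d0; have [d1 d10 H] := @rcont_expi R t _ d0; exists d1 => // s /H.
  have -> : 1 - expi s - (1 - expi t) = expi t - expi s :> R[i] by ring.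
  by rewrite cabsBC.
have := continuous_measurable_fun c => /(_ measurableT `]-oo, e[%classic (measurable_itv _)).
rewrite setTI => h; apply: measurableI; first exact: measurable_carc.
by rewrite (_ : [set t | _] = (fun t => cabs (1 - @expi R t)) @^-1` `]-oo, e[%classic)//; apply/seteqP; split => x /=; rewrite in_itv.
Qed.

(** For e <= 1/2 the cosine is at least 1/2, so |sin t| < e places t within 2 e of one of the
    endpoints 0 and 2 pi. *)
Lemma near_one_measure e : 0 < e -> e <= 2^-1 -> (mu (near_one e) <= (4 * e)%:E)%E.
Proof.
move=> e0 e1; have p0 := pi_gt0 R.
have sub : near_one e `<=` `[0, 2 * e]%classic `|` `[2 * pi - 2 * e, 2 * pi]%classic.
  move=> t [ct te]; move: ct; rewrite /carc /= in_itv /= => /andP[t0 t2].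
  have {}te : cabs (1 - expi t) < e by exact: te.
  have c1 : 2^-1 <= cos t.
    have h : 1 - cos t <= cabs (1 - expi t) := le_trans (ler_norm _) (Re_le_cabs (1 - expi t)).
    lra.
  have s1 : `|sin t| < e.
    by apply: le_lt_trans te; have := Im_le_cabs (1 - expi t); rewrite /= sub0r normrN.
  have [tp|pt] := leP t pi.
    left; rewrite /= in_itv /= t0 /=; have := @sin_ge_half t; rewrite t0 tp => /(_ isT c1).
    have := ler_norm (sin t); lra.
  right; rewrite /= in_itv /=; apply/andP; split; last lra.
  have := @sin_ge_half (2 * pi - t).
  rewrite cos_2pi_sub sin_2pi_sub.
  have h : 0 <= 2 * pi - t <= pi by apply/andP; split; lra.
  move=> /(_ h c1); have := ler_norm (- sin t); rewrite normrN; lra.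
have mI : measurable (`[0, 2 * e]%classic `|` `[2 * pi - 2 * e, 2 * pi]%classic : set R) by exact: measurableU.
apply: (@le_trans _ _ (mu (`[0, 2 * e]%classic `|` `[2 * pi - 2 * e, 2 * pi]%classic))).
  apply: le_measure => //; rewrite inE//; exact: measurable_near_one.
have itvE a b : a < b -> mu `[a, b]%classic = (b - a)%:E.
  by move=> ab; rewrite lebesgue_measure_itv /= lte_fin ab -EFinB.
have m1 := itvE 0 (2 * e) ltac:(lra); have m2 := itvE (2 * pi - 2 * e) (2 * pi) ltac:(lra).
move: mI m1 m2; set A := `[0, 2 * e]%classic; set B := `[_, _]%classic => mI m1 m2.
apply: (@le_trans _ _ (mu A + mu B)%E).
  by apply: measureU2; exact: measurable_itv.
by rewrite m1 m2 -EFinD lee_fin; lra.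
Qed.


(** The arcs have radius [2 * offset k] rather than [offset k] so that one function of the angle
    serves all radii at once; see [phi_envelope]. *)
Definition envelope t : \bar R := (\sum_(0 <= k <oo) (hinge k ^+ 10 * \1_(near_one (2 * offset k)) t)%:E)%E.

Lemma envelope_term k : measurable_fun carc (fun t => (hinge k ^+ 10 * \1_(near_one (2 * offset k)) t)%:E).
Proof.
apply/measurable_EFinP; apply: measurable_funM; first exact: measurable_cst.
by apply: measurable_indic; exact: measurable_near_one.
Qed.

Lemma envelope_ge0 k t : (0 <= (hinge k ^+ 10 * \1_(near_one (2 * offset k)) t)%:E)%E.
Proof. by rewrite lee_fin mulr_ge0 ?exprn_ge0. Qed.

(** The term of index k integrates to at most 8 / T_k <= 8 / 2^(k+1). *)
Lemma envelope_integral : (\int[mu]_(t in carc) envelope t <= 8%:E)%E.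
Proof.
rewrite integral_nneseries; first last.
- by move=> k t _; exact: envelope_ge0.
- exact: envelope_term.
- exact: measurable_carc.
have term_le k : (\int[mu]_(t in carc) (hinge k ^+ 10 * \1_(near_one (2 * offset k)) t)%:E <= (8 * 2 ^- k.+1)%:E)%E.
  under eq_integral do rewrite EFinM.
  rewrite ge0_integralZl_EFin ?exprn_ge0//; first last.
  - by apply/measurable_EFinP; apply: measurable_indic; exact: measurable_near_one.
  - exact: measurable_carc.
  rewrite integral_indic//; [|exact: measurable_carc|exact: measurable_near_one].
  rewrite (setIidl (_ : near_one (2 * offset k) `<=` carc)); last by move=> t [].
  have e0 := offset_gt0 k.
  have e1 : 2 * offset k <= 2^-1.
    suff : offset k <= 2^-1 ^+ 2 by lra.
    rewrite exprVn lef_pV2 ?posrE ?exprn_gt0//.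
    apply: (@le_trans _ _ (hinge k ^+ 2)); last by rewrite ler_weXn2l.
    by rewrite lerXn2r ?nnegrE ?hinge_ge2.
  apply: (@le_trans _ _ ((hinge k ^+ 10)%:E * (4 * (2 * offset k))%:E)%E).
    by rewrite lee_wpmul2l ?lee_fin ?exprn_ge0// near_one_measure// mulr_gt0.
  rewrite -EFinM lee_fin.
  have -> : hinge k ^+ 10 * (4 * (2 * offset k)) = 8 * (hinge k)^-1.
    by rewrite /offset; field; rewrite gt_eqF.
  by rewrite ler_pM2l// lef_pV2 ?posrE ?exprn_gt0// hinge_ge_exp.
apply: lime_le.
  by apply: is_cvg_nneseries => k _ _; apply: integral_ge0 => t _; exact: envelope_ge0.
apply: nearW => n.
apply: (@le_trans _ _ (\sum_(0 <= k < n) (8 * 2 ^- k.+1)%:E)%E); first exact: lee_sum.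
rewrite sumEFin lee_fin -mulr_sumr -[leRHS]mulr1 ler_pM2l//.
suff -> : \sum_(0 <= k < n) 2 ^- k.+1 = 1 - 2 ^- n :> R by rewrite gerBl invr_ge0 exprn_ge0.
elim: n => [|n IH]; first by rewrite big_geq// expr0 invr1 subrr.
by rewrite big_nat_recr//= IH exprS; field; rewrite expf_neq0.
Qed.

Lemma measurable_envelope : measurable_fun carc envelope.
Proof. apply: ge0_emeasurable_sum => [k t _ _|k _]; [exact: envelope_ge0|exact: envelope_term]. Qed.

Lemma envelope_integrable : mu.-integrable carc envelope.
Proof.
apply/integrableP; split; first exact: measurable_envelope.
under eq_integral.
  by move=> t _; rewrite gee0_abs; [over|apply: nneseries_ge0 => k _ _; exact: envelope_ge0].
exact: le_lt_trans envelope_integral (ltry _).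
Qed.

(** Radii r < 1 are used for the H^1 means of a composition, and r = 1 for its boundary values. The
    constant [hinge 0 ^+ 10] covers the points far from 1, which lie on none of the arcs. *)
Lemma phi_envelope : exists G : R -> R, cint G /\ {ae mu, forall t, carc t -> forall r, 0 <= r <= 1 ->
  exists k, cabs (phi (r%:C * expi t)) <= 1 - weight k / 8 /\ hinge k ^+ 10 <= G t}.
Proof.
have E0 t : (0 <= envelope t)%E by apply: nneseries_ge0 => k _ _; exact: envelope_ge0.
exists (fun t => hinge 0 ^+ 10 + fine (envelope t)); split.
  apply: cintD; first exact: cint_cst.
  apply: (@le_integrable _ _ _ mu _ _ _ envelope) => //.
  - exact: measurable_carc.
  - apply/measurable_EFinP; apply: measurableT_comp => //; exact: measurable_envelope.
  - move=> t _ /=; rewrite ger0_norm ?fine_ge0// gee0_abs//.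
    by case: (envelope t) (E0 t) => //= _; rewrite leey.
  - exact: envelope_integrable.
have fin_ae : {ae mu, forall t, carc t -> envelope t \is a fin_num}.
  by apply: integrable_ae envelope_integrable; exact: measurable_carc.
apply: (filterS2 (ae_filter_ringOfSetsType mu) _ fin_ae (ae_neq0 R)) => t fE t0 ct r r01.
move: (fE ct) => {}fE; have /andP[r0 r1] := r01.
have tn : expi t != 1 :> R[i].
  by apply: expi_neq1; move: ct; rewrite /carc /= in_itv /= => /andP[h ->]; rewrite lt_neqAle eq_sym t0 h.
have cr := Re_expi_le1 t r01.
(* The radial displacement 1 - r is itself at most the distance from 1 to r [expi t]. *)
have half : cabs (1 - expi t) <= 2 * cabs (1 - r%:C * expi t).
  have h1 : 1 - r <= cabs (1 - r%:C * expi t).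
    by apply: le_trans (le_trans (ler_norm _) (cabs_dist _ _)); rewrite cabs1 cabs_scale.
  have -> : 1 - expi t = 1 - r%:C * expi t - (1 - r)%:C * expi t by rewrite rmorphB /=; ring.
  apply: le_trans (cabsB _ _) _; rewrite [X in _ + X]cabs_scale ?subr_ge0//; lra.
have u0 : 0 < cabs (1 - r%:C * expi t).
  have : 0 < cabs (1 - expi t) by rewrite cabs_gt0 subr_eq0 eq_sym.
  lra.
have ex : exists k, offset k.+1 <= cabs (1 - r%:C * expi t).
  by have [N HN] := offset_small u0; exists N; exact: HN.
(* Minimality of a positive index k means that the distance to 1 is below [offset k], which puts
   [expi t] on the k-th arc. *)
exists (ex_minn ex); case: ex_minnP => k ek kmin; split; first exact: phi_bound.
case: k ek kmin => [|k] ek kmin; first by rewrite lerDl fine_ge0.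
apply: (@le_trans _ _ (fine (envelope t))); last by rewrite lerDr exprn_ge0.
rewrite -lee_fin fineK//.
apply: le_trans (@nneseries_lim_ge _ _ xpredT 0 k.+2 (fun k _ _ => envelope_ge0 k t)).
rewrite big_nat_recr//= -[leLHS]add0e leeD//.
  by apply: sume_ge0 => j _; exact: envelope_ge0.
rewrite lee_fin indicE mem_set ?mulr1//; split => //; change (cabs (1 - expi t) < 2 * offset k.+1).
have : cabs (1 - r%:C * expi t) < offset k.+1.
  by rewrite ltNge; apply/negP => /kmin; rewrite ltnn.
move: half; move: (cabs _) (cabs _) => a b; lra.
Qed.

End Construction.

(** * Luxemburg norms *)

Section Luxemburg.
Context {R : realType} {d : measure_display} {X : measurableType d}.
Variables (nu : {measure set X -> \bar R}) (D : set X) (c : R) (p : X -> R[i]).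
Hypotheses (mD : measurable D) (c0 : 0 < c).
Local Notation Re := (@complex.Re R).
Local Notation Im := (@complex.Im R).
Local Notation Psi := (@Psi R).
Implicit Types (g : R[i] -> R[i]) (C M : R).

(** The common form of [area_int] and [circle_int], so that both norms share the lemmas below. *)
Definition scaled_int (h : R[i] -> \bar R) : \bar R := (c%:E * \int[nu]_(x in D) h (p x))%E.

Local Notation meas_on g := (cmeasurable D (fun x => g (p x))).

Definition in_LPsi g := meas_on g /\ exists C, 0 < C /\ (modular scaled_int Psi g C < +oo)%E.

Local Notation modul := (modular scaled_int Psi).
Local Notation lux := (lux_norm scaled_int Psi).

Lemma measurable_modular g C : meas_on g -> measurable_fun D (fun x => (Psi (cabs (g (p x)) / C))%:E).
Proof.
move=> mg; apply/measurable_EFinP; apply: measurableT_comp; first exact: measurable_Psi.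
by apply: measurable_funM; [exact: measurable_cabs|exact: measurable_cst].
Qed.

Lemma Psi_cabs_ge0 g C x : 0 < C -> (0 <= (Psi (cabs (g (p x)) / C))%:E)%E.
Proof. by move=> C0; rewrite lee_fin Psi_ge0// divr_ge0 ?cabs_ge0// ltW. Qed.

Lemma modular_le g C C' : meas_on g -> 0 < C -> C <= C' -> (modul g C' <= modul g C)%E.
Proof.
move=> mg C0 CC'; have C'0 : 0 < C' by exact: lt_le_trans CC'.
rewrite /modular /scaled_int lee_wpmul2l ?lee_fin ?(ltW c0)//.
apply: ge0_le_integral => //.
- by move=> x _; exact: Psi_cabs_ge0.
- exact: measurable_modular.
- exact: measurable_modular.
- by move=> x _; rewrite lee_fin Psi_mono// ler_wpM2l ?cabs_ge0// lef_pV2.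
Qed.

Lemma modular_scale g C M : meas_on g -> 0 < C -> 1 <= M -> (modul g (M * C) <= M^-1%:E * modul g C)%E.
Proof.
move=> mg C0 M1; have M0 : 0 < M by exact: lt_le_trans M1.
rewrite /modular /scaled_int muleCA lee_wpmul2l ?lee_fin ?(ltW c0)//.
rewrite -ge0_integralZl_EFin ?invr_ge0 ?(ltW M0)//; first last.
- exact: measurable_modular.
- by move=> x _; exact: Psi_cabs_ge0.
apply: ge0_le_integral => //.
- by move=> x _; apply: Psi_cabs_ge0; rewrite mulr_gt0.
- exact: measurable_modular.
- by apply: emeasurable_funM => //; exact: measurable_modular.
- move=> x _; rewrite -EFinM lee_fin (_ : _ / (M * C) = cabs (g (p x)) / C / M).
    by rewrite [leRHS]mulrC Psi_scale// divr_ge0 ?cabs_ge0// ltW.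
  by rewrite invfM mulrA mulrAC.
Qed.

(** Convexity lets a finite modular be scaled below 1. Without such a C, [inf] of the empty set
    would make the norm 0. *)
Lemma lux_has_inf g : in_LPsi g -> exists C, 0 < C /\ (modul g C <= 1)%E.
Proof.
move=> [mg [C [C0 fC]]].
have m0 : (0 <= modul g C)%E.
  by apply: mule_ge0; [rewrite lee_fin ltW|apply: integral_ge0 => x _; exact: Psi_cabs_ge0].
pose m := fine (modul g C).
have mE : modul g C = m%:E by rewrite fineK// ge0_fin_numE.
have mm0 : 0 <= m by rewrite fine_ge0.
exists ((1 + m) * C); split; first by rewrite mulr_gt0// ltr_wpDr.
apply: le_trans (modular_scale mg C0 _) _; first by rewrite lerDl.
rewrite mE -EFinM lee_fin mulrC ler_pdivrMr ?ltr_wpDr//; lra.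
Qed.

Lemma lux_lt g M : in_LPsi g -> lux g < M -> 0 < M /\ (modul g M <= 1)%E.
Proof.
move=> Lg; have [C HC] := lux_has_inf Lg.
have hi : has_inf [set C : R | 0 < C /\ (modul g C <= 1)%E].
  by split; [exists C|exists 0 => y [/ltW]].
move=> /(inf_lt hi.1) [C' [C'0 m1] C'M]; split; first exact: lt_trans C'M.
by apply: le_trans m1; apply: modular_le => //; [case: Lg|exact: ltW].
Qed.

Lemma lux_le g C : 0 < C -> (modul g C <= 1)%E -> lux g <= C.
Proof. by move=> C1 m1; apply: ge_inf => //; exists 0 => y [/ltW]. Qed.

Lemma lux_ge0 g : 0 <= lux g.
Proof.
rewrite /lux_norm; set S := [set C | _].
have [->|/set0P S0] := eqVneq S set0; first by rewrite inf0.
by apply: lb_le_inf => // y [/ltW].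
Qed.

End Luxemburg.

(** * Compactness on the Hardy-Orlicz space *)

Section HardyCompact.
Variable R : realType.
Local Notation mu := (@lebesgue_measure R).
Local Notation Re := (@complex.Re R).
Local Notation Im := (@complex.Im R).
Local Notation carc := (@carc R).
Local Notation cmeas := (cmeasurable carc).
Local Notation Psi := (@Psi R).
Local Notation phi := (@phi R).
Local Notation hinge := (@hinge R).
Local Notation weight := (@weight R).
Implicit Types (c t x y e r s M B : R) (a z w : R[i]) (f g h : R[i] -> R[i]) (F G H K : R -> R[i]).
Local Open Scope complex_scope.

Lemma circle_factor_gt0 : 0 < circle_factor R.
Proof. by rewrite invr_gt0 two_pi_gt0. Qed.

Lemma in_LPsi_circleP g : in_LPsi_circle Psi g <-> in_LPsi mu carc (circle_factor R) (@expi R) g.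
Proof. by split=> [[]|[[]]]. Qed.

Lemma Psi_ge_div x y C : 0 < C -> Psi (x / C) <= y -> x <= C * y.
Proof. by move=> C0 h; rewrite mulrC -ler_pdivrMr// (le_trans (Psi_ge _)). Qed.

(** [Psi_slope] splits |f^*| / M under the Poisson integral: the part x averages to x, and the
    multiple of Psi(|f^*| / M) is bounded by the maximum of the kernel times the modular. The level
    x is left free. *)
Lemma hardy_pointwise f M : hardy_orlicz Psi f -> hardy_norm Psi f < M ->
  forall a x, cabs a < 1 -> 0 < x -> cabs (f a) <= 2 * M * (x + x / Psi x * (2 / (1 - cabs a))).
Proof.
move=> [[af [M0 HM0]] Lf] nf a x a1 x0.
have {}af : analytic f by move=> z z1; apply/derivable_cdiff; exact: af.
have [M_gt0 m1] := @lux_lt _ _ _ mu carc (circle_factor R) (@expi R) (@measurable_carc R) circle_factor_gt0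
   (boundary f) M ((in_LPsi_circleP _).1 Lf) nf.
have [mF1 mF2 _] := Lf.
pose F t := boundary f (expi t).
have mF : cmeas F by split.
have mP : measurable_fun carc (fun t => Psi (cabs (F t) / M)).
  apply: measurableT_comp; first exact: measurable_Psi.
  by apply: measurable_funM; [exact: measurable_cabs|exact: measurable_cst].
have P0 t : 0 <= Psi (cabs (F t) / M) by rewrite Psi_ge0// divr_ge0 ?cabs_ge0// ltW.
have iP : cint (fun t => Psi (cabs (F t) / M)).
  apply/integrableP; split; first exact/measurable_EFinP.
  move: m1; rewrite /modular /scaled_int; under eq_integral do rewrite -/(F _).
  under [in X in _ -> X]eq_integral do rewrite /= ger0_norm//.
  case: (integral _ _ _) => [v _|/=|//]; first exact: ltry.
  by rewrite gt0_muley ?lte_fin ?circle_factor_gt0.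
have aP : ravg (fun t => Psi (cabs (F t) / M)) <= 1.
  by rewrite -lee_fin ravg_circle_int.
have iF : cint (fun t => cabs (F t)).
  apply: (@cint_le _ _ (fun t => M * Psi (cabs (F t) / M))).
  - by exact: measurable_cabs.
  - exact: cintZ.
  - by move=> t _; rewrite ger0_norm ?cabs_ge0//; exact: Psi_ge_div.
have bd : forall r, 0 <= r < 1 -> ravg (fun t => cabs (f (r%:C * expi t))) <= M0.
  move=> r r01; have /andP[r0 r1] := r01; rewrite -lee_fin ravg_circle_int; first exact: HM0.
  by apply: cint_cabs; apply: cintc_rcont; exact: rcont_analytic.
apply: le_trans (boundary_majorant af bd (fun=> erefl) mF iF a1) _.
rewrite -mulrA ler_pM2l// -/(F _).
have s0 : 0 <= 2 / (1 - cabs a) by rewrite divr_ge0// subr_ge0 ltW.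
have xP : 0 <= x / Psi x by rewrite divr_ge0 ?Psi_ge0// ltW.
have iPo : cint (poisson a) by have [] := cintc_rcont (rcont_poisson a1).
have iPF : cint (fun t => poisson a t * cabs (F t)).
  apply: (@cint_le _ _ (fun t => 2 / (1 - cabs a) * cabs (F t))).
  - by apply: measurable_funM; exact: cint_meas.
  - exact: cintZ.
  - move=> t _; rewrite normrM !ger0_norm ?cabs_ge0 ?poisson_ge0//.
    by rewrite ler_wpM2r ?cabs_ge0 ?poisson_le.
apply: (@le_trans _ _ (ravg (fun t => M * x * poisson a t + M * (x / Psi x) * (2 / (1 - cabs a)) * Psi (cabs (F t) / M)))).
  apply: ravg_le => //; first by apply: cintD; exact: cintZ.
  move=> t _; have := Psi_slope x0 (_ : 0 <= cabs (F t) / M).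
  rewrite divr_ge0 ?cabs_ge0 ?(ltW M_gt0)// => /(_ isT).
  rewrite ler_pdivrMr// => h.
  have p1 := poisson_le t a1.
  apply: le_trans (ler_wpM2l (poisson_ge0 t a1) h) _.
  move: (poisson a t) (2 / (1 - cabs a)) p1 (x / Psi x) xP (Psi (cabs (F t) / M)) (P0 t) => u s us q q0 P PP.
  rewrite -subr_ge0 (_ : _ - _ = M * (q * (P * (s - u)))); last by ring.
  by rewrite !mulr_ge0// ?subr_ge0// ltW.
rewrite ravgD; [|exact: cintZ|exact: cintZ].
rewrite (ravgZ _ iPo) (ravgZ _ iP) cavg_poisson// mulr1 mulrDr lerD2l [leRHS]mulrA ler_piMr//.
by apply: mulr_ge0 => //; apply: mulr_ge0 => //; exact: ltW.
Qed.

Definition growth_bound B f := forall k a, cabs a <= 1 - weight k / 8 -> cabs (f a) <= B * hinge k ^+ 7.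

(** The level x = 2 T_k is just past a hinge, so x / Psi(x) <= 2 T_k^-3, while the kernel is at most
    16 T_k^10. This gives 2 M (2 T_k + 32 T_k^7) <= 68 M T_k^7. *)
Lemma hardy_growth f M : hardy_orlicz Psi f -> hardy_norm Psi f < M -> growth_bound (68 * M) f.
Proof.
move=> Hf nf k a ak; have b0 := weight_gt0 R k; have T0 := hinge_gt0 R k; have T1 := hinge_ge1 R k.
have a1 : cabs a < 1 by lra.
have M0 : 0 < M.
  have [_ Lf] := Hf.
  by have [] := @lux_lt _ _ _ mu carc (circle_factor R) (@expi R) (@measurable_carc R) circle_factor_gt0
    (boundary f) M ((in_LPsi_circleP _).1 Lf) nf.
apply: le_trans (hardy_pointwise Hf nf a1 (_ : 0 < 2 * hinge k)) _; first by rewrite mulr_gt0.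
have P4 : hinge k ^+ 4 <= Psi (2 * hinge k).
  by apply: le_trans (Psi_hinge k _); rewrite exprSr ler_pM2l ?exprn_gt0//; lra.
have q1 : 2 * hinge k / Psi (2 * hinge k) <= 2 * hinge k / hinge k ^+ 4.
  rewrite ler_pM2l ?mulr_gt0// lef_pV2 ?posrE ?exprn_gt0//.
  by apply: lt_le_trans P4; rewrite exprn_gt0.
have q2 : 2 / (1 - cabs a) <= 16 * hinge k ^+ 10.
  rewrite ler_pdivrMr ?subr_gt0//.
  have : weight k * hinge k ^+ 10 = 1 by rewrite /weight mulVf// gt_eqF// exprn_gt0.
  have : 0 < hinge k ^+ 10 by rewrite exprn_gt0.
  move: (hinge k ^+ 10) (weight k) ak b0 => q b ak b0 q0 bq; nra.
have q3 : 2 * hinge k / Psi (2 * hinge k) * (2 / (1 - cabs a)) <= 32 * hinge k ^+ 7.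
  apply: le_trans (ler_pM _ _ q1 q2) _.
  - by rewrite divr_ge0 ?Psi_ge0 ?mulr_ge0// ltW.
  - by rewrite divr_ge0// subr_ge0 ltW.
  - by rewrite le_eqVlt; apply/orP; left; apply/eqP; field; rewrite gt_eqF.
have q4 : hinge k <= hinge k ^+ 7 by rewrite -{1}(expr1 (hinge k)) ler_weXn2l.
rewrite (_ : 68 * M * hinge k ^+ 7 = 2 * M * (34 * hinge k ^+ 7)); last by ring.
by rewrite ler_pM2l ?mulr_gt0//; lra.
Qed.

(** Once T_k >= L, the argument is at most T_k^8 <= T_(k+1), where the slope bound T_k^3 applies;
    the finitely many earlier k are absorbed in the constant. *)
Lemma Psi_growth (L : R) : 0 <= L -> exists K : R, forall k, Psi (L * hinge k ^+ 7) <= K * hinge k ^+ 10.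
Proof.
move=> L0; have [N HN] := hinge_unbounded L.
exists (L + Psi (L * hinge N ^+ 7)) => k; have T0 := hinge_gt0 R k; have T1 := hinge_ge1 R k.
have PN : 0 <= Psi (L * hinge N ^+ 7) by rewrite Psi_ge0// mulr_ge0// exprn_ge0// ltW// hinge_gt0.
have T10 : 1 <= hinge k ^+ 10 by rewrite exprn_ege1.
have [Nk|kN] := leqP N k.
  have LT : L * hinge k ^+ 7 <= hinge k.+1.
    rewrite hingeS; apply: (@le_trans _ _ (hinge k * hinge k ^+ 7)).
      by rewrite ler_pM2r ?exprn_gt0// HN.
    by rewrite -exprS ler_weXn2l.
  apply: le_trans (Psi_le (mulr_ge0 L0 _) LT) _; first by rewrite exprn_ge0// ltW.
  rewrite mulrCA -exprD mulrDl lerDl mulr_ge0//; lra.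
apply: (@le_trans _ _ (Psi (L * hinge N ^+ 7))).
  by rewrite Psi_mono// ler_wpM2l// lerXn2r ?nnegrE ?hinge_ge0// hinge_mono// ltnW.
rewrite mulrDl -[leLHS]add0r lerD//; first by apply: mulr_ge0 => //; lra.
by rewrite ler_peMr.
Qed.

(** The functions and radii are quantified inside the almost everywhere statement: one null set
    serves the whole family. An arbitrary scale L is allowed, since norm convergence requires the
    modular at every scale. *)
Lemma growth_envelope B (L : R) : 0 <= B -> 0 <= L -> exists G : R -> R, cint G /\
  {ae mu, forall t, carc t -> forall f r, growth_bound B f -> 0 <= r <= 1 ->
   Psi (cabs (f (phi (r%:C * expi t))) * L) <= G t}.
Proof.
move=> B0 L0; have [K HK] := Psi_growth (mulr_ge0 B0 L0).
have K0 : 0 <= K.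
  have := HK 0%N; have := exprn_gt0 10 (hinge_gt0 R 0).
  have : 0 <= Psi (B * L * hinge 0 ^+ 7) by rewrite Psi_ge0// !mulr_ge0// exprn_ge0// ltW// hinge_gt0.
  move: (Psi _) (_ ^+ 10) => u v u0 v0 h; have : 0 <= K * v by lra.
  by rewrite pmulr_lge0.
have [G [iG aeG]] := phi_envelope R.
exists (fun t => K * G t); split; first exact: cintZ.
apply: ae_sub aeG => t h ct f r gf r01; have [k [h1 h2]] := h ct r r01.
apply: (@le_trans _ _ (K * hinge k ^+ 10)); last by rewrite ler_wpM2l.
apply: le_trans (HK k); rewrite Psi_mono// (_ : B * L * _ = B * hinge k ^+ 7 * L); last by ring.
by rewrite ler_wpM2r// gf.
Qed.

Lemma growth_boundB B f g : growth_bound B f -> growth_bound B g -> growth_bound (B + B) (fun z => f z - g z).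
Proof.
by move=> hf hg k a ak; apply: le_trans (cabsB _ _) _; rewrite mulrDl lerD ?hf ?hg.
Qed.

(** For t other than 0 the point phi([expi t]) is inside the disc, so the radial limit is an
    interior value of [f]. *)
Lemma boundary_comp f t : analytic f -> carc t -> t != 0 ->
  boundary (fun z => f (phi z)) (expi t) = f (phi (expi t)).
Proof.
move=> af; rewrite /carc /= in_itv /= => /andP[t0 t2] tn0.
have p1 : cabs (phi (expi t)) < 1.
  apply: phi_lt1; first by apply: cabs_Re_le1; rewrite cabs_expi.
  by apply: expi_neq1; rewrite t2 lt_neqAle eq_sym tn0 t0.
apply: radial_cvg_boundary => e e0; have [d d0 H] := analytic_ccont af p1 e0.
have d20 : 0 < d / 2 by lra.
have [d1 d10 H1] := phi_radial t d20; exists d1 => // r rd r1; apply: H.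
apply: le_lt_trans (H1 r rd r1) _; lra.
Qed.

Lemma carc_split : carc = [set 0] `|` `]0, (2 * pi)[%classic.
Proof.
have p := two_pi_gt0 R.
apply/seteqP; split => t; rewrite /carc /= !in_itv /=.
  by move=> /andP[]; rewrite le_eqVlt => /orP[/eqP<-|->] ->; [left|right].
by move=> [->|/andP[/ltW -> ->]//]; rewrite lexx p.
Qed.

(** The factor [rad n] moves phi(1) = 1 into the disc, so the approximants are continuous on the
    whole circle. Their convergence may fail at t = 0, which is therefore split off as a
    singleton. *)
Lemma measurable_boundary_comp f : analytic f ->
  cmeas (fun t => boundary (fun z => f (phi z)) (expi t)).
Proof.
move=> af; pose F n t := f ((rad R n)%:C * phi (expi t)).
have zE t : Re (expi t) <= 1 :> R by apply: cabs_Re_le1; rewrite cabs_expi.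
have p1 t : cabs (phi (expi t)) <= 1.
  rewrite -(@ler_pXn2r _ 2)// ?nnegrE ?cabs_ge0//; have := wser_sqr (zE t); rewrite /phi !cabs_sqr expr1n.
  by case: (wser _) => x y /=; nra.
have mF n : cmeas (F n).
  apply/cmeas_rcont; apply: (@rcont_comp R (fun w => f ((rad R n)%:C * w))); first exact: rcont_phi_expi.
  move=> t; apply: cdiffable_ccont.
  apply: (@cdiffable_comp _ (fun w => (rad R n)%:C * w) f).
    by apply: cdiffableM; [exact: cdiffable_cst|exact: cdiffable_id].
  apply: af; have /andP[r0 r1] := rad01 R n.
  rewrite cabsM cabs_real ger0_norm ?(ltW r0)// (le_lt_trans _ r1)// ler_piMr// ltW//.
have cF t : (`]0, (2 * pi)[%classic : set R) t -> ccvg (F ^~ t) (boundary (fun z => f (phi z)) (expi t)).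
  rewrite /= in_itv /= => /andP[t0 t2].
  have tn : t != 0 by rewrite gt_eqF.
  rewrite boundary_comp//; last by rewrite /carc /= in_itv /= t2 ltW.
  apply: (@ccvg_comp R f (fun n => (rad R n)%:C * phi (expi t))).
    apply: analytic_ccont => //; apply: phi_lt1 => //; apply: expi_neq1; by rewrite t0.
  by have := ccvg_scale (phi (expi t)) (@rad_cvg R); rewrite (_ : 1%:C = 1)// mul1r.
have sub : (`]0, (2 * pi)[%classic : set R) `<=` carc by rewrite carc_split; right.
split; rewrite carc_split; apply/measurable_funU => //; (split; first exact: measurable_fun_set1).
  apply: (@measurable_fun_cvg _ _ _ _ (fun n => Re \o F n)).
    by move=> n; have [h _] := mF n; apply: measurable_funS h; [exact: measurable_carc|].
  by move=> t /cF/ccvgP[].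
apply: (@measurable_fun_cvg _ _ _ _ (fun n => Im \o F n)).
  by move=> n; have [_ h] := mF n; apply: measurable_funS h; [exact: measurable_carc|].
by move=> t /cF/ccvgP[].
Qed.

Lemma scale1 t : 1%:C * expi t = expi t :> R[i].
Proof. by rewrite (_ : 1%:C = 1)// mul1r. Qed.

Lemma ae_le_integral (F K : R -> R) : measurable_fun carc F -> (forall t, 0 <= F t) -> cint K ->
  {ae mu, forall t, carc t -> F t <= K t} -> (\int[mu]_(t in carc) (F t)%:E <= \int[mu]_(t in carc) (K t)%:E)%E.
Proof.
move=> mF F0 iK FK.
have iK' := cint_abs iK; have mK := cint_meas iK.
have K0 : ae_eq mu carc (fun t => (F t)%:E) (fun t => (Num.min (F t) `|K t|)%:E).
  by apply: ae_sub FK => t h ct; rewrite (min_idPl _)// (le_trans (h ct))// ler_norm.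
have Ka : ae_eq mu carc (fun t => (K t)%:E) (fun t => (`|K t|)%:E).
  by apply: ae_sub FK => t h ct; rewrite ger0_norm// (le_trans _ (h ct)).
have -> : (\int[mu]_(t in carc) (F t)%:E = \int[mu]_(t in carc) (Num.min (F t) `|K t|)%:E)%E.
  apply: ae_eq_integral => //.
  - exact: measurable_carc.
  - exact/measurable_EFinP.
  - by apply/measurable_EFinP/measurable_minr => //; exact: cint_meas.
have -> : (\int[mu]_(t in carc) (K t)%:E = \int[mu]_(t in carc) (`|K t|)%:E)%E.
  apply: ae_eq_integral => //.
  - exact: measurable_carc.
  - exact/measurable_EFinP.
  - by apply/measurable_EFinP; exact: cint_meas.
apply: ge0_le_integral.
- exact: measurable_carc.
- by move=> t _; rewrite lee_fin le_min F0 normr_ge0.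
- by apply/measurable_EFinP/measurable_minr => //; exact: cint_meas.
- by apply/measurable_EFinP; exact: cint_meas.
- by move=> t _; rewrite lee_fin ge_min lexx orbT.
Qed.

Lemma hardy_orlicz_comp f B : 0 <= B -> analytic f -> growth_bound B f -> hardy_orlicz Psi (fun z => f (phi z)).
Proof.
move=> B0 af gf; have [G [iG aeG]] := growth_envelope B0 (ler01 : 0 <= 1 :> R).
have ac : analytic (fun z => f (phi z)).
  move=> z z1; apply: cdiffable_comp; first exact: phi_analytic.
  by apply: af; have [_] := phi_selfmap R; exact.
split; first split.
- by move=> z z1; apply/derivable_cdiff; exact: ac.
- exists (ravg G) => r r0 r1.
  have rc : rcont (fun t => f (phi (r%:C * expi t))) by apply: (@rcont_analytic R _ r ac); rewrite r0.
  rewrite (ravg_circle_int iG) lee_wpmul2l ?lee_fin ?(ltW circle_factor_gt0)//.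
  apply: ae_le_integral => //.
  + by apply: cint_meas; apply: cint_cabs; exact: cintc_rcont rc.
  + by move=> t; exact: cabs_ge0.
  + apply: ae_sub aeG => t h ct; have := h ct f r gf; rewrite r0 (ltW r1) mulr1 => /(_ isT).
    exact: le_trans (Psi_ge _).
- have [m1 m2] := measurable_boundary_comp af; split => //.
  exists 1; split => //; rewrite /modular /circle_int circle_arcE.
  have mB : measurable_fun carc (fun t => cabs (boundary (fun z => f (phi z)) (expi t))).
    by exact: measurable_cabs.
  have le : (\int[mu]_(t in carc) (Psi (cabs (boundary (fun z => f (phi z)) (expi t)) / 1))%:E
    <= \int[mu]_(t in carc) (G t)%:E)%E.
    apply: ae_le_integral => //.
    + apply: measurableT_comp; first exact: measurable_Psi.
      by under eq_fun do rewrite divr1.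
    + by move=> t; rewrite Psi_ge0// divr_ge0 ?cabs_ge0.
    + apply: (filterS2 (ae_filter_ringOfSetsType mu) _ aeG (ae_neq0 R)) => t h t0 ct.
      have := h ct f 1 gf; rewrite lexx ler01 => /(_ isT).
      by rewrite scale1 mulr1 divr1 boundary_comp.
  apply: le_lt_trans (lee_wpmul2l _ le) _; first by rewrite lee_fin ltW// circle_factor_gt0.
  by rewrite -(ravg_circle_int iG) ltry.
Qed.

Lemma Psi_near0 e : 0 < e -> exists2 d, 0 < d & forall x, 0 <= x -> x <= d -> Psi x <= e.
Proof.
move=> e0; have T0 := exprn_gt0 3 (hinge_gt0 R 0); exists (Num.min 1 (e / hinge 0 ^+ 3)).
  by rewrite lt_min ltr01 divr_gt0.
move=> x x0; rewrite le_min => /andP[x1 x2].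
apply: le_trans (Psi_le (k := 0) x0 _) _; first exact: le_trans x1 (hinge_ge1 R 1).
by rewrite mulrC -ler_pdivlMr.
Qed.

(** The norm is at most e once the modular at scale e is at most 1. That modular tends to 0 by
    dominated convergence, with the majorant of [growth_envelope] at L = 1 / e. *)
Lemma hardy_norm_comp (h_ : nat -> R[i] -> R[i]) B : 0 <= B -> (forall n, analytic (h_ n)) ->
  (forall n, growth_bound B (h_ n)) -> (forall z, cabs z < 1 -> ccvg (h_ ^~ z) 0) ->
  hardy_norm Psi (fun z => h_ n (phi z)) @[n --> \oo] --> 0.
Proof.
move=> B0 ah gh ch; apply/cvgrPdist_le => e e0.
have [G [iG aeG]] := growth_envelope B0 (ltac:(by rewrite invr_ge0 ltW) : 0 <= e^-1).
pose b n t := boundary (fun z => h_ n (phi z)) (expi t).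
pose F n t := (Psi (cabs (b n t) / e))%:E.
have mF n : measurable_fun carc (F n).
  apply/measurable_EFinP; apply: measurableT_comp; first exact: measurable_Psi.
  have [m1 m2] := measurable_boundary_comp (ah n).
  by apply: measurable_funM => //; exact: measurable_cabs.
have F0 n t : (0 <= F n t)%E by rewrite lee_fin Psi_ge0// divr_ge0 ?cabs_ge0// ltW.
have bE n t : carc t -> t != 0 -> b n t = h_ n (phi (expi t)) by move=> ct t0; exact: boundary_comp.
have [|||||_ _ L] := @dominated_convergence _ _ R mu carc (@measurable_carc R) F (cst 0%E) (EFin \o G).
- exact: mF.
- exact: measurable_cst.
- apply: ae_sub (ae_neq0 R) => t t0 ct.
  have p1 : cabs (phi (expi t)) < 1.
    apply: phi_lt1; first by apply: cabs_Re_le1; rewrite cabs_expi.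
    by apply: expi_neq1; move: ct; rewrite /carc /= in_itv /= => /andP[h ->]; rewrite lt_neqAle eq_sym t0 h.
  apply/fine_cvgP; split; first exact: nearW.
  apply/cvgrPdist_le => d d0; have [d1 d10 H1] := Psi_near0 d0.
  have d2 : 0 < d1 * e by rewrite mulr_gt0.
  have /cvgrPdist_le/(_ _ d2) := ch _ p1; apply: filterS => n.
  rewrite subr0 !sub0r !normrN !ger0_norm ?cabs_ge0//; last by rewrite /= Psi_ge0// divr_ge0 ?cabs_ge0// ltW.
  by move=> h; rewrite /= bE// H1 ?ler_pdivrMr// divr_ge0 ?cabs_ge0// ltW.
- exact: iG.
- apply: (filterS2 (ae_filter_ringOfSetsType mu) _ aeG (ae_neq0 R)) => t h t0 n ct.
  rewrite gee0_abs ?F0//= lee_fin bE//; have := h ct (h_ n) 1 (gh n); rewrite lexx ler01 => /(_ isT).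
  by rewrite scale1.
have {}L : (\int[mu]_(t in carc) F n t)%E @[n --> \oo] --> 0%E.
  by move: L; rewrite integral0.
have p0 := two_pi_gt0 R.
have : \forall n \near \oo, (\int[mu]_(t in carc) F n t <= (2 * pi)%:E)%E.
  have /fine_cvgP[f1 /cvgrPdist_le/(_ _ p0)] := L.
  apply: filterS2 f1 => n f1; rewrite sub0r normrN => h.
  by rewrite -(fineK f1) lee_fin (le_trans _ h)// ler_norm.
apply: filterS => n h; rewrite sub0r normrN ger0_norm ?lux_ge0//.
apply: (@lux_le _ _ _ mu carc (circle_factor R) (@expi R)) => //.
apply: le_trans (lee_wpmul2l _ h) _; first by rewrite lee_fin ltW// circle_factor_gt0.
by rewrite -EFinM lee_fin /circle_factor mulVf// gt_eqF.
Qed.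

Theorem hardy_compact : compact_op (hardy_orlicz Psi) (hardy_norm Psi) (comp_op phi).
Proof.
move=> u Hu [M HM]; pose M' := `|M| + 1.
have nM n : hardy_norm Psi (u n) < M'.
  by apply: le_lt_trans (HM n) _; rewrite /M' (le_lt_trans (ler_norm _))// ltrDl.
have M'0 : 0 <= M' by rewrite addr_ge0.
have gu n : growth_bound (68 * M') (u n) := hardy_growth (Hu n) (nM n).
have B0 : 0 <= 68 * M' by rewrite mulr_ge0.
have au n : analytic (u n).
  by move=> z z1; apply/derivable_cdiff; have [[h _] _] := Hu n; exact: h.
(* The growth bound at an index k with b_k / 8 <= 1 - r is uniform in n on |z| <= r. *)
have lu : locally_bounded u.
  move=> r r1; have e0 : 0 < 8 * (1 - r) by rewrite mulr_gt0// subr_gt0.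
  have [k bk] := weight_small e0; exists (68 * M' * hinge k ^+ 7) => n z zr.
  by apply: gu; have := weight_gt0 R k; lra.
have [sg [f [sgi af cf]]] := montel au lu.
have gf : growth_bound (68 * M') f.
  move=> k a ak; have b0 := weight_gt0 R k; have a1 : cabs a < 1 by lra.
  by apply: (ccvg_le (cf a a1)) => n; exact: gu.
exists sg, (fun z => f (phi z)); split => //; first exact: hardy_orlicz_comp B0 af gf.
apply: (@hardy_norm_comp (fun n w => u (sg n) w - f w) (68 * M' + 68 * M')).
- exact: addr_ge0.
- by move=> n z z1; apply: cdiffableB; [exact: au|exact: af].
- by move=> n; exact: growth_boundB.
- by move=> z z1; have := ccvgB_cst (f z) (cf z z1); rewrite subrr.
Qed.

End HardyCompact.

(** * Noncompactness on the Bergman-Orlicz space *)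

Section BergmanNoncompact.
Variable R : realType.
Local Notation mu := (@lebesgue_measure R).
Local Notation Re := (@complex.Re R).
Local Notation Im := (@complex.Im R).
Local Notation Psi := (@Psi R).
Local Notation phi := (@phi R).
Local Notation hinge := (@hinge R).
Local Notation weight := (@weight R).
Local Notation offset := (@offset R).
Local Notation discRR := (@discRR R).
Local Notation cplx := (@cplx R).
Implicit Types (c t x y e r s M B C : R) (a z w : R[i]) (f g h : R[i] -> R[i]) (p : R * R).
Local Open Scope complex_scope.

Local Notation nu := ((@lebesgue_measure R) \x (@lebesgue_measure R))%E.

Lemma cmeasurable_cplx (D : set (R * R)) : measurable D -> cmeasurable D cplx.
Proof.
move=> mD; split; [rewrite (_ : _ \o _ = fst)//|rewrite (_ : _ \o _ = snd)//].
  by apply: measurable_funTS; exact: measurable_fst.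
by apply: measurable_funTS; exact: measurable_snd.
Qed.

Lemma measurable_discRR : measurable discRR.
Proof.
have m : measurable_fun setT (fun p => cabs (cplx p)).
  have [h1 h2] := cmeasurable_cplx (@measurableT _ (R * R)%type).
  exact: measurable_cabs.
have := m measurableT `]-oo, 1[%classic (measurable_itv _).
rewrite setTI => h.
by rewrite (_ : discRR = (fun p => cabs (cplx p)) @^-1` `]-oo, 1[%classic)//; apply/seteqP; split => p /=; rewrite in_itv.
Qed.

Lemma area_factor_gt0 : 0 < area_factor R.
Proof. by rewrite invr_gt0 pi_gt0. Qed.

Lemma in_LPsi_areaP g : in_LPsi_area Psi g <-> in_LPsi nu discRR (area_factor R) cplx g.
Proof. by split=> [[]|[[]]]. Qed.

Lemma discRR_Re p : discRR p -> Re (cplx p) <= 1.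
Proof. by move=> /ltW; exact: cabs_Re_le1. Qed.

Lemma cmeasurable_phi : cmeasurable discRR (phi \o cplx).
Proof.
have mc := cmeasurable_cplx measurable_discRR.
have m1 : cmeasurable discRR (fun p => 1 - cplx p) by apply: cmeasurableB => //; exact: cmeasurable_cst.
apply: cmeasurableB; first exact: cmeasurable_cst.
apply: (@cmeasurable_lim _ _ _ _ (fun n p => wsum n (cplx p))); last first.
  by move=> p /discRR_Re; exact: wsum_wser.
move=> n; rewrite /wsum; elim: n => [|n IH].
  by under eq_fun do rewrite big_ord0; exact: cmeasurable_cst.
under eq_fun do rewrite big_ord_recr /=; apply: cmeasurableD => //.
apply: cmeasurableM; first exact: cmeasurable_cst.
apply: cmeasurableM => //; apply: (@cmeasurableV _ _ _ _ _ (offset n.+1)).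
- exact: offset_gt0.
- by move=> p /discRR_Re; exact: vterm_den.
- by apply: cmeasurableD => //; exact: cmeasurable_cst.
Qed.

(* Bounded by [hinge k.+1], of that order where |1 - z| is at most [weight k],
   and at most 1 where it exceeds [hinge k ^- 8]. *)
Definition peak k z : R[i] := (hinge k.+1)%:C * ((weight k)%:C / (1 - z + (weight k)%:C)) ^+ 8.

Lemma peak_den k z : Re z <= 1 ->
  weight k <= cabs (1 - z + (weight k)%:C) /\ cabs (1 - z) <= cabs (1 - z + (weight k)%:C).
Proof.
move=> z1; have b0 := weight_gt0 R k; split.
  apply: le_trans (le_trans (ler_norm _) (Re_le_cabs _)).
  by case: z z1 => x y /=; lra.
rewrite -(@ler_pXn2r _ 2)// ?nnegrE ?cabs_ge0// !cabs_sqr.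
by move: b0; case: z z1 => x y /= ; set b := weight k; nra.
Qed.

Lemma peakE k z : cabs (peak k z) = hinge k.+1 * (weight k / cabs (1 - z + (weight k)%:C)) ^+ 8.
Proof.
by rewrite /peak cabsM cabsX cabsM cabsV !cabs_real !ger0_norm ?hinge_ge0 ?weight_ge0.
Qed.

Lemma peak_le k z : Re z <= 1 -> cabs (peak k z) <= hinge k.+1.
Proof.
move=> z1; have [h1 h2] := peak_den k z1; have b0 := weight_gt0 R k.
rewrite peakE ler_piMr ?hinge_ge0// exprn_ile1 ?divr_ge0 ?cabs_ge0 ?(ltW b0)//.
by rewrite ler_pdivrMr ?mul1r// (lt_le_trans b0).
Qed.

Lemma peak_far k z : Re z <= 1 -> z != 1 -> cabs (peak k z) <= hinge k.+1 * (weight k / cabs (1 - z)) ^+ 8.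
Proof.
move=> z1 zn; have [h1 h2] := peak_den k z1; have b0 := weight_gt0 R k.
have u0 : 0 < cabs (1 - z) by rewrite cabs_gt0 subr_eq0 eq_sym.
rewrite peakE ler_pM2l ?hinge_gt0// lerXn2r ?nnegrE ?divr_ge0 ?cabs_ge0 ?(ltW b0)//.
by rewrite ler_pM2l// lef_pV2 ?posrE// (lt_le_trans b0).
Qed.

Lemma peak_analytic k : analytic (peak k).
Proof.
move=> z z1; apply: cdiffableM; first exact: cdiffable_cst.
apply: cdiffableX; apply: cdiffableM; first exact: cdiffable_cst.
apply: cdiffableV.
  apply: cdiffableD; last exact: cdiffable_cst.
  by apply: cdiffableB; [exact: cdiffable_cst|exact: cdiffable_id].
by rewrite -cabs_gt0; have [h _] := peak_den k (cabs_Re_le1 (ltW z1)); exact: lt_le_trans (weight_gt0 R k) h.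
Qed.

Lemma cmeasurable_peak k (F : R * R -> R[i]) : (forall p, discRR p -> Re (F p) <= 1) ->
  cmeasurable discRR F -> cmeasurable discRR (fun p => peak k (F p)).
Proof.
move=> F1 mF; apply: cmeasurableM; first exact: cmeasurable_cst.
apply: cmeasurableX; apply: cmeasurableM; first exact: cmeasurable_cst.
apply: (@cmeasurableV _ _ _ _ _ (weight k)).
- exact: weight_gt0.
- by move=> p /F1 h; have [] := peak_den k h.
- apply: cmeasurableD; last exact: cmeasurable_cst.
  by apply: cmeasurableB => //; exact: cmeasurable_cst.
Qed.

Definition rect (a b c e : R) : set (R * R) := `[a, b]%classic `*` `[c, e]%classic.

Lemma measurable_rect (a b c e : R) : measurable (rect a b c e).
Proof. by apply: measurableX; exact: measurable_itv. Qed.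

Lemma nu_rect (a b c e : R) : a < b -> c < e -> nu (rect a b c e) = ((b - a) * (e - c))%:E.
Proof.
move=> ab ce; transitivity (mu `[a, b]%classic * mu `[c, e]%classic)%E.
  by apply: product_measure1E; exact: measurable_itv.
by rewrite !lebesgue_measure_itv /= !lte_fin ab ce EFinM.
Qed.

Lemma nu_disc : (nu discRR <= 4%:E)%E.
Proof.
apply: (@le_trans _ _ (nu (rect (-1) 1 (-1) 1))); last first.
  by rewrite nu_rect ?lee_fin; lra.
apply: le_measure; rewrite ?inE; [exact: measurable_discRR|exact: measurable_rect|].
move=> p p1; have := le_lt_trans (Re_le_cabs _) p1; have := le_lt_trans (Im_le_cabs _) p1.
rewrite /rect /= !ltr_norml !in_itv /= => /andP[h1 h2] /andP[h3 h4].
by split; apply/andP; split; exact: ltW.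
Qed.

(** On the square of side 2 T_k^-8 around 1, Psi is at most T_k^15, contributing at most 4 / T_k.
    Elsewhere the eighth power gives T_k^12 (T_k^-2)^8 = T_k^-4 <= 1, where Psi is at most T_0^3 =
    8. The disc has area at most 4, whence 32 + 4. *)
Lemma peak_modular k : (modular (scaled_int nu discRR (area_factor R) cplx) Psi (peak k) 1 <= 36%:E)%E.
Proof.
have T0 := hinge_gt0 R k; have T1 := hinge_ge1 R k.
pose s := hinge k ^- 8; have s0 : 0 < s by rewrite invr_gt0 exprn_gt0.
pose S := rect (1 - s) (1 + s) (- s) s.
have bd p : discRR p -> Psi (cabs (peak k (cplx p)) / 1) <= 8 + hinge k ^+ 15 * \1_S p.
  move=> pd; have p1 := discRR_Re pd; rewrite divr1.
  have [Sp|Sp] := pselect (S p).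
    rewrite indicE mem_set// mulr1.
    apply: (@le_trans _ _ (hinge k ^+ 15)); last by rewrite lerDr.
    apply: le_trans (Psi_mono (peak_le k p1)) _.
    apply: le_trans (Psi_le (hinge_ge0 _ _) (lexx _)) _.
    by rewrite hingeS -exprD.
  rewrite indicE memNset// mulr0 addr0.
  have far : s <= cabs (1 - cplx p).
    rewrite leNgt; apply/negP => ns; apply: Sp.
    have := le_lt_trans (Re_le_cabs _) ns; have := le_lt_trans (Im_le_cabs _) ns.
    rewrite /S /rect /= !ltr_norml !in_itv /= => /andP[h1 h2] /andP[h3 h4].
    by split; apply/andP; split; lra.
  have pn : cplx p != 1.
    by apply/eqP => E; move: far; rewrite E subrr cabs0 leNgt s0.
  have pk : cabs (peak k (cplx p)) <= 1.
    apply: le_trans (peak_far k p1 pn) _.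
    apply: (@le_trans _ _ (hinge k.+1 * (weight k / s) ^+ 8)).
      rewrite ler_pM2l ?hinge_gt0// lerXn2r ?nnegrE ?divr_ge0 ?cabs_ge0 ?weight_ge0 ?(ltW s0)//.
      by rewrite ler_pM2l ?weight_gt0// lef_pV2 ?posrE// (lt_le_trans s0).
    rewrite hingeS /weight /s (_ : hinge k ^+ 12 * (hinge k ^- 10 / hinge k ^- 8) ^+ 8 = hinge k ^- 4).
      by rewrite invf_le1 ?exprn_gt0// exprn_ege1.
    by field; rewrite gt_eqF.
  apply: le_trans (Psi_mono pk) _; apply: le_trans (Psi_le (k := 0) ler01 (hinge_ge1 R 1)) _.
  by rewrite mulr1 /hinge expn0 expr1 -natrX ler_nat.
rewrite /modular /scaled_int.
have m8 : measurable_fun discRR (fun p => \1_S p : R).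
  by apply: measurable_indic; exact: measurable_rect.
have int_le : (\int[nu]_(p in discRR) (Psi (cabs (peak k (cplx p)) / 1))%:E <= 36%:E)%E.
  apply: (@le_trans _ _ (\int[nu]_(p in discRR) (8%:E + (hinge k ^+ 15)%:E * (\1_S p)%:E))%E).
    apply: ge0_le_integral.
    - exact: measurable_discRR.
    - by move=> p _; exact: Psi_cabs_ge0.
    - apply: (@measurable_modular _ _ _ discRR cplx).
      by apply: (@cmeasurable_peak k cplx discRR_Re); apply: cmeasurable_cplx; exact: measurable_discRR.
    - apply: emeasurable_funD; first exact: measurable_cst.
      by apply: emeasurable_funM; [exact: measurable_cst|exact/measurable_EFinP].
    - by move=> p /bd; rewrite -EFinM -EFinD lee_fin.
  rewrite ge0_integralD//; first last.
  - by apply: emeasurable_funM; [exact: measurable_cst|exact/measurable_EFinP].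
  - by move=> p _; rewrite mule_ge0// lee_fin ?exprn_ge0// ltW.
  - exact: measurable_discRR.
  rewrite integral_cst; last exact: measurable_discRR.
  rewrite ge0_integralZl_EFin ?exprn_ge0 ?(ltW T0)//; first last.
  - exact/measurable_EFinP.
  - exact: measurable_discRR.
  rewrite integral_indic; [|exact: measurable_discRR|exact: measurable_rect].
  have SD : (nu (S `&` discRR) <= ((2 * s) * (2 * s))%:E)%E.
    apply: (@le_trans _ _ (nu S)).
      apply: le_measure; rewrite ?inE; [|exact: measurable_rect|exact: subIsetl].
      by apply: measurableI; [exact: measurable_rect|exact: measurable_discRR].
    by rewrite nu_rect ?lee_fin; lra.
  apply: (@le_trans _ _ (8%:E * 4%:E + (hinge k ^+ 15)%:E * ((2 * s) * (2 * s))%:E)%E).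
    by apply: leeD; apply: lee_wpmul2l => //; rewrite ?lee_fin ?exprn_ge0 ?(ltW T0)// nu_disc.
  rewrite -!EFinM -EFinD lee_fin.
  have -> : hinge k ^+ 15 * (2 * s * (2 * s)) = 4 * (hinge k)^-1.
    by rewrite /s; field; rewrite gt_eqF.
  have : (hinge k)^-1 <= 1 by rewrite invf_le1.
  lra.
apply: le_trans (lee_wpmul2l _ int_le) _; first by rewrite lee_fin ltW// area_factor_gt0.
rewrite -EFinM lee_fin ler_piMl// invf_le1 ?pi_gt0// (le_trans _ (pi_ge2 R))//.
by rewrite ler1n.
Qed.

Lemma meas_peak k : cmeasurable discRR (fun p => peak k (cplx p)).
Proof. by apply: (@cmeasurable_peak k cplx discRR_Re); apply: cmeasurable_cplx; exact: measurable_discRR. Qed.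

Lemma peak_bergman k : bergman_orlicz Psi (peak k).
Proof.
split; first by move=> z z1; apply/derivable_cdiff; exact: peak_analytic.
have [m1 m2] := meas_peak k; split => //; exists 1; split => //.
by apply: le_lt_trans (peak_modular k) _; rewrite ltry.
Qed.

Lemma peak_norm k : bergman_norm Psi (peak k) <= 36.
Proof.
apply: (@lux_le _ _ _ nu discRR (area_factor R) cplx) => //.
have := @modular_scale _ _ _ nu discRR (area_factor R) cplx measurable_discRR area_factor_gt0 (peak k) 1 36 (meas_peak k) ltr01.
rewrite mulr1 ler1n => /(_ isT) /le_trans; apply.
apply: le_trans (lee_wpmul2l _ (peak_modular k)) _; first by rewrite lee_fin invr_ge0.
by rewrite -EFinM lee_fin mulVf// pnatr_eq0.
Qed.

(** One third, because |1 - z| <= 2 rho + rho on [core k], which must not exceed the radius b_k e_k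
    of [wser_small]. *)
Definition rho k : R := weight k * offset k / 3.

Lemma rho_gt0 k : 0 < rho k.
Proof. by rewrite divr_gt0// mulr_gt0 ?weight_gt0 ?offset_gt0. Qed.

Lemma rho_le k : rho k <= 3^-1.
Proof.
rewrite /rho -[leRHS]mul1r ler_pM2r// /weight /offset -invfM invf_le1 ?mulr_gt0 ?exprn_gt0 ?hinge_gt0//.
by rewrite -exprD exprn_ege1// hinge_ge1.
Qed.

Definition core k := rect (1 - 2 * rho k) (1 - rho k) 0 (rho k).

Lemma coreP k p : core k p -> 1 - 2 * rho k <= p.1 <= 1 - rho k /\ 0 <= p.2 <= rho k.
Proof. by move=> []; rewrite /= !in_itv. Qed.

Lemma core_disc k : core k `<=` discRR.
Proof.
move=> [x y] /coreP[/andP[/= x1 x2] /andP[/= y1 y2]].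
have r0 := rho_gt0 k; have r1 := rho_le k.
change (cabs (x +i* y) < 1); rewrite -(@ltr_pXn2r _ 2) ?nnegrE ?cabs_ge0 ?ler01// cabs_sqr /=.
move: (rho k) x1 x2 y2 r0 r1 => r *; nra.
Qed.

(** By [wser_small], 1 - phi is at most 3 b_k there, so the denominator of the peak is at most 4
    b_k. *)
Lemma peak_core k p : core k p -> hinge k.+1 / 4 ^+ 8 <= cabs (peak k (phi (cplx p))).
Proof.
move=> cp; have p1 := discRR_Re (core_disc cp).
have r0 := rho_gt0 k; have b0 := weight_gt0 R k.
have u : cabs (1 - cplx p) <= weight k * offset k.
  have -> : weight k * offset k = 3 * rho k by rewrite /rho; field.
  have [/andP[x1 x2] /andP[y1 y2]] := coreP cp.
  apply: le_trans (cabs_le_ReIm _) _; rewrite /= sub0r normrN (ger0_norm y1) ger0_norm; lra.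
have w := wser_small p1 u.
have d1 : 0 < cabs (1 - phi (cplx p) + (weight k)%:C).
  have h1 : Re (phi (cplx p)) <= 1.
    by apply/cabs_Re_le1/ltW; have [_] := phi_selfmap R; apply; exact: (core_disc cp).
  by have [h _] := peak_den k h1; exact: lt_le_trans h.
have d2 : cabs (1 - phi (cplx p) + (weight k)%:C) <= 4 * weight k.
  rewrite (_ : 1 - phi _ = wser (cplx p)); last by rewrite /phi; ring.
  apply: le_trans (cabsD _ _) _; rewrite cabs_real ger0_norm ?weight_ge0//; lra.
rewrite peakE ler_pM2l ?hinge_gt0// -exprVn lerXn2r ?nnegrE ?divr_ge0 ?cabs_ge0 ?weight_ge0//.
by rewrite ler_pdivlMr// ler_pdivrMl.
Qed.

(** Chosen so that the composed peak divided by it reaches 2 T_(k+1) on [core k], where the line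
    hinged at T_(k+1) has already climbed to T_(k+1)^4. *)
Definition threshold : R := (2 * 4 ^+ 8)^-1.

Lemma threshold_gt0 : 0 < threshold.
Proof. by rewrite invr_gt0 mulr_gt0// exprn_gt0. Qed.

Lemma meas_peak_phi k : cmeasurable discRR (fun p => peak k (phi (cplx p))).
Proof.
apply: (@cmeasurable_peak k (phi \o cplx)); last exact: cmeasurable_phi.
by move=> p pd; apply/cabs_Re_le1/ltW; have [_] := phi_selfmap R; apply.
Qed.

Lemma peak_phi_modular k :
  (1 < modular (scaled_int nu discRR (area_factor R) cplx) Psi (fun z => peak k (phi z)) threshold)%E.
Proof.
have T0 := hinge_gt0 R k; have c0 := threshold_gt0; have r0 := rho_gt0 k.
have Tk0 := hinge_gt0 R k.+1.
have low p : core k p -> hinge k ^+ 48 <= Psi (cabs (peak k (phi (cplx p))) / threshold).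
  move=> cp; apply: (@le_trans _ _ (Psi (2 * hinge k.+1))).
    apply: le_trans (Psi_hinge k.+1 _).
    rewrite (_ : 2 * hinge k.+1 - hinge k.+1 = hinge k.+1); last by ring.
    by rewrite -exprSr hingeS -exprM.
  rewrite Psi_mono// ler_pdivlMr//; apply: le_trans (peak_core cp).
  by rewrite /threshold le_eqVlt; apply/orP; left; apply/eqP; field.
have mF := @measurable_modular _ _ _ discRR cplx (fun z => peak k (phi z)) threshold (meas_peak_phi k).
have F0 p : (0 <= (Psi (cabs (peak k (phi (cplx p))) / threshold))%:E)%E.
  by rewrite lee_fin Psi_ge0// divr_ge0 ?cabs_ge0// ltW.
have nuc : nu (core k) = (rho k * rho k)%:E.
  by rewrite nu_rect; [congr EFin; ring|lra|lra].
have int_ge : ((hinge k ^+ 48 * (rho k * rho k))%:E <=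
    \int[nu]_(p in discRR) (Psi (cabs (peak k (phi (cplx p))) / threshold))%:E)%E.
  apply: (@le_trans _ _ (\int[nu]_(p in core k) (Psi (cabs (peak k (phi (cplx p))) / threshold))%:E)%E); last first.
    apply: ge0_subset_integral => //; [exact: measurable_rect|exact: measurable_discRR|exact: core_disc].
  rewrite EFinM -nuc -integral_cst; last exact: measurable_rect.
  apply: ge0_le_integral.
  - exact: measurable_rect.
  - by move=> p _; rewrite lee_fin exprn_ge0// ltW.
  - exact: measurable_cst.
  - by apply: measurable_funS mF; [exact: measurable_discRR|exact: core_disc].
  - by move=> p cp; rewrite lee_fin low.
rewrite /modular /scaled_int.
apply: lt_le_trans (lee_wpmul2l _ int_ge); last by rewrite lee_fin ltW// area_factor_gt0.
rewrite -EFinM lte_fin.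
(* Since T_k >= 2, this is at least 64 / 9, which exceeds 4 and hence pi. *)
have -> : hinge k ^+ 48 * (rho k * rho k) = hinge k ^+ 6 / 9.
  by rewrite /rho /weight /offset; field; rewrite gt_eqF.
rewrite ltr_pdivlMl ?pi_gt0// mulr1.
have : 2 ^+ 6 <= hinge k ^+ 6 by rewrite lerXn2r ?nnegrE ?hinge_ge2// ltW.
have := pihalf_lt2 R; have := pi_gt0 R.
by move: (pi) (hinge k ^+ 6) => q t q0 q4 t64; rewrite ltr_pdivlMr//; lra.
Qed.

(** At a fixed z the distance from phi z to 1 is a positive constant, while T_(k+1) b_k^8 =
    T_k^-68. *)
Lemma peak_phi_cvg (sg : nat -> nat) z : (forall m n, (m < n)%N -> (sg m < sg n)%N) ->
  cabs z < 1 -> ccvg (fun n => peak (sg n) (phi z)) 0.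
Proof.
move=> sgi z1; have p1 : cabs (phi z) < 1 by have [_] := phi_selfmap R; apply.
have pn : phi z != 1 by apply/eqP => E; move: p1; rewrite E cabs1 ltxx.
have u0 : 0 < cabs (1 - phi z) by rewrite cabs_gt0 subr_eq0 eq_sym.
apply/cvgrPdist_le => e e0.
have [N HN] := hinge_unbounded ((cabs (1 - phi z) ^+ 8 * e)^-1).
apply: filterS (nbhs_infty_ge N) => n Nn; rewrite subr0 sub0r normrN (ger0_norm (cabs_ge0 _)).
apply: le_trans (peak_far (sg n) (cabs_Re_le1 (ltW p1)) pn) _.
have T0 := hinge_gt0 R (sg n); have T1 := hinge_ge1 R (sg n).
have -> : hinge (sg n).+1 * (weight (sg n) / cabs (1 - phi z)) ^+ 8 = hinge (sg n) ^- 68 / cabs (1 - phi z) ^+ 8.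
  by rewrite hingeS /weight; field; rewrite !gt_eqF.
rewrite ler_pdivrMr ?exprn_gt0// mulrC.
have h := HN (sg n) (leq_trans Nn (increasing_geq n sgi)).
apply: (@le_trans _ _ (hinge (sg n))^-1).
  by rewrite lef_pV2 ?posrE ?exprn_gt0// -{1}(expr1 (hinge _)) ler_weXn2l.
by rewrite -[leRHS]invrK lef_pV2 ?posrE ?invr_gt0 ?mulr_gt0 ?exprn_gt0.
Qed.

Lemma Psi_half x y C : 0 < C -> 0 <= x -> 0 <= y -> Psi ((x + y) / (2 * C)) <= Psi (x / C) + Psi (y / C).
Proof.
move=> C0 x0 y0.
rewrite (_ : (x + y) / (2 * C) = 2^-1 * (x / C) + (1 - 2^-1) * (y / C)); last first.
  by field; rewrite gt_eqF.
apply: le_trans (Psi_convex _ _ _ _) _; [lra|lra|].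
have := Psi_ge0 (divr_ge0 x0 (ltW C0)); have := Psi_ge0 (divr_ge0 y0 (ltW C0)); lra.
Qed.

(** [lux_lt] draws a modular bound from a small norm only for members of the space, as the default
    value of [inf] could otherwise produce the small norm. The composed peak is bounded, hence
    harmless. *)
Lemma in_LPsi_peakB k g : in_LPsi_area Psi g ->
  in_LPsi nu discRR (area_factor R) cplx (fun z => peak k (phi z) - g z).
Proof.
move=> /in_LPsi_areaP[mg [C [C0 fC]]].
have mh : cmeasurable discRR (fun p => peak k (phi (cplx p)) - g (cplx p)).
  exact: (@cmeasurableB _ _ _ discRR (fun p => peak k (phi (cplx p))) (fun p => g (cplx p)) (meas_peak_phi k) mg).
split => //; exists (2 * C); split; first by rewrite mulr_gt0.
have mg' := @measurable_modular _ _ _ discRR cplx g C mg.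
have PT : 0 <= Psi (hinge k.+1 / C) by rewrite Psi_ge0// divr_ge0 ?hinge_ge0 ?(ltW C0).
have le : (\int[nu]_(p in discRR) (Psi (cabs (peak k (phi (cplx p)) - g (cplx p)) / (2 * C)))%:E <=
   (Psi (hinge k.+1 / C))%:E * nu discRR + \int[nu]_(p in discRR) (Psi (cabs (g (cplx p)) / C))%:E)%E.
  rewrite -integral_cst; last exact: measurable_discRR.
  rewrite -ge0_integralD//; first last.
  - by move=> p _; exact: Psi_cabs_ge0.
  - exact: measurable_discRR.
  apply: ge0_le_integral.
  - exact: measurable_discRR.
  - by move=> p _; rewrite lee_fin Psi_ge0// divr_ge0 ?cabs_ge0// mulr_ge0// ltW.
  - exact: (@measurable_modular _ _ _ discRR cplx (fun z => peak k (phi z) - g z) (2 * C) mh).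
  - by apply: emeasurable_funD => //; exact: measurable_cst.
  - move=> p pd; rewrite -EFinD lee_fin.
    have h1 : Re (phi (cplx p)) <= 1.
      by apply/cabs_Re_le1/ltW; have [_] := phi_selfmap R; apply.
    apply: (@le_trans _ _ (Psi ((hinge k.+1 + cabs (g (cplx p))) / (2 * C)))).
      rewrite Psi_mono// ler_pM2r ?invr_gt0 ?mulr_gt0//.
      by apply: le_trans (cabsB _ _) _; rewrite lerD2r peak_le.
    by apply: Psi_half; rewrite ?hinge_ge0 ?cabs_ge0.
have fg : (\int[nu]_(p in discRR) (Psi (cabs (g (cplx p)) / C))%:E < +oo)%E.
  move: fC; rewrite /modular /scaled_int.
  case: (integral _ _ _) => [v _|/=|//]; first exact: ltry.
  by rewrite gt0_muley ?lte_fin ?area_factor_gt0.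
rewrite /modular /scaled_int; apply: lte_mul_pinfty; rewrite ?lee_fin ?(ltW area_factor_gt0)//.
apply: le_lt_trans le _; apply: lte_add_pinfty => //.
apply: lte_mul_pinfty; rewrite ?lee_fin//.
by apply: le_lt_trans nu_disc _; rewrite ltry.
Qed.

(** From s <= Psi(s), the integral of |h| is at most e times that of Psi(|h| / e), which is at most
    pi < 4. *)
Lemma L1_le_lux h e : in_LPsi nu discRR (area_factor R) cplx h -> bergman_norm Psi h < e ->
  (\int[nu]_(p in discRR) (cabs (h (cplx p)))%:E <= (4 * e)%:E)%E.
Proof.
move=> Lh he.
have [e0 m1] := @lux_lt _ _ _ nu discRR (area_factor R) cplx measurable_discRR area_factor_gt0 h e Lh he.
have [mh _] := Lh; have mP := @measurable_modular _ _ _ discRR cplx h e mh.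
apply: (@le_trans _ _ (\int[nu]_(p in discRR) (e%:E * (Psi (cabs (h (cplx p)) / e))%:E))%E).
  apply: ge0_le_integral.
  - exact: measurable_discRR.
  - by move=> p _; rewrite lee_fin cabs_ge0.
  - by apply/measurable_EFinP; exact: (measurable_cabs mh).
  - by apply: emeasurable_funM => //; exact: measurable_cst.
  - by move=> p _; rewrite -EFinM lee_fin Psi_ge_div.
rewrite ge0_integralZl_EFin ?(ltW e0)//; first last.
- by move=> p _; exact: Psi_cabs_ge0.
- exact: measurable_discRR.
have m2 : (\int[nu]_(p in discRR) (Psi (cabs (h (cplx p)) / e))%:E <= pi%:E)%E.
  move: m1; rewrite /modular /scaled_int /area_factor => m1.
  rewrite -[leLHS]mul1e -(mulfV (lt0r_neq0 (pi_gt0 R))) EFinM -muleA -[leRHS]mule1.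
  by apply: lee_wpmul2l => //; rewrite lee_fin pi_ge0.
apply: le_trans (lee_wpmul2l _ m2) _; first by rewrite lee_fin ltW.
rewrite -EFinM lee_fin [leRHS]mulrC ler_pM2l//.
by have := pihalf_lt2 R; lra.
Qed.

(** A norm limit of a subsequence of composed peaks has to vanish almost everywhere, so their norms
    would fall below [threshold], against [peak_phi_modular]. *)
Theorem bergman_noncompact : ~ compact_op (bergman_orlicz Psi) (bergman_norm Psi) (comp_op phi).
Proof.
move=> /(_ peak peak_bergman (ex_intro _ 36 peak_norm)) [sg [g [sgi [ag Lg] cv]]].
pose h n z := peak (sg n) (phi z) - g z.
have Lh n : in_LPsi nu discRR (area_factor R) cplx (h n) by exact: in_LPsi_peakB.
have ch p : discRR p -> ccvg (fun n => h n (cplx p)) (- g (cplx p)).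
  by move=> pd; have := ccvgB_cst (g (cplx p)) (peak_phi_cvg sgi pd); rewrite sub0r.
have small e : 0 < e -> \forall n \near \oo, bergman_norm Psi (h n) < e.
  move=> e0; move/cvgrPdist_lt : cv => /(_ e e0); apply: filterS => n.
  by rewrite sub0r normrN; apply: le_lt_trans; exact: ler_norm.
pose F n (p : R * R) := (cabs (h n (cplx p)))%:E.
have mF n : measurable_fun discRR (F n).
  by apply/measurable_EFinP; apply: measurable_cabs; case: (Lh n).
have F0 n p : (0 <= F n p)%E by rewrite lee_fin cabs_ge0.
have L1 : (\int[nu]_(p in discRR) F n p)%E @[n --> \oo] --> 0%E.
  apply/fine_cvgP; split.
    apply: filterS (small 1 ltr01) => n hn; have := L1_le_lux (Lh n) hn.
    rewrite ge0_fin_numE; first by move=> /le_lt_trans; apply; exact: ltry.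
    by apply: integral_ge0 => p _.
  apply/cvgrPdist_le => e e0; have e4 : 0 < e / 4 by lra.
  apply: filterS (small _ e4) => n hn; have := L1_le_lux (Lh n) hn.
  have I0 : (0 <= \int[nu]_(p in discRR) F n p)%E by apply: integral_ge0 => p _.
  rewrite -/(F n _) (_ : 4 * (e / 4) = e); last by field.
  rewrite sub0r normrN /=; move: I0; rewrite -/(F n _); case: (integral _ _ _) => [v|//|//].
  by rewrite !lee_fin /= => v0; rewrite ger0_norm.
(* The differences converge to 0 in L^1 and to [- g] pointwise, so Fatou's lemma bounds the integral
   of |g| by 0. *)
have g0 : ae_eq nu discRR (fun p => (cabs (g (cplx p)))%:E) (cst 0%E).
  have mg : measurable_fun discRR (fun p => (cabs (g (cplx p)))%:E).
    by apply/measurable_EFinP; apply: (@measurable_cabs _ _ _ discRR (fun p => g (cplx p))); case: Lg.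
  apply/(ae_eq_integral_abs nu measurable_discRR mg).
  have := fatou nu measurable_discRR mF (fun n p _ => F0 n p).
  rewrite (cvg_limn_einf_sup L1).1 => ft.
  apply/eqP; rewrite eq_le integral_ge0 ?andbT; last by move=> p _; rewrite abse_ge0.
  apply: le_trans ft; rewrite le_eqVlt; apply/orP; left; apply/eqP.
  apply: eq_integral => p /set_mem pd; rewrite gee0_abs ?lee_fin ?cabs_ge0//.
  suff c : F n p @[n --> \oo] --> (cabs (g (cplx p)))%:E by have [-> _] := cvg_limn_einf_sup c.
  apply/fine_cvgP; split; first exact: nearW.
  apply/cvgrPdist_le => e e0; move/cvgrPdist_le : (ch p pd) => /(_ e e0); apply: filterS => n.
  rewrite sub0r normrN ger0_norm ?cabs_ge0//= => hn; apply: le_trans hn.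
  by rewrite -[cabs (g _)]cabsN distrC; exact: cabs_dist.
have [N _ /(_ N (leqnn N)) /=] := small _ threshold_gt0.
move=> /(@lux_lt _ _ _ nu discRR (area_factor R) cplx measurable_discRR area_factor_gt0 (h N) threshold (Lh N)) [_ m1].
have := peak_phi_modular (sg N); rewrite ltNge => /negP; apply; apply: le_trans m1.
(* As g vanishes almost everywhere, the modulars of [h N] and of the composed peak coincide. *)
rewrite /modular /scaled_int le_eqVlt; apply/orP; left; apply/eqP; congr (_ * _)%E.
apply: ae_eq_integral.
- exact: measurable_discRR.
- exact: (@measurable_modular _ _ _ discRR cplx (fun z => peak (sg N) (phi z)) threshold (meas_peak_phi _)).
- by apply: (@measurable_modular _ _ _ discRR cplx (h N) threshold); case: (Lh N).
- move: g0; apply: filterS => p gp pd.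
  have g00 : g (cplx p) = 0 by apply/eqP; rewrite -cabs_eq0; apply/eqP/EFin_inj; exact: gp pd.
  have -> : h N (cplx p) = peak (sg N) (phi (cplx p)) by rewrite /h g00; exact: subr0.
  reflexivity.
Qed.

End BergmanNoncompact.

Theorem theorem4p2 (R : realType) :
  exists (phi : R[i] -> R[i]) (Psi : R -> R),
    [/\ analytic_selfmap phi,
        Orlicz Psi,
        compact_op (hardy_orlicz Psi) (hardy_norm Psi) (comp_op phi)
      & ~ compact_op (bergman_orlicz Psi) (bergman_norm Psi) (comp_op phi)].
Proof.
exists (@phi R), (@Psi R); split.
- exact: phi_selfmap.
- exact: Psi_Orlicz.
- exact: hardy_compact.
- exact: bergman_noncompact.
Qed.
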